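(* For every $f\in{\cal AE}$ with divisor $D$, the zeros and poles of $f$ can be indexed as $D=((a_n)_{n\in\mathbb{N}},(b_n)_{n\in\mathbb{N}})$ (each zero/pole repeated according to multiplicity) in such a way that $\sup_n|a_n-b_n|<\infty$.
   Context: $\rho_S$ is the spherical metric. A nonconstant meromorphic $f$ on $\mathbb{C}$ is almost elliptic ($f\in{\cal AE}$) if for every $\varepsilon>0$ there is $L<\infty$ such that every disc of radius $L$ contains a point $\tau$ with $\rho_S(f(z+\tau),f(z))<\varepsilon$ for all $z\in\mathbb{C}$. *)

(* Defs.v *)
(* complex numbers are modelled as R*R; the extended
   complex plane (Riemann sphere) as option Cpx with None = infinity. *)
From Stdlib Require Import Reals Lra ZArith List.
Open Scope R_scope.

Definition Cpx : Type := (R * R)%type.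

Definition Cadd (z w : Cpx) : Cpx := (fst z + fst w, snd z + snd w).
Definition Copp (z : Cpx) : Cpx := (- fst z, - snd z).
Definition Csub (z w : Cpx) : Cpx := Cadd z (Copp w).
Definition Cmul (z w : Cpx) : Cpx :=
  (fst z * fst w - snd z * snd w, fst z * snd w + snd z * fst w).
Definition Cnorm (z : Cpx) : R := sqrt (fst z * fst z + snd z * snd z).
Definition Cinv (z : Cpx) : Cpx :=
  let d := fst z * fst z + snd z * snd z in (fst z / d, - snd z / d).
Definition C0 : Cpx := (0, 0).
Definition C1 : Cpx := (1, 0).

Fixpoint Cpow (z : Cpx) (n : nat) : Cpx :=
  match n with O => C1 | S k => Cmul z (Cpow z k) end.

(* integer powers z^m, m : Z (meaningful for z <> 0 when m < 0) *)
Definition Cpowz (z : Cpx) (m : Z) : Cpx :=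
  if Z.leb 0 m then Cpow z (Z.to_nat m) else Cpow (Cinv z) (Z.to_nat (- m)).

Definition Cdifferentiable (g : Cpx -> Cpx) (z : Cpx) : Prop :=
  exists l : Cpx, forall eps, 0 < eps -> exists delta, 0 < delta /\
    forall h : Cpx, 0 < Cnorm h < delta ->
      Cnorm (Csub (Csub (g (Cadd z h)) (g z)) (Cmul l h)) <= eps * Cnorm h.

Definition holomorphic_on_disc (g : Cpx -> Cpx) (a : Cpx) (r : R) : Prop :=
  forall z, Cnorm (Csub z a) < r -> Cdifferentiable g z.

Definition has_order (f : Cpx -> option Cpx) (a : Cpx) (m : Z) : Prop :=
  exists r, 0 < r /\ exists g : Cpx -> Cpx,
    holomorphic_on_disc g a r /\ g a <> C0 /\
    (forall z, 0 < Cnorm (Csub z a) < r -> f z = Some (Cmul (Cpowz (Csub z a) m) (g z))) /\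
    f a = (if Z.ltb 0 m then Some C0 else if Z.eqb m 0 then Some (g a) else None).

(* meromorphic on C (and not identically 0; the constant 0 is excluded by
   nonconstancy anyway): every point has a local representation as above *)
Definition meromorphic (f : Cpx -> option Cpx) : Prop :=
  forall a, exists m : Z, has_order f a m.

Definition nonconstant (f : Cpx -> option Cpx) : Prop :=
  exists z1 z2, f z1 <> f z2.

Definition rho_S (w1 w2 : option Cpx) : R :=
  match w1, w2 with
  | Some u, Some v =>
      2 * Cnorm (Csub u v) /
        sqrt ((1 + Cnorm u * Cnorm u) * (1 + Cnorm v * Cnorm v))
  | Some u, None | None, Some u => 2 / sqrt (1 + Cnorm u * Cnorm u)
  | None, None => 0
  end.

Definition almost_elliptic (f : Cpx -> option Cpx) : Prop :=
  meromorphic f /\ nonconstant f /\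
  forall eps, 0 < eps -> exists L, 0 < L /\
    forall c : Cpx, exists tau : Cpx, Cnorm (Csub tau c) < L /\
      forall z, rho_S (f (Cadd z tau)) (f z) < eps.

Definition occurs_exactly (s : nat -> Cpx) (w : Cpx) (k : nat) : Prop :=
  exists l : list nat, NoDup l /\ (forall n, In n l <-> s n = w) /\ length l = k.

(* Main.v *)
(* Cut the plane into large squares whose sides avoid the zeros and poles.  By the argument
   principle the excess of zeros over poles in a square is the sum of the increments of the
   argument of [f] along its sides, divided by [2 pi]; after normalising by a choice of argument
   at the vertices this writes (zeros - poles) as the divergence of an integer flow.  The flow
   through a side of length [T] is [O(T)], while a square contains at least a constant times
   [T ^ 2] zeros.  So the zeros can be moved along the flow to neighbouring squares until every
   square has as many zeros as poles, and are then paired within the squares.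

   The increment along a segment is bounded uniformly: if it is large, then [Re f] and [Im f] have
   many zeros on the segment, which forces [f] to be tiny near it.  By Lagrange interpolation
   smallness spreads from one square to a bounded number of neighbours, whereas the values of [f]
   recur in every disc of a fixed radius. *)
Require Import Defs.
From Stdlib Require Import Reals ZArith List Lra Lia.
From Stdlib Require Import ClassicalEpsilon Permutation Ranalysis5 Cantor.
From Coquelicot Require Import Coquelicot.
Open Scope R_scope.

(** * Complex differentiability *)

(** A side of a square may pass arbitrarily close to zeros and poles, so compactness alone does not
    bound the increment of the argument along it: [f] has no uniform lower bound on the sides.
    Counting crossings of the coordinate axes avoids this, since it needs only an upper bound for
    [f] on a surrounding square and a lower bound at one point of it. Both are uniform over the
    plane. For the upper bound, inversion is an isometry of the spherical metric, and there are
    squares of one fixed size on each of which [f] or its inverse is at most 2; a compact set of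
    centres suffices, because every translate of [f] is close to a translate by a bounded vector.
    The lower bound comes from quantitative lemmas whose constants depend on the size of the square
    but not on the function, so no limits of translates of [f] occur. The same lemmas, together with
    Liouville's theorem, show that zeros exist; an estimate for the inverse of a translate makes
    them recur. *)

Lemma Cnorm_Cmod (z : C) : Cnorm z = Cmod z.
Proof. unfold Cnorm, Cmod. f_equal. ring. Qed.

Lemma Cinv_Cinv (z : C) : Defs.Cinv z = Cinv z.
Proof.
  unfold Defs.Cinv, Cinv; cbv zeta.
  replace (fst z * fst z + snd z * snd z) with (fst z ^ 2 + snd z ^ 2) by ring.
  reflexivity.
Qed.

Lemma Cmod_sub_comm (z w : C) : Cmod (z - w) = Cmod (w - z).
Proof. rewrite <- (Cmod_opp (z - w)). f_equal. ring. Qed.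

Lemma Cmod_triangle_sub (z w u : C) : Cmod (z - u) <= Cmod (z - w) + Cmod (w - u).
Proof.
  replace (z - u)%C with ((z - w) + (w - u))%C by ring. apply Cmod_triangle.
Qed.

Lemma Cmod_lower (z w : C) : Cmod w - Cmod (z - w) <= Cmod z.
Proof.
  assert (H := Cmod_triangle z (w - z)).
  replace (z + (w - z))%C with w in H by ring.
  rewrite (Cmod_sub_comm w z) in H. lra.
Qed.

Lemma Cmod_upper (z w : C) : Cmod z <= Cmod w + Cmod (z - w).
Proof.
  assert (H := Cmod_triangle w (z - w)).
  replace (w + (z - w))%C with z in H by ring. lra.
Qed.

Lemma abs_fst_Cmod (z : C) : Rabs (fst z) <= Cmod z.
Proof. eapply Rle_trans; [apply Rmax_l | apply Rmax_Cmod]. Qed.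

Lemma abs_snd_Cmod (z : C) : Rabs (snd z) <= Cmod z.
Proof. eapply Rle_trans; [apply Rmax_r | apply Rmax_Cmod]. Qed.

Lemma Cmod_le_abs (z : C) : Cmod z <= Rabs (fst z) + Rabs (snd z).
Proof.
  replace z with (RtoC (fst z) + Ci * RtoC (snd z))%C at 1
    by (destruct z; unfold RtoC, Ci, Cplus, Cmult; simpl; f_equal; ring).
  eapply Rle_trans; [apply Cmod_triangle |].
  rewrite Cmod_mult, Cmod_Ci, !Cmod_R. lra.
Qed.

Lemma Cmod_sub_neq (z w : C) : z <> w -> 0 < Cmod (z - w).
Proof.
  intros H. apply Cmod_gt_0. intros E. apply H.
  replace z with ((z - w) + w)%C by ring. rewrite E. ring.
Qed.

Lemma Cmod_sub_pos_neq (z w : C) : 0 < Cmod (z - w) -> z <> w.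
Proof.
  intros H E. subst w. replace (z - z)%C with (RtoC 0) in H by ring.
  rewrite Cmod_0 in H. lra.
Qed.

Lemma Cminus_neq0 (z w : C) : z <> w -> (z - w <> 0)%C.
Proof. intros H. apply Cmod_gt_0. apply Cmod_sub_neq, H. Qed.

Lemma Cplus_minus_cancel (z h : C) : (z + h - z)%C = h.
Proof. ring. Qed.

Lemma pos_min a b : 0 < a -> 0 < b -> exists r, 0 < r /\ r <= a /\ r <= b.
Proof.
  intros. exists (Rmin a b). split; [apply Rmin_pos; auto | split; [apply Rmin_l | apply Rmin_r]].
Qed.

Definition ccont (g : C -> C) (z : C) : Prop :=
  forall eps, 0 < eps -> exists delta, 0 < delta /\
    forall w, Cmod (w - z) < delta -> Cmod (g w - g z) < eps.

Lemma ccont_const c z : ccont (fun _ => c) z.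
Proof.
  intros e He. exists 1. split; [lra | intros w _].
  replace (c - c)%C with (RtoC 0) by ring. rewrite Cmod_0. exact He.
Qed.

Lemma ccont_id z : ccont (fun w => w) z.
Proof. intros e He. exists e. auto. Qed.

Lemma ccont_plus f g z : ccont f z -> ccont g z -> ccont (fun w => f w + g w)%C z.
Proof.
  intros Hf Hg e He.
  destruct (Hf (e/2)) as [d1 [D1 H1]]; [lra |].
  destruct (Hg (e/2)) as [d2 [D2 H2]]; [lra |].
  destruct (pos_min d1 d2 D1 D2) as (d & D & L1 & L2). exists d. split; [auto |]. intros w Hw.
  specialize (H1 w ltac:(lra)). specialize (H2 w ltac:(lra)).
  replace (f w + g w - (f z + g z))%C with ((f w - f z) + (g w - g z))%C by ring.
  eapply Rle_lt_trans; [apply Cmod_triangle | lra].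
Qed.

Lemma ccont_mult f g z : ccont f z -> ccont g z -> ccont (fun w => f w * g w)%C z.
Proof.
  intros Hf Hg e He.
  assert (Pf := Cmod_ge_0 (f z)). assert (Pg := Cmod_ge_0 (g z)).
  destruct (Hf 1) as [d0 [D0 H0]]; [lra |].
  set (A := Cmod (f z) + 1). set (B := Cmod (g z) + 1).
  assert (HA : 0 < A) by (unfold A; lra). assert (HB : 0 < B) by (unfold B; lra).
  destruct (Hf (e / 2 / B)) as [d1 [D1 H1]].
  { apply Rdiv_lt_0_compat; lra. }
  destruct (Hg (e / 2 / A)) as [d2 [D2 H2]].
  { apply Rdiv_lt_0_compat; lra. }
  destruct (pos_min d1 d2 D1 D2) as (d3 & D3 & L1 & L2).
  destruct (pos_min d0 d3 D0 D3) as (d & D & L3 & L4). exists d. split; [auto |]. intros w Hw.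
  assert (W0 := H0 w ltac:(lra)). assert (W1 := H1 w ltac:(lra)). assert (W2 := H2 w ltac:(lra)).
  replace (f w * g w - f z * g z)%C with (f w * (g w - g z) + (f w - f z) * g z)%C by ring.
  eapply Rle_lt_trans; [apply Cmod_triangle |]. rewrite !Cmod_mult.
  assert (U := Cmod_upper (f w) (f z)).
  assert (Cmod (f w) <= A) by (unfold A; lra).
  assert (P1 := Cmod_ge_0 (g w - g z)). assert (P2 := Cmod_ge_0 (f w - f z)).
  assert (Cmod (f w) * Cmod (g w - g z) <= A * Cmod (g w - g z)) by nra.
  assert (A * Cmod (g w - g z) < A * (e / 2 / A)) by (apply Rmult_lt_compat_l; auto).
  assert (Cmod (f w - f z) * Cmod (g z) <= e / 2 / B * B).
  { apply Rmult_le_compat; auto; [lra | unfold B; lra]. }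
  assert (A * (e / 2 / A) = e / 2) by (field; lra).
  assert (e / 2 / B * B = e / 2) by (field; lra). lra.
Qed.

Lemma ccont_inv f z : ccont f z -> f z <> 0%C -> ccont (fun w => / f w)%C z.
Proof.
  intros Hf Nz e He. assert (P : 0 < Cmod (f z)) by (apply Cmod_gt_0; auto).
  set (A := Cmod (f z)) in *.
  destruct (Hf (A / 2)) as [d1 [D1 H1]]; [lra |].
  destruct (Hf (e * (A * A / 2))) as [d2 [D2 H2]].
  { apply Rmult_lt_0_compat; nra. }
  destruct (pos_min d1 d2 D1 D2) as (d & D & L1 & L2). exists d. split; [auto |]. intros w Hw.
  assert (W1 := H1 w ltac:(lra)). assert (W2 := H2 w ltac:(lra)).
  assert (L := Cmod_lower (f w) (f z)). fold A in L.
  assert (Nw : f w <> 0%C) by (apply Cmod_gt_0; lra).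
  replace (/ f w - / f z)%C with ((f z - f w) / (f w * f z))%C by (field; auto).
  rewrite Cmod_div by (apply Cmult_neq_0; auto).
  rewrite Cmod_mult, Cmod_sub_comm. fold A.
  apply Rmult_lt_reg_r with (Cmod (f w) * A); [nra |].
  unfold Rdiv. rewrite Rmult_assoc, Rinv_l by nra.
  eapply Rlt_le_trans; [rewrite Rmult_1_r; apply W2 |].
  apply Rmult_le_compat_l; nra.
Qed.

Lemma ccont_ext_loc f g z r : 0 < r -> (forall w, Cmod (w - z) < r -> f w = g w) ->
  ccont f z -> ccont g z.
Proof.
  intros Hr E Hf e He. destruct (Hf e He) as [d [D H]].
  destruct (pos_min r d Hr D) as (q & Q & L1 & L2). exists q. split; [auto |]. intros w Hw.
  rewrite <- !E; [apply H; lra | | lra].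
  replace (z - z)%C with (RtoC 0) by ring. rewrite Cmod_0. exact Hr.
Qed.

(* Caratheodory's form of differentiability: it turns the rules of calculus into continuity statements. *)
Definition cdiff (g : C -> C) (z : C) : Prop :=
  exists s : C -> C, ccont s z /\ forall w, g w = (g z + s w * (w - z))%C.

Lemma Cdifferentiable_cdiff (g : C -> C) (z : C) : Cdifferentiable g z <-> cdiff g z.
Proof.
  split.
  - intros [l H].
    (* The difference quotient, completed at [z] by the derivative. [Cdifferentiable] gives a weak
       inequality and [ccont] asks for a strict one, hence the [e / 2]. *)
    exists (fun w => if Ceq_dec w z then l else ((g w - g z) / (w - z))%C). split.
    + intros e He. destruct (H (e / 2)) as [d [D K]]; [lra |].
      exists d. split; [exact D |]. intros w Hw.
      destruct (Ceq_dec z z) as [_ | n]; [| congruence].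
      destruct (Ceq_dec w z) as [_ | n].
      { replace (l - l)%C with (RtoC 0) by ring. rewrite Cmod_0. exact He. }
      assert (Pw := Cmod_sub_neq _ _ n).
      assert (N0 := Cminus_neq0 _ _ n).
      specialize (K (w - z)%C). rewrite !Cnorm_Cmod in K. specialize (K (conj Pw Hw)).
      change (Cmod (g (z + (w - z)) - g z - l * (w - z))%C <= e / 2 * Cmod (w - z)) in K.
      replace (z + (w - z))%C with w in K by ring.
      replace ((g w - g z) / (w - z) - l)%C with ((g w - g z - l * (w - z)) / (w - z))%C
        by (field; auto).
      rewrite Cmod_div by auto.
      apply Rmult_lt_reg_r with (Cmod (w - z)); [auto |].
      unfold Rdiv. rewrite Rmult_assoc, Rinv_l by lra. nra.
    + intros w. destruct (Ceq_dec w z) as [-> | n]; [ring |].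
      field. apply Cminus_neq0, n.
  - intros [s [Hs E]]. exists (s z). intros e He. destruct (Hs e He) as [d [D K]].
    exists d. split; [exact D |]. intros h. rewrite !Cnorm_Cmod. intros [H1 H2].
    change (Cmod (g (z + h) - g z - s z * h)%C <= e * Cmod h).
    rewrite (E (z + h)%C), (Cplus_minus_cancel z h).
    replace (g z + s (z + h) * h - g z - s z * h)%C
      with ((s (z + h) - s z) * h)%C by ring.
    rewrite Cmod_mult. apply Rmult_le_compat_r; [lra |].
    left. apply K. rewrite (Cplus_minus_cancel z h). exact H2.
Qed.

Lemma cdiff_ccont g z : cdiff g z -> ccont g z.
Proof.
  intros [s [Hs E]].
  apply (ccont_ext_loc (fun w => g z + s w * (w - z))%C) with (r := 1); [lra | auto |].
  apply ccont_plus; [apply ccont_const |]. apply ccont_mult; [exact Hs |].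
  apply (ccont_plus (fun w => w)); [apply ccont_id | apply ccont_const].
Qed.

Lemma cdiff_const c z : cdiff (fun _ => c) z.
Proof. exists (fun _ => RtoC 0). split; [apply ccont_const | intros; ring]. Qed.

Lemma cdiff_id z : cdiff (fun w => w) z.
Proof. exists (fun _ => RtoC 1). split; [apply ccont_const | intros; ring]. Qed.

Lemma cdiff_plus f g z : cdiff f z -> cdiff g z -> cdiff (fun w => f w + g w)%C z.
Proof.
  intros [s [Hs E]] [t [Ht F]]. exists (fun w => s w + t w)%C.
  split; [apply ccont_plus; auto |]. intros w. rewrite E, F. ring.
Qed.

Lemma cdiff_mult f g z : cdiff f z -> cdiff g z -> cdiff (fun w => f w * g w)%C z.
Proof.
  intros Hf Hg. assert (Cg := cdiff_ccont _ _ Hg).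
  destruct Hf as [s [Hs E]], Hg as [t [Ht F]].
  exists (fun w => s w * g w + f z * t w)%C. split.
  - apply ccont_plus; apply ccont_mult; auto using ccont_const.
  - intros w. transitivity (f z * g w + s w * g w * (w - z))%C; [rewrite (E w); ring |].
    rewrite (F w) at 1. ring.
Qed.

Lemma cdiff_minus f g z : cdiff f z -> cdiff g z -> cdiff (fun w => f w - g w)%C z.
Proof.
  intros Hf Hg.
  destruct (cdiff_plus f (fun w => (- RtoC 1) * g w)%C z) as [s [Hs E]]; auto.
  { apply cdiff_mult; auto using cdiff_const. }
  exists s. split; [auto |]. intros w. specialize (E w).
  replace (f w - g w)%C with (f w + (- RtoC 1) * g w)%C; [rewrite E |].
  all: ring.
Qed.

(** The slope in [cdiff] has to factor [g] on the whole plane, so outside the disc it is replaced by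
    the difference quotient of [g]; continuity at [z] does not notice the change. *)
Lemma cdiff_ext_loc f g z r : 0 < r -> (forall w, Cmod (w - z) < r -> f w = g w) ->
  cdiff f z -> cdiff g z.
Proof.
  intros Hr E [s [Hs F]].
  assert (Ez : f z = g z).
  { apply E. replace (z - z)%C with (RtoC 0) by ring. rewrite Cmod_0. exact Hr. }
  exists (fun w => if Rlt_dec (Cmod (w - z)) r then s w else ((g w - g z) / (w - z))%C).
  split.
  - apply (ccont_ext_loc s) with (r := r); auto.
    intros w Hw. destruct (Rlt_dec (Cmod (w - z)) r); [reflexivity | contradiction].
  - intros w. destruct (Rlt_dec (Cmod (w - z)) r) as [l | n].
    + rewrite <- E, <- Ez by auto. apply F.
    + field. apply Cminus_neq0. intros ->. apply n.
      replace (z - z)%C with (RtoC 0) by ring. rewrite Cmod_0. exact Hr.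
Qed.

Lemma cdiff_inv f z : cdiff f z -> f z <> 0%C -> cdiff (fun w => / f w)%C z.
Proof.
  intros Hf Nz. assert (Cf := cdiff_ccont _ _ Hf).
  assert (Pz : 0 < Cmod (f z)) by (apply Cmod_gt_0; auto).
  destruct (Cf (Cmod (f z)) Pz) as [d [D K]].
  destruct Hf as [s [Hs E]].
  (* At zeros of [f] this slope does not factor [/ f]. The auxiliary [g] is factored by it
     everywhere and agrees with [/ f] near [z]. *)
  set (g := fun w : C => (/ f z + (- s w * / f w * / f z) * (w - z))%C).
  apply (cdiff_ext_loc g) with (r := d); auto.
  - intros w Hw. unfold g.
    assert (L := Cmod_lower (f w) (f z)). specialize (K w Hw).
    assert (Nw : f w <> 0%C) by (apply Cmod_gt_0; lra).
    assert (Ew := E w).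
    assert (E2 : (s w * (w - z) = f w - f z)%C) by (rewrite Ew; ring).
    replace (/ f z + - s w * / f w * / f z * (w - z))%C
      with (/ f z - (s w * (w - z)) * / f w * / f z)%C by ring.
    rewrite E2. field. auto.
  - exists (fun w => - s w * / f w * / f z)%C. split.
    + apply ccont_mult; [| apply ccont_const].
      apply ccont_mult; [| apply ccont_inv; auto].
      apply (ccont_ext_loc (fun w => (- RtoC 1) * s w)%C) with (r := 1); [lra | |].
      * intros w _. ring.
      * apply ccont_mult; auto using ccont_const.
    + intros w. unfold g. ring.
Qed.

Lemma cdiff_lin c z : cdiff (fun w => w - c)%C z.
Proof. apply cdiff_minus; [apply cdiff_id | apply cdiff_const]. Qed.

(** * Integer powers of complex numbers *)

Definition zpow (z : C) (m : Z) : C := Cpowz z m.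

Lemma zpow_of_nat z n : zpow z (Z.of_nat n) = (z ^ n)%C.
Proof.
  unfold zpow, Cpowz. destruct (Z.leb_spec 0 (Z.of_nat n)); [| lia].
  rewrite Nat2Z.id. reflexivity.
Qed.

Lemma zpow_opp_of_nat z n : zpow z (- Z.of_nat n) = (/ z ^ n)%C.
Proof.
  destruct n as [| n].
  { unfold zpow, Cpowz. cbn. change Defs.C1 with (RtoC 1).
    apply injective_projections; simpl; field. }
  unfold zpow, Cpowz. destruct (Z.leb_spec 0 (- Z.of_nat (S n))); [lia |].
  replace (Z.to_nat (- - Z.of_nat (S n))) with (S n) by lia.
  rewrite Cinv_Cinv. change (((/ z) ^ S n)%C = (/ z ^ S n)%C).
  (* At [0] both sides are [0]: the components of the inverse of [0] are quotients with numerator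
     zero. *)
  destruct (Ceq_dec z 0) as [-> | N].
  - rewrite !Cpow_S. replace (/ RtoC 0)%C with (RtoC 0).
    + rewrite !Cmult_0_l. apply injective_projections; simpl; unfold Rdiv; ring.
    + apply injective_projections; simpl; unfold Rdiv; ring.
  - apply Cpow_inv. exact N.
Qed.

Lemma zpow_0 z : zpow z 0 = 1%C.
Proof. reflexivity. Qed.

Lemma zpow_neq0 (z : C) (m : Z) : z <> 0%C -> zpow z m <> 0%C.
Proof.
  intros Hz. destruct (Z_le_dec 0 m).
  - rewrite <- (Z2Nat.id m) by auto. rewrite zpow_of_nat. apply Cpow_nz, Hz.
  - replace m with (- Z.of_nat (Z.to_nat (- m)))%Z by lia. rewrite zpow_opp_of_nat.
    intros E. assert (P := Cpow_nz z (Z.to_nat (- m)) Hz).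
    assert (Q := Cinv_r _ P). rewrite E, Cmult_0_r in Q.
    apply C1_nz. auto.
Qed.

Lemma Cinv_0 : (/ RtoC 0)%C = 0%C.
Proof. apply injective_projections; simpl; unfold Rdiv; ring. Qed.

Lemma zpow_opp (z : C) (m : Z) : zpow z (- m) = (/ zpow z m)%C.
Proof.
  destruct (Z_le_dec 0 m).
  - rewrite <- (Z2Nat.id m) by auto. rewrite zpow_opp_of_nat, zpow_of_nat. reflexivity.
  - replace m with (- Z.of_nat (Z.to_nat (- m)))%Z by lia.
    set (k := Z.to_nat (- m)). rewrite Z.opp_involutive, zpow_of_nat, zpow_opp_of_nat.
    destruct (Ceq_dec (z ^ k) 0) as [E | N].
    + rewrite E, !Cinv_0. reflexivity.
    + field. exact N.
Qed.

Lemma zpow_add_nat (z : C) (m : Z) (n : nat) : z <> 0%C -> zpow z (m + Z.of_nat n) = (zpow z m * z ^ n)%C.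
Proof.
  intros Hz. induction n as [| n IH].
  - rewrite Z.add_0_r. simpl. ring.
  - replace (m + Z.of_nat (S n))%Z with ((m + Z.of_nat n) + 1)%Z by lia.
    rewrite Cpow_S. rewrite Cmult_assoc, (Cmult_comm (zpow z m)), <- Cmult_assoc, <- IH.
    set (k := (m + Z.of_nat n)%Z). clearbody k. clear -Hz.
    destruct (Z_le_dec 0 k).
    + rewrite <- (Z2Nat.id k) by auto.
      replace (Z.of_nat (Z.to_nat k) + 1)%Z with (Z.of_nat (S (Z.to_nat k))) by lia.
      rewrite !zpow_of_nat. apply Cpow_S.
    + replace k with (- Z.of_nat (S (Z.to_nat (- k - 1))))%Z by lia.
      set (j := Z.to_nat (- k - 1)).
      replace (- Z.of_nat (S j) + 1)%Z with (- Z.of_nat j)%Z by lia.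
      rewrite !zpow_opp_of_nat, Cpow_S. field. split; auto. apply Cpow_nz, Hz.
Qed.

Lemma cdiff_pow c n z : cdiff (fun w => (w - c) ^ n)%C z.
Proof.
  induction n as [| n IH].
  - apply (cdiff_ext_loc (fun _ => RtoC 1)) with (r := 1); [lra | | apply cdiff_const].
    intros. reflexivity.
  - apply (cdiff_ext_loc (fun w => (w - c) * (w - c) ^ n)%C) with (r := 1); [lra | |].
    + intros. symmetry. apply Cpow_S.
    + apply cdiff_mult; [apply cdiff_lin | exact IH].
Qed.

Lemma cdiff_zpow (c : C) (m : Z) (z : C) : z <> c -> cdiff (fun w => zpow (w - c) m) z.
Proof.
  intros N. destruct (Z_le_dec 0 m).
  - apply (cdiff_ext_loc (fun w => (w - c) ^ (Z.to_nat m))%C) with (r := 1); [lra | | apply cdiff_pow].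
    intros w _. rewrite <- zpow_of_nat, Z2Nat.id; auto.
  - apply (cdiff_ext_loc (fun w => / (w - c) ^ (Z.to_nat (- m)))%C) with (r := 1); [lra | |].
    + intros w _. rewrite <- zpow_opp_of_nat. f_equal. lia.
    + apply cdiff_inv; [apply cdiff_pow |]. apply Cpow_nz, Cminus_neq0, N.
Qed.

(** * Continuous choices of the argument *)

Lemma INR_lt_pow2 n : INR n < 2 ^ n.
Proof.
  induction n as [| n IH]; [simpl; lra |].
  rewrite S_INR. simpl. assert (1 <= 2 ^ n) by (apply pow_R1_Rle; lra). lra.
Qed.

Lemma halving_lt (w delta : R) : 0 <= w -> 0 < delta -> exists N, forall n, (N <= n)%nat -> w / 2 ^ n < delta.
Proof.
  intros Hw Hd. destruct (INR_unbounded (w / delta)) as [N HN].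
  exists N. intros n Hn. apply le_INR in Hn. assert (P := INR_lt_pow2 n).
  assert (Q : 0 < 2 ^ n) by (apply pow_lt; lra).
  apply Rmult_lt_reg_r with (2 ^ n); [auto |].
  unfold Rdiv. rewrite Rmult_assoc, Rinv_l, Rmult_1_r by lra.
  assert (w = w / delta * delta) by (field; lra).
  assert (w / delta * delta < 2 ^ n * delta) by (apply Rmult_lt_compat_r; lra). lra.
Qed.

Lemma nested_intervals (a b : nat -> R) :
  (forall n, a n <= a (S n) /\ b (S n) <= b n /\ a n <= b n) ->
  exists x, forall n, a n <= x <= b n.
Proof.
  intros H.
  assert (Ha : forall n k, a n <= a (n + k)%nat).
  { intros n; induction k; [rewrite Nat.add_0_r; lra |].
    rewrite Nat.add_succ_r. destruct (H (n + k)%nat); lra. }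
  assert (Hb : forall n k, b (n + k)%nat <= b n).
  { intros n; induction k; [rewrite Nat.add_0_r; lra |].
    rewrite Nat.add_succ_r. destruct (H (n + k)%nat); lra. }
  assert (Hab : forall n m, a n <= b m).
  { intros n m. assert (A := Ha n m). assert (B := Hb m n).
    rewrite Nat.add_comm in B. destruct (H (n + m)%nat); lra. }
  destruct (completeness (fun r => exists n, r = a n)) as [x [U L]].
  - exists (b 0%nat). intros r [n ->]. apply Hab.
  - exists (a 0%nat), 0%nat. reflexivity.
  - exists x. intros n. split.
    + apply U. exists n. reflexivity.
    + apply L. intros r [m ->]. apply Hab.
Qed.

(** Cousin's principle: if [P] failed, it would fail on a quarter, on a quarter of that, and so on;
    these rectangles shrink to a point and contradict the local hypothesis there. Liftings of the
    argument, Goursat's lemma and the finiteness of the divisor all rest on it. *)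
Lemma rect_ind (P : R -> R -> R -> R -> Prop) (x0 x1 y0 y1 : R) :
  x0 <= x1 -> y0 <= y1 ->
  (forall a b c d, x0 <= a -> a <= b -> b <= x1 -> y0 <= c -> c <= d -> d <= y1 ->
     P a ((a + b) / 2) c ((c + d) / 2) -> P ((a + b) / 2) b c ((c + d) / 2) ->
     P a ((a + b) / 2) ((c + d) / 2) d -> P ((a + b) / 2) b ((c + d) / 2) d ->
     P a b c d) ->
  (forall x y, x0 <= x <= x1 -> y0 <= y <= y1 -> exists delta, 0 < delta /\
     forall a b c d, x0 <= a -> a <= x <= b -> b <= x1 -> y0 <= c -> c <= y <= d -> d <= y1 ->
       b - a < delta -> d - c < delta -> P a b c d) ->
  P x0 x1 y0 y1.
Proof.
  intros Hx Hy Split Loc. apply NNPP. intros NP.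
  set (bad := fun s : (R * R) * (R * R) =>
    x0 <= fst (fst s) /\ fst (fst s) <= snd (fst s) /\ snd (fst s) <= x1 /\
    y0 <= fst (snd s) /\ fst (snd s) <= snd (snd s) /\ snd (snd s) <= y1 /\
    ~ P (fst (fst s)) (snd (fst s)) (fst (snd s)) (snd (snd s))).
  set (half := fun i j : R * R => fst i <= fst j /\ snd j <= snd i /\
    snd j - fst j = (snd i - fst i) / 2).
  assert (Step : forall s : {s | bad s}, exists t : {s | bad s},
    half (fst (proj1_sig s)) (fst (proj1_sig t)) /\ half (snd (proj1_sig s)) (snd (proj1_sig t))).
  { intros [[[a b] [c d]] B]. unfold bad in B; simpl in B.
    destruct B as (A1 & A2 & A3 & A4 & A5 & A6 & NB).
    assert (Q : exists t, bad t /\ half (a, b) (fst t) /\ half (c, d) (snd t)).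
    { apply NNPP. intros NQ. apply NB. apply Split; auto; apply NNPP; intros NN; apply NQ.
      - exists ((a, (a + b) / 2), (c, (c + d) / 2)).
        unfold bad, half; simpl; repeat split; auto; lra.
      - exists (((a + b) / 2, b), (c, (c + d) / 2)).
        unfold bad, half; simpl; repeat split; auto; lra.
      - exists ((a, (a + b) / 2), ((c + d) / 2, d)).
        unfold bad, half; simpl; repeat split; auto; lra.
      - exists (((a + b) / 2, b), ((c + d) / 2, d)).
        unfold bad, half; simpl; repeat split; auto; lra. }
    destruct Q as [t [Bt Q]]. exists (exist _ t Bt). exact Q. }
  destruct (choice _ Step) as [F HF].
  assert (B0 : bad ((x0, x1), (y0, y1))).
  { unfold bad; simpl; repeat split; auto; lra. }
  set (s := fun n => Nat.iter n F (exist _ _ B0)).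
  set (v := fun n => proj1_sig (s n)).
  assert (Bv : forall n, bad (v n)) by (intros n; apply (proj2_sig (s n))).
  assert (Sv : forall n, half (fst (v n)) (fst (v (S n))) /\ half (snd (v n)) (snd (v (S n)))).
  { intros n. apply (HF (s n)). }
  destruct (nested_intervals (fun n => fst (fst (v n))) (fun n => snd (fst (v n)))) as [x X].
  { intros n. destruct (Sv n) as [[? [? ?]] _], (Bv n) as (? & ? & _). auto. }
  destruct (nested_intervals (fun n => fst (snd (v n))) (fun n => snd (snd (v n)))) as [y Y].
  { intros n. destruct (Sv n) as [_ [? [? ?]]], (Bv n) as (? & ? & ? & ? & ? & _). auto. }
  assert (Wx : forall n, snd (fst (v n)) - fst (fst (v n)) = (x1 - x0) / 2 ^ n).
  { induction n as [| n IH]; [unfold v; simpl; field |].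
    destruct (Sv n) as [[_ [_ E]] _]. rewrite E, IH. simpl. field. apply pow_nonzero; lra. }
  assert (Wy : forall n, snd (snd (v n)) - fst (snd (v n)) = (y1 - y0) / 2 ^ n).
  { induction n as [| n IH]; [unfold v; simpl; field |].
    destruct (Sv n) as [_ [_ [_ E]]]. rewrite E, IH. simpl. field. apply pow_nonzero; lra. }
  destruct (Loc x y) as [dl [D K]]; [apply (X 0%nat) | apply (Y 0%nat) |].
  destruct (halving_lt (x1 - x0) dl) as [N1 H1]; [lra | auto |].
  destruct (halving_lt (y1 - y0) dl) as [N2 H2]; [lra | auto |].
  set (n := (N1 + N2)%nat).
  destruct (Bv n) as (A1 & A2 & A3 & A4 & A5 & A6 & NB).
  apply NB, K; auto.
  - rewrite Wx. apply H1. unfold n; lia.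
  - rewrite Wy. apply H2. unfold n; lia.
Qed.

Lemma interval_ind (P : R -> R -> Prop) (x0 x1 : R) :
  x0 <= x1 ->
  (forall a b, x0 <= a -> a <= b -> b <= x1 ->
     P a ((a + b) / 2) -> P ((a + b) / 2) b -> P a b) ->
  (forall x, x0 <= x <= x1 -> exists delta, 0 < delta /\
     forall a b, x0 <= a -> a <= x <= b -> b <= x1 -> b - a < delta -> P a b) ->
  P x0 x1.
Proof.
  intros Hx S L. apply (rect_ind (fun a b _ _ => P a b) x0 x1 0 0); [exact Hx | lra | |].
  - intros; apply S; auto.
  - intros x y X _. destruct (L x X) as [d [D K]]. exists d; split; auto.
Qed.

Lemma locally_constant (d : R -> R) (a b : R) : a <= b ->
  (forall t, a <= t <= b -> exists delta, 0 < delta /\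
     forall s, a <= s <= b -> Rabs (s - t) < delta -> d s = d t) -> d a = d b.
Proof.
  intros Hab H. apply (interval_ind (fun u v => d u = d v)); auto.
  - intros; congruence.
  - intros x X. destruct (H x X) as [e [E K]]. exists e; split; auto.
    intros u v Hu Huv Hv W. rewrite (K u), (K v); auto; try lra.
    all: apply Rabs_def1; lra.
Qed.

Definition pcont (w : R -> C) (t : R) : Prop :=
  forall eps, 0 < eps -> exists delta, 0 < delta /\
    forall s, Rabs (s - t) < delta -> Cmod (w s - w t) < eps.

Definition polar (r th : R) : C := (r * cos th, r * sin th).

(** [continuity_pt] is two-sided at [a] and [b] as well, so two lifts that agree at a common end
    point can be glued there. *)
Definition lift (w : R -> C) (a b : R) (phi : R -> R) : Prop :=
  forall t, a <= t <= b ->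
    continuity_pt phi t /\ w t <> 0%C /\ w t = polar (Cmod (w t)) (phi t).

(** A relation, because a lift requires that [w] does not vanish. [Inc_unique] and [Inc_exists] make
    it a function on continuous non-vanishing paths. *)
Definition Inc (w : R -> C) (a b th : R) : Prop :=
  a <= b /\ exists phi, lift w a b phi /\ th = phi b - phi a.

Lemma cos_eq_1_small x : Rabs x < 1 -> cos x = 1 -> x = 0.
Proof.
  intros Hx Hc. apply Rabs_def2 in Hx. assert (P := PI2_1).
  destruct (Req_dec x 0) as [| N]; [auto | exfalso].
  assert (S0 : sin x = 0).
  { assert (E := sin2_cos2 x). unfold Rsqr in E. nra. }
  destruct (Rlt_dec 0 x).
  - assert (0 < sin x) by (apply sin_gt_0; lra). lra.
  - assert (0 < sin (- x)) by (apply sin_gt_0; lra). rewrite sin_neg in H. lra.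
Qed.

Lemma polar_inj r th ps : r <> 0 -> polar r th = polar r ps -> cos th = cos ps /\ sin th = sin ps.
Proof.
  intros Hr E. injection E as E1 E2. split; eapply Rmult_eq_reg_l; eauto.
Qed.

Lemma continuity_pt_eps f x e : continuity_pt f x -> 0 < e ->
  exists d, 0 < d /\ forall y, Rabs (y - x) < d -> Rabs (f y - f x) < e.
Proof.
  intros H He. destruct (H e He) as [d [D K]]. exists d; split; [auto |].
  intros y Hy. destruct (Req_dec y x) as [-> | N].
  - rewrite Rminus_diag, Rabs_R0. auto.
  - apply (K y). split; [split; [exact I | auto] | exact Hy].
Qed.

Lemma continuity_pt_of_eps f x :
  (forall e, 0 < e -> exists d, 0 < d /\ forall y, Rabs (y - x) < d -> Rabs (f y - f x) < e) ->
  continuity_pt f x.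
Proof.
  intros H e He. destruct (H e He) as [d [D K]]. exists d; split; [auto |].
  intros y [_ Hy]. apply K, Hy.
Qed.

(** Two lifts differ by a continuous function whose cosine is 1. Its values are multiples of
    [2 * PI], so small changes of it are zero and it is locally constant. *)
Lemma Inc_unique w a b th ps : Inc w a b th -> Inc w a b ps -> th = ps.
Proof.
  intros [Hab [f [Lf ->]]] [_ [g [Lg ->]]].
  enough (E : f a - g a = f b - g b) by lra.
  apply (locally_constant (fun t => f t - g t)); auto. intros t Ht.
  assert (Cos : forall s, a <= s <= b -> cos (f s - g s) = 1 /\ sin (f s - g s) = 0).
  { intros s Hs. destruct (Lf s Hs) as (_ & N & E1), (Lg s Hs) as (_ & _ & E2).
    rewrite E1 in E2 at 1. apply polar_inj in E2; [| intros Z; apply N, Cmod_eq_0, Z].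
    destruct E2 as [E2 E3]. rewrite cos_minus, sin_minus, E2, E3.
    assert (E := sin2_cos2 (g s)). unfold Rsqr in E. lra. }
  destruct (Lf t Ht) as (Cf & _), (Lg t Ht) as (Cg & _).
  destruct (continuity_pt_eps _ _ (1/2) Cf) as [d1 [D1 K1]]; [lra |].
  destruct (continuity_pt_eps _ _ (1/2) Cg) as [d2 [D2 K2]]; [lra |].
  destruct (pos_min d1 d2 D1 D2) as (d & D & M1 & M2). exists d. split; [auto |]. intros s Hs Hst.
  specialize (K1 s ltac:(lra)). specialize (K2 s ltac:(lra)).
  destruct (Cos s Hs) as [C1 S1], (Cos t Ht) as [C2 S2].
  enough (f s - g s - (f t - g t) = 0) by lra. apply cos_eq_1_small.
  - apply Rabs_def2 in K1. apply Rabs_def2 in K2. apply Rabs_def1; lra.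
  - rewrite cos_minus, C1, C2, S1, S2. ring.
Qed.

Lemma polar_mult r s th ps : (polar r th * polar s ps)%C = polar (r * s) (th + ps).
Proof.
  unfold polar, Cmult; simpl. rewrite cos_plus, sin_plus. f_equal; ring.
Qed.

Lemma Inc_mult u v a b th ps : Inc u a b th -> Inc v a b ps ->
  Inc (fun t => u t * v t)%C a b (th + ps).
Proof.
  intros [Hab [f [Lf ->]]] [_ [g [Lg ->]]]. split; [auto |].
  exists (fun t => f t + g t). split; [| ring]. intros t Ht.
  destruct (Lf t Ht) as (Cf & Nf & Ef), (Lg t Ht) as (Cg & Ng & Eg).
  split; [apply continuity_pt_plus; auto |]. split; [apply Cmult_neq_0; auto |].
  rewrite Ef, Eg at 1. rewrite polar_mult, Cmod_mult. reflexivity.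
Qed.

Lemma Inc_inv u a b th : Inc u a b th -> Inc (fun t => / u t)%C a b (- th).
Proof.
  intros [Hab [f [Lf ->]]]. split; [auto |].
  exists (fun t => - f t). split; [| ring]. intros t Ht.
  destruct (Lf t Ht) as (Cf & Nf & Ef).
  assert (P : Cmod (u t) <> 0) by (intros Z; apply Nf, Cmod_eq_0, Z).
  split; [apply continuity_pt_opp; auto |]. split.
  - intros E. assert (Q := Cinv_r _ Nf). rewrite E, Cmult_0_r in Q. apply C1_nz; auto.
  - rewrite Cmod_inv by auto.
    assert (E : (u t * polar (/ Cmod (u t)) (- f t) = 1)%C).
    { rewrite Ef at 1. rewrite polar_mult. rewrite Rinv_r, Rplus_opp_r by auto.
      unfold polar. rewrite cos_0, sin_0. apply injective_projections; simpl; ring. }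
    rewrite <- (Cmult_1_l (polar _ _)), <- (Cinv_l _ Nf), <- Cmult_assoc, E. ring.
Qed.

(** At [m] the two lifts may differ by a multiple [c] of [2 * PI]. Adding [c] to the second one
    changes neither its increment nor the points it describes. *)
Lemma Inc_cat w a m b th ps : Inc w a m th -> Inc w m b ps -> Inc w a b (th + ps).
Proof.
  intros [Ham [f [Lf ->]]] [Hmb [g [Lg ->]]]. split; [lra |].
  set (c := f m - g m).
  exists (fun t => if Rle_dec t m then f t else g t + c). split.
  2: { destruct (Rle_dec a m); [| lra]. destruct (Rle_dec b m); [| unfold c; lra].
       replace b with m by lra. unfold c; lra. }
  destruct (Lf m) as (Cfm & Nm & Efm); [lra |]. destruct (Lg m) as (Cgm & _ & Egm); [lra |].
  rewrite Efm in Egm at 1. apply polar_inj in Egm; [| intros Z; apply Nm, Cmod_eq_0, Z].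
  assert (Cc : cos c = 1 /\ sin c = 0).
  { unfold c. rewrite cos_minus, sin_minus. destruct Egm as [-> ->].
    assert (E := sin2_cos2 (g m)). unfold Rsqr in E. lra. }
  intros t Ht. destruct (Rlt_dec t m) as [l | n].
  - destruct (Lf t) as (Cf & Nf & Ef); [lra |]. split; [| destruct (Rle_dec t m); [auto | lra]].
    apply continuity_pt_of_eps. intros e He.
    destruct (continuity_pt_eps _ _ e Cf He) as [d [D K]].
    destruct (pos_min d (m - t)) as (d' & D' & M1 & M2); [lra | lra |].
    exists d'. split; [auto |]. intros s Hs. assert (S1 := Rabs_def2 _ _ Hs).
    destruct (Rle_dec s m); [| lra]. destruct (Rle_dec t m); [| lra]. apply K. lra.
  - destruct (Lg t) as (Cg & Ng & Eg); [lra |].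
    assert (EE : polar (Cmod (w t)) (g t) = polar (Cmod (w t)) (g t + c)).
    { unfold polar. rewrite cos_plus, sin_plus. destruct Cc as [-> ->]. f_equal; ring. }
    destruct (Req_dec t m) as [-> | N].
    + destruct (Rle_dec m m); [| lra]. split; [| auto].
      apply continuity_pt_of_eps. intros e He.
      destruct (continuity_pt_eps _ _ e Cfm He) as [d1 [D1 K1]].
      destruct (continuity_pt_eps _ _ e Cgm He) as [d2 [D2 K2]].
      destruct (pos_min d1 d2 D1 D2) as (d & D & M1 & M2). exists d. split; [auto |]. intros s Hs.
      destruct (Rle_dec m m); [| lra]. destruct (Rle_dec s m); [apply K1; lra |].
      replace (g s + c - f m) with (g s - g m) by (unfold c; ring). apply K2. lra.
    + split; [| destruct (Rle_dec t m); [lra |]; rewrite <- EE; auto].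
      apply continuity_pt_of_eps. intros e He.
      destruct (continuity_pt_eps _ _ e Cg He) as [d [D K]].
      destruct (pos_min d (t - m)) as (d' & D' & M1 & M2); [lra | lra |].
      exists d'. split; [auto |]. intros s Hs. assert (S1 := Rabs_def2 _ _ Hs).
      destruct (Rle_dec s m); [lra |]. destruct (Rle_dec t m); [lra |].
      replace (g s + c - (g t + c)) with (g s - g t) by ring. apply K. lra.
Qed.

Lemma Inc_ext u v a b th : (forall t, a <= t <= b -> u t = v t) -> Inc u a b th -> Inc v a b th.
Proof.
  intros E [Hab [f [Lf ->]]]. split; [auto |]. exists f. split; [| auto].
  intros t Ht. rewrite <- E by auto. apply Lf, Ht.
Qed.

(** An argument of [z] only where the real part is positive; other half planes are first turned into
    this one by a constant factor. *)
Definition parg (z : C) : R := atan (snd z / fst z).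

Lemma polar_parg z : 0 < fst z -> z = polar (Cmod z) (parg z).
Proof.
  intros H. destruct z as [x y]; unfold polar, parg, Cmod; simpl in *.
  assert (P : 0 < x * (x * 1) + y * (y * 1)) by nra.
  rewrite cos_atan, sin_atan.
  assert (E : sqrt (1 + (y / x)²) = sqrt (x * (x * 1) + y * (y * 1)) / x).
  { transitivity (sqrt (x * (x * 1) + y * (y * 1)) / sqrt (x²)); [| rewrite sqrt_Rsqr by lra; auto].
    rewrite <- sqrt_div_alt by (unfold Rsqr; nra). f_equal. unfold Rsqr. field. lra. }
  rewrite E. assert (Q := sqrt_lt_R0 _ P).
  f_equal; field; split; lra.
Qed.

(** The range matters for the flow: with arguments in [[- PI, PI]] at the vertices, the
    normalisation changes the increment along a side by at most [2 * PI]. *)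
Lemma polar_exists (z : C) : exists th, - PI <= th <= PI /\ z = polar (Cmod z) th.
Proof.
  assert (P := PI_RGT_0).
  destruct (Rlt_dec 0 (fst z)) as [l | n].
  { exists (parg z). split; [| apply polar_parg, l].
    unfold parg. assert (B := atan_bound (snd z / fst z)). lra. }
  destruct (Rlt_dec (fst z) 0) as [l | n'].
  { assert (Q : 0 < fst (- z)%C) by (simpl; lra).
    assert (E := polar_parg _ Q). rewrite Cmod_opp in E.
    assert (B : - PI / 2 < parg (- z)%C < PI / 2) by apply atan_bound.
    assert (Sh : forall k, (k = PI \/ k = - PI) -> z = polar (Cmod z) (parg (- z)%C + k)).
    { intros k Hk. replace z with (- - z)%C at 1 by ring. rewrite E at 1.
      unfold polar, Copp; simpl. rewrite cos_plus, sin_plus.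
      destruct Hk as [-> | ->]; rewrite ?cos_neg, ?sin_neg, cos_PI, sin_PI; f_equal; ring. }
    destruct (Rle_dec (parg (- z)%C) 0).
    - exists (parg (- z)%C + PI). split; [lra | auto].
    - exists (parg (- z)%C + - PI). split; [lra | auto]. }
  destruct z as [x y]; simpl in *. replace x with 0 by lra.
  unfold Cmod; simpl. replace (0 * (0 * 1) + y * (y * 1)) with (Rsqr y) by (unfold Rsqr; ring).
  rewrite sqrt_Rsqr_abs. unfold polar.
  destruct (Rle_dec 0 y).
  - exists (PI / 2). split; [lra |]. rewrite Rabs_pos_eq, cos_PI2, sin_PI2 by auto. f_equal; ring.
  - exists (- (PI / 2)). split; [lra |].
    rewrite Rabs_left, cos_neg, sin_neg, cos_PI2, sin_PI2 by lra. f_equal; ring.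
Qed.

Lemma pcont_fst w t : pcont w t -> continuity_pt (fun s => fst (w s)) t.
Proof.
  intros H. apply continuity_pt_of_eps. intros e He. destruct (H e He) as [d [D K]].
  exists d; split; [auto |]. intros y Hy. eapply Rle_lt_trans; [| apply (K y Hy)].
  apply (abs_fst_Cmod (w y - w t)).
Qed.

Lemma pcont_snd w t : pcont w t -> continuity_pt (fun s => snd (w s)) t.
Proof.
  intros H. apply continuity_pt_of_eps. intros e He. destruct (H e He) as [d [D K]].
  exists d; split; [auto |]. intros y Hy. eapply Rle_lt_trans; [| apply (K y Hy)].
  apply (abs_snd_Cmod (w y - w t)).
Qed.

Lemma pcont_mult_const w c t : pcont w t -> pcont (fun s => w s * c)%C t.
Proof.
  intros H e He. assert (P := Cmod_ge_0 c).
  destruct (H (e / (Cmod c + 1))) as [d [D K]]; [apply Rdiv_lt_0_compat; lra |].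
  exists d; split; [auto |]. intros s Hs. specialize (K s Hs).
  replace (w s * c - w t * c)%C with ((w s - w t) * c)%C by ring. rewrite Cmod_mult.
  assert (Q := Cmod_ge_0 (w s - w t)).
  assert (Cmod (w s - w t) * (Cmod c + 1) < e / (Cmod c + 1) * (Cmod c + 1))
    by (apply Rmult_lt_compat_r; lra).
  replace (e / (Cmod c + 1) * (Cmod c + 1)) with e in H0 by (field; lra). nra.
Qed.

Lemma Inc_const (c : C) (a b : R) : a <= b -> c <> 0%C -> Inc (fun _ => c) a b 0.
Proof.
  intros Hab Hc. destruct (polar_exists c) as [th [_ E]]. split; [auto |].
  exists (fun _ => th). split; [| ring]. intros t _. split; [| split; [exact Hc | exact E]].
  apply continuity_pt_const. intros x y; reflexivity.
Qed.

Lemma Inc_right_half_plane w a b : a <= b ->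
  (forall t, a <= t <= b -> pcont w t /\ 0 < fst (w t)) ->
  Inc w a b (parg (w b) - parg (w a)).
Proof.
  intros Hab H. split; [auto |]. exists (fun t => parg (w t)). split; [| auto].
  intros t Ht. destruct (H t Ht) as [Ct Pt]. split; [| split].
  - unfold parg. apply (continuity_pt_comp (fun t => snd (w t) / fst (w t)) atan).
    + apply continuity_pt_div; [apply pcont_snd, Ct | apply pcont_fst, Ct | lra].
    + apply derivable_continuous_pt, derivable_pt_atan.
  - intros E. rewrite E in Pt. simpl in Pt. lra.
  - apply polar_parg, Pt.
Qed.

(** The factor [c] turns the half plane into the right one, where [parg] is continuous; dividing by
    the constant path [c] again contributes nothing. *)
Lemma Inc_half_plane w c a b : a <= b ->
  (forall t, a <= t <= b -> pcont w t /\ 0 < fst (w t * c)%C) ->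
  Inc w a b (parg (w b * c) - parg (w a * c)).
Proof.
  intros Hab H.
  assert (Nc : c <> 0%C).
  { intros ->. destruct (H a) as [_ P]; [lra |]. rewrite Cmult_0_r in P. simpl in P. lra. }
  assert (H1 : Inc (fun t => w t * c)%C a b (parg (w b * c) - parg (w a * c))).
  { apply (Inc_right_half_plane (fun t => w t * c)%C); auto. intros t Ht.
    destruct (H t Ht). split; [apply pcont_mult_const; auto | auto]. }
  assert (H2 := Inc_inv _ _ _ _ (Inc_const c a b Hab Nc)).
  assert (H3 := Inc_mult _ _ _ _ _ _ H1 H2).
  replace (parg (w b * c) - parg (w a * c)) with (parg (w b * c) - parg (w a * c) + - 0) by ring.
  eapply Inc_ext; [| exact H3]. intros t _. simpl. field. exact Nc.
Qed.

(** The open disc around [w] whose circle passes through 0 lies in the half plane facing [w].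
    Continuity therefore keeps a non-vanishing function in a half plane locally. *)
Lemma Cconj_near_pos (z w : C) : Cmod (z - w) < Cmod w -> 0 < fst (z * Cconj w)%C.
Proof.
  intros H.
  assert (E : fst (z * Cconj w)%C = fst ((z - w) * Cconj w)%C + Cmod w * Cmod w).
  { assert (Q := Cmod2_alt w). unfold Re, Im in Q. simpl. simpl in Q. nra. }
  assert (A := abs_fst_Cmod ((z - w) * Cconj w)%C). rewrite Cmod_mult, Cmod_conj in A.
  assert (P := Cmod_ge_0 (z - w)).
  assert (- (Cmod (z - w) * Cmod w) <= fst ((z - w) * Cconj w)%C).
  { assert (B := Rle_abs (- fst ((z - w) * Cconj w)%C)). rewrite Rabs_Ropp in B. lra. }
  rewrite E. nra.
Qed.

Lemma Inc_exists w a b : a <= b ->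
  (forall t, a <= t <= b -> pcont w t /\ w t <> 0%C) -> exists th, Inc w a b th.
Proof.
  intros Hab H. apply (interval_ind (fun a b => exists th, Inc w a b th)); auto.
  - intros u v _ _ _ [t1 H1] [t2 H2]. exists (t1 + t2). eapply Inc_cat; eauto.
  - intros t Ht. destruct (H t Ht) as [Ct Nt].
    assert (P : 0 < Cmod (w t)) by (apply Cmod_gt_0, Nt).
    destruct (Ct _ P) as [d [D K]]. exists d; split; [auto |].
    intros u v Hu Huv Hv W. eexists. apply (Inc_half_plane w (Cconj (w t))); [lra |].
    intros s Hs. split; [apply H; lra |].
    apply Cconj_near_pos, K, Rabs_def1; lra.
Qed.

Lemma Inc_integer w a b th alpha beta : Inc w a b th ->
  w a = polar (Cmod (w a)) alpha -> w b = polar (Cmod (w b)) beta ->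
  exists k : Z, th = beta - alpha + 2 * PI * IZR k.
Proof.
  intros [Hab [f [Lf ->]]] Ea Eb.
  destruct (Lf a) as (_ & Na & Fa); [lra |]. destruct (Lf b) as (_ & Nb & Fb); [lra |].
  rewrite Ea in Fa at 1. apply polar_inj in Fa; [| intros Z; apply Na, Cmod_eq_0, Z].
  rewrite Eb in Fb at 1. apply polar_inj in Fb; [| intros Z; apply Nb, Cmod_eq_0, Z].
  assert (Per : forall x y, cos x = cos y /\ sin x = sin y -> exists k, y = x + 2 * PI * IZR k).
  { intros x y [E1 E2].
    assert (C1 : cos (y - x) = 1).
    { rewrite cos_minus, E1, E2. assert (E := sin2_cos2 y). unfold Rsqr in E. lra. }
    assert (S1 : sin ((y - x) / 2) = 0).
    { assert (E := cos_2a_sin ((y - x) / 2)).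
      replace (2 * ((y - x) / 2)) with (y - x) in E by field. nra. }
    apply sin_eq_0_0 in S1. destruct S1 as [k S1]. exists k. lra. }
  destruct (Per _ _ Fa) as [k K], (Per _ _ Fb) as [l L].
  exists (l - k)%Z. rewrite minus_IZR, K, L. ring.
Qed.

(** * Winding numbers along rectangles *)

Definition inrect (x0 x1 y0 y1 : R) (z : C) : Prop :=
  x0 <= fst z <= x1 /\ y0 <= snd z <= y1.

Definition interior_rect (x0 x1 y0 y1 : R) (z : C) : Prop :=
  x0 < fst z < x1 /\ y0 < snd z < y1.

Definition bdry (x0 x1 y0 y1 : R) (z : C) : Prop :=
  inrect x0 x1 y0 y1 z /\ ~ interior_rect x0 x1 y0 y1 z.

Definition hor (u : C -> C) (y : R) : R -> C := fun s => u (s, y).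
Definition ver (u : C -> C) (x : R) : R -> C := fun s => u (x, s).

(** The boundary is run through counterclockwise, so the top and the left side count negatively. *)
Definition Wind (u : C -> C) (x0 x1 y0 y1 th : R) : Prop :=
  exists b r t l, Inc (hor u y0) x0 x1 b /\ Inc (ver u x1) y0 y1 r /\
    Inc (hor u y1) x0 x1 t /\ Inc (ver u x0) y0 y1 l /\ th = b + r - t - l.

Lemma pcont_hor u y s : ccont u (s, y) -> pcont (hor u y) s.
Proof.
  intros H e He. destruct (H e He) as [d [D K]]. exists d; split; [auto |].
  intros t Ht. apply K. replace ((t, y) - (s, y))%C with (RtoC (t - s)).
  - rewrite Cmod_R. exact Ht.
  - apply injective_projections; simpl; ring.
Qed.

Lemma pcont_ver u x s : ccont u (x, s) -> pcont (ver u x) s.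
Proof.
  intros H e He. destruct (H e He) as [d [D K]]. exists d; split; [auto |].
  intros t Ht. apply K. replace ((x, t) - (x, s))%C with (Ci * RtoC (t - s))%C.
  - rewrite Cmod_mult, Cmod_Ci, Cmod_R, Rmult_1_l. exact Ht.
  - apply injective_projections; simpl; ring.
Qed.

Lemma Wind_unique u x0 x1 y0 y1 th ps :
  Wind u x0 x1 y0 y1 th -> Wind u x0 x1 y0 y1 ps -> th = ps.
Proof.
  intros (b & r & t & l & H1 & H2 & H3 & H4 & ->) (b' & r' & t' & l' & K1 & K2 & K3 & K4 & ->).
  rewrite (Inc_unique _ _ _ _ _ H1 K1), (Inc_unique _ _ _ _ _ H2 K2),
    (Inc_unique _ _ _ _ _ H3 K3), (Inc_unique _ _ _ _ _ H4 K4). reflexivity.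
Qed.

Lemma Wind_mul u v x0 x1 y0 y1 th ps :
  Wind u x0 x1 y0 y1 th -> Wind v x0 x1 y0 y1 ps ->
  Wind (fun z => u z * v z)%C x0 x1 y0 y1 (th + ps).
Proof.
  intros (b & r & t & l & H1 & H2 & H3 & H4 & ->) (b' & r' & t' & l' & K1 & K2 & K3 & K4 & ->).
  exists (b + b'), (r + r'), (t + t'), (l + l').
  repeat split; try (eapply Inc_mult; eassumption); try apply H1; try apply H2; try ring.
Qed.

Lemma Wind_inv u x0 x1 y0 y1 th :
  Wind u x0 x1 y0 y1 th -> Wind (fun z => / u z)%C x0 x1 y0 y1 (- th).
Proof.
  intros (b & r & t & l & H1 & H2 & H3 & H4 & ->).
  exists (- b), (- r), (- t), (- l).
  repeat split; try (eapply Inc_inv; eassumption); try apply H1; try apply H2; ring.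
Qed.

Lemma bdry_sides x0 x1 y0 y1 s : x0 <= x1 -> y0 <= y1 ->
  (x0 <= s <= x1 -> bdry x0 x1 y0 y1 (s, y0) /\ bdry x0 x1 y0 y1 (s, y1)) /\
  (y0 <= s <= y1 -> bdry x0 x1 y0 y1 (x0, s) /\ bdry x0 x1 y0 y1 (x1, s)).
Proof.
  intros; unfold bdry, inrect, interior_rect; simpl. repeat split; try lra; intros ?; lra.
Qed.

Lemma Wind_ext u v x0 x1 y0 y1 th : (forall z, bdry x0 x1 y0 y1 z -> u z = v z) ->
  Wind u x0 x1 y0 y1 th -> Wind v x0 x1 y0 y1 th.
Proof.
  intros E (b & r & t & l & H1 & H2 & H3 & H4 & ->).
  assert (Hx : x0 <= x1) by apply H1. assert (Hy : y0 <= y1) by apply H2.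
  exists b, r, t, l. repeat split; auto; try (eapply Inc_ext; [| eassumption]); auto.
  all: intros s Hs; apply E; apply bdry_sides; auto.
Qed.

Lemma Wind_half_plane u c x0 x1 y0 y1 : x0 <= x1 -> y0 <= y1 ->
  (forall z, bdry x0 x1 y0 y1 z -> ccont u z /\ 0 < fst (u z * c)%C) ->
  Wind u x0 x1 y0 y1 0.
Proof.
  intros Hx Hy H. do 4 eexists. repeat split; try assumption.
  1, 3: apply (Inc_half_plane (hor u _) c); auto; intros s Hs.
  3, 4: apply (Inc_half_plane (ver u _) c); auto; intros s Hs.
  1, 2: destruct (bdry_sides x0 x1 y0 y1 s Hx Hy) as [B _]; destruct (B Hs) as [B1 B2];
    apply H in B1; apply H in B2; split; [apply pcont_hor |]; tauto.
  1, 2: destruct (bdry_sides x0 x1 y0 y1 s Hx Hy) as [_ B]; destruct (B Hs) as [B1 B2];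
    apply H in B1; apply H in B2; split; [apply pcont_ver |]; tauto.
  unfold hor, ver. ring.
Qed.

Lemma Cmod_le_sides z w a b : Rabs (fst z - fst w) <= a -> Rabs (snd z - snd w) <= b ->
  Cmod (z - w) <= a + b.
Proof.
  intros Ha Hb. eapply Rle_trans; [apply Cmod_le_abs |].
  change (Rabs (fst z - fst w) + Rabs (snd z - snd w) <= a + b). lra.
Qed.

Lemma inrect_dist x0 x1 y0 y1 z w : inrect x0 x1 y0 y1 z -> inrect x0 x1 y0 y1 w ->
  Cmod (z - w) <= (x1 - x0) + (y1 - y0).
Proof.
  intros [? ?] [? ?]. apply Cmod_le_sides; apply Rabs_le; lra.
Qed.

(** Compactness for properties of sets that pass to subsets and to unions of two sets. It yields
    finitely many zeros and poles in a rectangle, and squares of one common size. *)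
Lemma rect_compact (P : (C -> Prop) -> Prop) :
  (forall S T : C -> Prop, (forall z, S z -> T z) -> P T -> P S) ->
  (forall S T : C -> Prop, P S -> P T -> P (fun z => S z \/ T z)) ->
  (forall a, exists r, 0 < r /\ P (fun z => Cmod (z - a) < r)) ->
  forall x0 x1 y0 y1, x0 <= x1 -> y0 <= y1 -> P (inrect x0 x1 y0 y1).
Proof.
  intros Mono Union Loc x0 x1 y0 y1 H0 H1.
  apply (rect_ind (fun x0 x1 y0 y1 => P (inrect x0 x1 y0 y1))); auto.
  - intros x x' y y' _ _ _ _ _ _ P1 P2 P3 P4.
    apply (Mono _ (fun z => (inrect x ((x + x') / 2) y ((y + y') / 2) z \/
      inrect ((x + x') / 2) x' y ((y + y') / 2) z) \/
      (inrect x ((x + x') / 2) ((y + y') / 2) y' z \/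
       inrect ((x + x') / 2) x' ((y + y') / 2) y' z))); auto.
    unfold inrect. intros z [Z1 Z2].
    destruct (Rle_dec (fst z) ((x + x') / 2)), (Rle_dec (snd z) ((y + y') / 2)).
    + left; left; lra.
    + right; left; lra.
    + left; right; lra.
    + right; right; lra.
  - intros x y X Y. destruct (Loc (x, y)) as (d & D & K). exists (d / 2). split; [lra |].
    intros a b c e _ Ha _ _ Hc _ W1 W2. eapply Mono; [| apply K].
    intros z Hz. eapply Rle_lt_trans; [apply (inrect_dist a b c e); auto | lra].
    split; simpl; lra.
Qed.

(** Each inner side belongs to two quarters and is run through in opposite directions; uniqueness of
    the increment makes the two contributions cancel. *)
Lemma Wind_split u x0 x xx y0 y yy t1 t2 t3 t4 :
  Wind u x0 x y0 y t1 -> Wind u x xx y0 y t2 -> Wind u x0 x y yy t3 -> Wind u x xx y yy t4 ->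
  Wind u x0 xx y0 yy (t1 + t2 + t3 + t4).
Proof.
  intros (b1 & r1 & u1 & l1 & A1 & A2 & A3 & A4 & ->) (b2 & r2 & u2 & l2 & B1 & B2 & B3 & B4 & ->)
    (b3 & r3 & u3 & l3 & D1 & D2 & D3 & D4 & ->) (b4 & r4 & u4 & l4 & E1 & E2 & E3 & E4 & ->).
  rewrite (Inc_unique _ _ _ _ _ A2 B4), (Inc_unique _ _ _ _ _ A3 D1),
    (Inc_unique _ _ _ _ _ B3 E1), (Inc_unique _ _ _ _ _ D2 E4).
  exists (b1 + b2), (r2 + r4), (u3 + u4), (l1 + l3).
  split; [eapply Inc_cat; eassumption |]. split; [eapply Inc_cat; eassumption |].
  split; [eapply Inc_cat; eassumption |]. split; [eapply Inc_cat; eassumption |]. ring.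
Qed.

(** On a small rectangle the values stay in one half plane, so the winding is 0 there; [Wind_split]
    adds these zeros up. *)
Lemma Wind_nonvanishing u x0 x1 y0 y1 : x0 <= x1 -> y0 <= y1 ->
  (forall z, inrect x0 x1 y0 y1 z -> ccont u z /\ u z <> 0%C) ->
  Wind u x0 x1 y0 y1 0.
Proof.
  intros Hx Hy H. apply (rect_ind (fun a b c d => Wind u a b c d 0)); auto.
  - intros a b c d _ _ _ _ _ _ W1 W2 W3 W4.
    replace 0 with (0 + 0 + 0 + 0) by ring. eapply Wind_split; eassumption.
  - intros x y X Y. destruct (H (x, y)) as [Cz Nz]; [split; auto |].
    assert (P : 0 < Cmod (u (x, y))) by (apply Cmod_gt_0, Nz).
    destruct (Cz _ P) as [e [E K]]. exists (e / 2). split; [lra |].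
    intros a b c d Ha Hab Hb Hc Hcd Hd W1 W2.
    apply (Wind_half_plane u (Cconj (u (x, y)))); try lra.
    intros z [Hz _]. split.
    + apply H. unfold inrect in *. lra.
    + apply Cconj_near_pos, K.
      eapply Rle_lt_trans; [apply (inrect_dist a b c d) |]; auto; [| lra].
      unfold inrect; simpl; lra.
Qed.

Lemma atan_corner a b : 0 < a -> 0 < b -> atan (a / b) + atan (b / a) = PI / 2.
Proof.
  intros Ha Hb. replace (b / a) with (/ (a / b)) by (field; lra).
  rewrite atan_inv by (apply Rdiv_lt_0_compat; auto). ring.
Qed.

Lemma Wind_lin c x0 x1 y0 y1 : interior_rect x0 x1 y0 y1 c ->
  Wind (fun z => z - c)%C x0 x1 y0 y1 (2 * PI).
Proof.
  intros [[X1 X2] [Y1 Y2]].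
  assert (CC : forall z, ccont (fun z => z - c)%C z) by (intros; apply cdiff_ccont, cdiff_lin).
  assert (HH : forall y k, (forall s, 0 < fst (hor (fun z => z - c)%C y s * k)%C) ->
    Inc (hor (fun z => z - c)%C y) x0 x1
      (parg (hor (fun z => z - c) y x1 * k)%C - parg (hor (fun z => z - c) y x0 * k)%C)).
  { intros y k Hk. apply Inc_half_plane; [lra |]. intros. split; [apply pcont_hor; auto | auto]. }
  assert (VV : forall x k, (forall s, 0 < fst (ver (fun z => z - c)%C x s * k)%C) ->
    Inc (ver (fun z => z - c)%C x) y0 y1
      (parg (ver (fun z => z - c) x y1 * k)%C - parg (ver (fun z => z - c) x y0 * k)%C)).
  { intros x k Hk. apply Inc_half_plane; [lra |]. intros. split; [apply pcont_ver; auto | auto]. }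
  do 4 eexists.
  (* Seen from [c] each side lies in a half plane, which the factors [Ci], [1], [- Ci], [- 1] turn
     into the right one. The eight arctangents then pair up at the corners, and each pair is a right
     angle. *)
  split; [apply (HH y0 Ci); intros; simpl; lra |].
  split; [apply (VV x1 1%C); intros; simpl; lra |].
  split; [apply (HH y1 (- Ci)%C); intros; simpl; lra |].
  split; [apply (VV x0 (- (1))%C); intros; simpl; lra |].
  set (p := fst c - x0). set (q := x1 - fst c). set (d := snd c - y0). set (e := y1 - snd c).
  assert (Pp : 0 < p) by (unfold p; lra). assert (Pq : 0 < q) by (unfold q; lra).
  assert (Pd : 0 < d) by (unfold d; lra). assert (Pe : 0 < e) by (unfold e; lra).
  transitivity (atan (q / d) - atan (- (p / d)) + (atan (e / q) - atan (- (d / q)))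
    - (atan (- (q / e)) - atan (p / e)) - (atan (- (e / p)) - atan (d / p))).
  - rewrite !atan_opp. assert (K1 := atan_corner p d Pp Pd). assert (K2 := atan_corner q d Pq Pd).
    assert (K3 := atan_corner p e Pp Pe). assert (K4 := atan_corner q e Pq Pe). lra.
  - unfold parg, hor, ver; simpl.
    repeat match goal with
      | |- Rplus _ _ = Rplus _ _ => f_equal
      | |- Rminus _ _ = Rminus _ _ => f_equal
      | |- atan _ = atan _ => f_equal
    end; unfold p, q, d, e in *; field; lra.
Qed.

Definition prodl (A : list C) (z : C) : C := fold_right (fun c acc => (z - c) * acc)%C (RtoC 1) A.

Lemma prodl_neq0 A z : ~ In z A -> prodl A z <> 0%C.
Proof.
  induction A as [| c A IH]; simpl; intros H; [apply C1_nz |].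
  apply Cmult_neq_0; [apply Cminus_neq0; intros E; apply H; auto | apply IH; tauto].
Qed.

Lemma cdiff_prodl A z : cdiff (prodl A) z.
Proof.
  induction A as [| c A IH]; [apply cdiff_const |].
  apply (cdiff_mult (fun z => z - c)%C (prodl A)); [apply cdiff_lin | exact IH].
Qed.

Lemma prodl_app A B z : prodl (A ++ B) z = (prodl A z * prodl B z)%C.
Proof. induction A as [| c A IH]; simpl; [ring | rewrite IH; ring]. Qed.

Lemma prodl_repeat c n z : prodl (repeat c n) z = ((z - c) ^ n)%C.
Proof. induction n as [| n IH]; [reflexivity |]. rewrite Cpow_S, <- IH. reflexivity. Qed.

Lemma Wind_prodl A x0 x1 y0 y1 : x0 <= x1 -> y0 <= y1 ->
  (forall c, In c A -> interior_rect x0 x1 y0 y1 c) ->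
  Wind (prodl A) x0 x1 y0 y1 (2 * PI * INR (length A)).
Proof.
  intros Hx Hy. induction A as [| c A IH]; intros H.
  - simpl. rewrite Rmult_0_r. apply (Wind_half_plane _ 1%C); auto. intros z _.
    split; [apply ccont_const | simpl; lra].
  - replace (2 * PI * INR (length (c :: A))) with (2 * PI + 2 * PI * INR (length A))
      by (simpl length; rewrite S_INR; ring).
    apply (Wind_mul (fun z => z - c)%C (prodl A)).
    + apply Wind_lin, H. left; auto.
    + apply IH. intros; apply H; right; auto.
Qed.

(** * Cauchy integrals *)

Definition cint (w : R -> C) (a b : R) : C :=
  (RInt (fun s => fst (w s)) a b, RInt (fun s => snd (w s)) a b).

Definition contseg (w : R -> C) (a b : R) : Prop := forall t, a <= t <= b -> pcont w t.

Lemma contseg_ex_RInt w a b : a <= b -> contseg w a b ->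
  ex_RInt (fun s => fst (w s)) a b /\ ex_RInt (fun s => snd (w s)) a b.
Proof.
  intros Hab H.
  split; apply (ex_RInt_continuous (V := R_CompleteNormedModule)); intros z Hz;
    rewrite Rmin_left, Rmax_right in Hz by auto; apply continuity_pt_filterlim.
  - apply pcont_fst, H, Hz.
  - apply pcont_snd, H, Hz.
Qed.

Lemma contseg_sub w a b c d : a <= c -> d <= b -> contseg w a b -> contseg w c d.
Proof. intros ? ? H t Ht. apply H. lra. Qed.

Lemma cint_Chasles w a m b : a <= m -> m <= b -> contseg w a b ->
  (cint w a m + cint w m b = cint w a b)%C.
Proof.
  intros Ham Hmb H.
  destruct (contseg_ex_RInt w a m) as [A1 A2]; [lra | eapply contseg_sub; [| | eauto]; lra |].
  destruct (contseg_ex_RInt w m b) as [B1 B2]; [lra | eapply contseg_sub; [| | eauto]; lra |].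
  unfold cint. apply injective_projections; simpl; apply (RInt_Chasles (V := R_CompleteNormedModule)); auto.
Qed.

Lemma cint_plus u v a b : a <= b -> contseg u a b -> contseg v a b ->
  cint (fun s => u s + v s)%C a b = (cint u a b + cint v a b)%C.
Proof.
  intros Hab Hu Hv.
  destruct (contseg_ex_RInt _ _ _ Hab Hu), (contseg_ex_RInt _ _ _ Hab Hv).
  unfold cint. apply injective_projections; simpl;
    apply (RInt_plus (V := R_CompleteNormedModule)); auto.
Qed.

Lemma RInt_Rmult_l (k : R) (f : R -> R) a b : ex_RInt f a b ->
  ex_RInt (fun s => k * f s) a b /\ RInt (fun s => k * f s) a b = k * RInt f a b.
Proof.
  intros H. split.
  - apply (ex_RInt_scal (V := R_CompleteNormedModule)), H.
  - apply (RInt_scal (V := R_CompleteNormedModule)), H.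
Qed.

Lemma cint_scal c u a b : a <= b -> contseg u a b ->
  cint (fun s => c * u s)%C a b = (c * cint u a b)%C.
Proof.
  intros Hab Hu. destruct (contseg_ex_RInt _ _ _ Hab Hu) as [E1 E2].
  destruct (RInt_Rmult_l (fst c) _ _ _ E1) as [X1 F1], (RInt_Rmult_l (snd c) _ _ _ E1) as [X2 F2],
    (RInt_Rmult_l (fst c) _ _ _ E2) as [X3 F3], (RInt_Rmult_l (snd c) _ _ _ E2) as [X4 F4].
  unfold cint. apply injective_projections; simpl.
  - transitivity (minus (RInt (fun s => fst c * fst (u s)) a b) (RInt (fun s => snd c * snd (u s)) a b)).
    + apply (RInt_minus (V := R_CompleteNormedModule)); auto.
    + rewrite F1, F4. reflexivity.
  - transitivity (plus (RInt (fun s => fst c * snd (u s)) a b) (RInt (fun s => snd c * fst (u s)) a b)).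
    + apply (RInt_plus (V := R_CompleteNormedModule)); auto.
    + rewrite F2, F3. reflexivity.
Qed.

Lemma cint_ext u v a b : a <= b -> (forall s, a <= s <= b -> u s = v s) -> cint u a b = cint v a b.
Proof.
  intros Hab E. unfold cint. f_equal; apply RInt_ext; intros s Hs;
    rewrite Rmin_left, Rmax_right in Hs by auto; rewrite E by lra; reflexivity.
Qed.

(** Real and imaginary part are estimated separately at the cost of the factor 2. Sharp constants
    are needed nowhere; this factor reappears in the 4 of [rint_bound]. *)
Lemma cint_bound w a b M : a <= b -> contseg w a b ->
  (forall s, a <= s <= b -> Cmod (w s) <= M) -> Cmod (cint w a b) <= 2 * M * (b - a).
Proof.
  intros Hab H B. destruct (contseg_ex_RInt _ _ _ Hab H) as [E1 E2].
  eapply Rle_trans; [apply Cmod_le_abs |]. unfold cint; simpl.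
  assert (I1 := abs_RInt_le_const (fun s => fst (w s)) a b M Hab E1).
  assert (I2 := abs_RInt_le_const (fun s => snd (w s)) a b M Hab E2).
  assert (J1 : Rabs (RInt (fun s => fst (w s)) a b) <= (b - a) * M).
  { apply I1. intros t Ht. eapply Rle_trans; [apply abs_fst_Cmod | auto]. }
  assert (J2 : Rabs (RInt (fun s => snd (w s)) a b) <= (b - a) * M).
  { apply I2. intros t Ht. eapply Rle_trans; [apply abs_snd_Cmod | auto]. }
  lra.
Qed.

Lemma RInt_ext_R (f g : R -> R) a b : (forall s, f s = g s) -> RInt f a b = RInt g a b.
Proof. intros E. apply RInt_ext. intros s _. apply E. Qed.

Lemma RInt_affine p q a b : RInt (fun s => p + q * s) a b = p * (b - a) + q * ((b * b - a * a) / 2).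
Proof.
  apply is_RInt_unique.
  replace (p * (b - a) + q * ((b * b - a * a) / 2))
    with (minus ((fun s => p * s + q * (s * s / 2)) b) ((fun s => p * s + q * (s * s / 2)) a)).
  - apply (is_RInt_derive (fun s => p * s + q * (s * s / 2))).
    + intros x _. auto_derive; [auto | field].
    + intros x _. apply continuity_pt_filterlim. apply derivable_continuous_pt.
      reg.
  - unfold minus, plus, opp; simpl. field.
Qed.

Lemma cint_affine (p q : C) a b :
  cint (fun s => p + q * RtoC s)%C a b = (p * RtoC (b - a) + q * RtoC ((b * b - a * a) / 2))%C.
Proof.
  unfold cint. apply injective_projections; simpl.
  - rewrite (RInt_ext_R _ (fun s => fst p + fst q * s)) by (intros; ring). rewrite RInt_affine. ring.
  - rewrite (RInt_ext_R _ (fun s => snd p + snd q * s)) by (intros; ring). rewrite RInt_affine. ring.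
Qed.

(** The contour integral of [g dz], counterclockwise. On the vertical sides [dz] is [Ci] times the
    differential of the parameter. *)
Definition rint (g : C -> C) (x0 x1 y0 y1 : R) : C :=
  (cint (hor g y0) x0 x1 + Ci * cint (ver g x1) y0 y1
   - cint (hor g y1) x0 x1 - Ci * cint (ver g x0) y0 y1)%C.

Definition contrect (g : C -> C) x0 x1 y0 y1 : Prop :=
  forall z, bdry x0 x1 y0 y1 z -> ccont g z.

Lemma contrect_sides g x0 x1 y0 y1 : x0 <= x1 -> y0 <= y1 -> contrect g x0 x1 y0 y1 ->
  contseg (hor g y0) x0 x1 /\ contseg (ver g x1) y0 y1 /\
  contseg (hor g y1) x0 x1 /\ contseg (ver g x0) y0 y1.
Proof.
  intros Hx Hy H. repeat split; intros s Hs.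
  1, 3: apply pcont_hor, H, bdry_sides; auto.
  1, 2: apply pcont_ver, H, bdry_sides; auto.
Qed.

Lemma rint_plus f g x0 x1 y0 y1 : x0 <= x1 -> y0 <= y1 ->
  contrect f x0 x1 y0 y1 -> contrect g x0 x1 y0 y1 ->
  rint (fun z => f z + g z)%C x0 x1 y0 y1 = (rint f x0 x1 y0 y1 + rint g x0 x1 y0 y1)%C.
Proof.
  intros Hx Hy Hf Hg.
  destruct (contrect_sides f _ _ _ _ Hx Hy Hf) as (F1 & F2 & F3 & F4).
  destruct (contrect_sides g _ _ _ _ Hx Hy Hg) as (G1 & G2 & G3 & G4).
  unfold rint.
  change (hor (fun z => f z + g z)%C) with (fun y s => hor f y s + hor g y s)%C.
  change (ver (fun z => f z + g z)%C) with (fun y s => ver f y s + ver g y s)%C.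
  cbv beta. rewrite !cint_plus by auto. ring.
Qed.

Lemma rint_scal c f x0 x1 y0 y1 : x0 <= x1 -> y0 <= y1 -> contrect f x0 x1 y0 y1 ->
  rint (fun z => c * f z)%C x0 x1 y0 y1 = (c * rint f x0 x1 y0 y1)%C.
Proof.
  intros Hx Hy Hf.
  destruct (contrect_sides f _ _ _ _ Hx Hy Hf) as (F1 & F2 & F3 & F4).
  unfold rint.
  change (hor (fun z => c * f z)%C) with (fun y s => c * hor f y s)%C.
  change (ver (fun z => c * f z)%C) with (fun y s => c * ver f y s)%C.
  cbv beta. rewrite !cint_scal by auto. ring.
Qed.

Lemma rint_ext f g x0 x1 y0 y1 : x0 <= x1 -> y0 <= y1 ->
  (forall z, bdry x0 x1 y0 y1 z -> f z = g z) -> rint f x0 x1 y0 y1 = rint g x0 x1 y0 y1.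
Proof.
  intros Hx Hy E. unfold rint.
  rewrite (cint_ext (hor f y0) (hor g y0)), (cint_ext (ver f x1) (ver g x1)),
    (cint_ext (hor f y1) (hor g y1)), (cint_ext (ver f x0) (ver g x0)); auto.
  all: intros s Hs; apply E, bdry_sides; auto.
Qed.

Lemma rint_bound g x0 x1 y0 y1 M : x0 <= x1 -> y0 <= y1 -> contrect g x0 x1 y0 y1 ->
  (forall z, bdry x0 x1 y0 y1 z -> Cmod (g z) <= M) ->
  Cmod (rint g x0 x1 y0 y1) <= 4 * M * ((x1 - x0) + (y1 - y0)).
Proof.
  intros Hx Hy H B. destruct (contrect_sides g _ _ _ _ Hx Hy H) as (G1 & G2 & G3 & G4).
  assert (B1 := cint_bound _ _ _ M Hx G1). assert (B2 := cint_bound _ _ _ M Hy G2).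
  assert (B3 := cint_bound _ _ _ M Hx G3). assert (B4 := cint_bound _ _ _ M Hy G4).
  unfold rint, Cminus.
  eapply Rle_trans; [apply Cmod_triangle |]. rewrite Cmod_opp, Cmod_mult, Cmod_Ci.
  assert (T1 := Cmod_triangle (cint (hor g y0) x0 x1 + Ci * cint (ver g x1) y0 y1) (- cint (hor g y1) x0 x1)).
  assert (T2 := Cmod_triangle (cint (hor g y0) x0 x1) (Ci * cint (ver g x1) y0 y1)).
  rewrite Cmod_opp in T1. rewrite Cmod_mult, Cmod_Ci in T2.
  enough (Cmod (cint (hor g y0) x0 x1) <= 2 * M * (x1 - x0) /\
    Cmod (cint (hor g y1) x0 x1) <= 2 * M * (x1 - x0) /\
    Cmod (cint (ver g x0) y0 y1) <= 2 * M * (y1 - y0) /\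
    Cmod (cint (ver g x1) y0 y1) <= 2 * M * (y1 - y0)) by lra.
  repeat split; [apply B1 | apply B3 | apply B4 | apply B2]; intros s Hs; apply B, bdry_sides; auto.
Qed.

Lemma rint_split_x g x0 x xx y0 y1 : x0 <= x -> x <= xx ->
  contseg (hor g y0) x0 xx -> contseg (hor g y1) x0 xx ->
  rint g x0 xx y0 y1 = (rint g x0 x y0 y1 + rint g x xx y0 y1)%C.
Proof.
  intros H1 H2 C1 C2. unfold rint.
  rewrite <- (cint_Chasles (hor g y0) x0 x xx), <- (cint_Chasles (hor g y1) x0 x xx) by auto. ring.
Qed.

Lemma rint_split_y g x0 x1 y0 y yy : y0 <= y -> y <= yy ->
  contseg (ver g x0) y0 yy -> contseg (ver g x1) y0 yy ->
  rint g x0 x1 y0 yy = (rint g x0 x1 y0 y + rint g x0 x1 y yy)%C.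
Proof.
  intros H1 H2 C1 C2. unfold rint.
  rewrite <- (cint_Chasles (ver g x0) y0 y yy), <- (cint_Chasles (ver g x1) y0 y yy) by auto. ring.
Qed.

Lemma rint_affine p q x0 x1 y0 y1 : x0 <= x1 -> y0 <= y1 ->
  rint (fun z => p + q * z)%C x0 x1 y0 y1 = 0%C.
Proof.
  intros Hx Hy. unfold rint.
  assert (H : forall y, cint (hor (fun z => p + q * z)%C y) x0 x1
    = ((p + q * (Ci * RtoC y)) * RtoC (x1 - x0) + q * RtoC ((x1 * x1 - x0 * x0) / 2))%C).
  { intros y. rewrite <- cint_affine. apply cint_ext; auto. intros s _.
    unfold hor. apply injective_projections; simpl; ring. }
  assert (V : forall x, cint (ver (fun z => p + q * z)%C x) y0 y1
    = ((p + q * RtoC x) * RtoC (y1 - y0) + (q * Ci) * RtoC ((y1 * y1 - y0 * y0) / 2))%C).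
  { intros x. rewrite <- cint_affine. apply cint_ext; auto. intros s _.
    unfold ver. apply injective_projections; simpl; ring. }
  rewrite !H, !V. apply injective_projections; simpl; field.
Qed.

Lemma le_0_of_le_small x k : 0 <= k -> (forall e, 0 < e -> x <= e * k) -> x <= 0.
Proof.
  intros Hk H. apply le_epsilon. intros e He. rewrite Rplus_0_l.
  eapply Rle_trans; [apply (H (e / (k + 1))), Rdiv_lt_0_compat; lra |].
  apply Rle_trans with (e / (k + 1) * (k + 1)); [| right; field; lra].
  apply Rmult_le_compat_l; [apply Rdiv_le_0_compat |]; lra.
Qed.

(** For each [e] the integral is at most [e] times the squared half perimeter. This bound survives
    quartering, since four quarters have a quarter of the square each. Locally the affine part of
    [g] integrates to zero, and the rest is at most [e / 4] times the half perimeter, which the 4 of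
    [rint_bound] turns into the claim. *)
Lemma Goursat g x0 x1 y0 y1 : x0 <= x1 -> y0 <= y1 ->
  (forall z, inrect x0 x1 y0 y1 z -> cdiff g z) -> rint g x0 x1 y0 y1 = 0%C.
Proof.
  intros Hx Hy Hg. apply Cmod_eq_0, Rle_antisym; [| apply Cmod_ge_0].
  assert (Cg : forall z, inrect x0 x1 y0 y1 z -> ccont g z) by (intros; apply cdiff_ccont; auto).
  set (W := (x1 - x0) + (y1 - y0)). assert (HW : 0 <= W) by (unfold W; lra).
  apply (le_0_of_le_small _ (W * W)); [nra |].
  intros e He.
  apply (rect_ind (fun a b c d => Cmod (rint g a b c d) <= e * (((b - a) + (d - c)) * ((b - a) + (d - c)))));
    auto.
  - intros a b c d Ha Hab Hb Hc Hcd Hd Q1 Q2 Q3 Q4.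
    assert (HS : forall y, c <= y <= d -> contseg (hor g y) a b).
    { intros y Y s Hs. apply pcont_hor, Cg. split; simpl; lra. }
    assert (VS : forall x, a <= x <= b -> contseg (ver g x) c d).
    { intros x X s Hs. apply pcont_ver, Cg. split; simpl; lra. }
    rewrite (rint_split_x g a ((a + b) / 2) b), (rint_split_y g a _ c ((c + d) / 2) d),
      (rint_split_y g _ b c ((c + d) / 2) d); try apply HS; try apply VS; try lra.
    eapply Rle_trans; [apply Cmod_triangle |].
    eapply Rle_trans; [apply Rplus_le_compat; apply Cmod_triangle |]. nra.
  - intros x y X Y. destruct (Hg (x, y)) as [s [Hs E]]; [split; auto |].
    set (z0 := (x, y) : C) in *.
    destruct (Hs (e / 4)) as [dl [D K]]; [lra |]. exists (dl / 2). split; [lra |].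
    intros a b c d Ha Hab Hb Hc Hcd Hd W1 W2.
    assert (Hz0 : inrect a b c d z0) by (split; simpl; lra).
    assert (Hr : forall z, bdry a b c d z -> inrect x0 x1 y0 y1 z /\ Cmod (z - z0) <= (b - a) + (d - c)).
    { intros z [Hz _]. split; [unfold inrect in *; lra | apply inrect_dist; auto]. }
    set (f1 := fun z => ((g z0 - s z0 * z0) + s z0 * z)%C).
    set (f2 := fun z => (g z + - RtoC 1 * f1 z)%C).
    assert (C1 : forall z, ccont f1 z).
    { intros z. apply ccont_plus; [apply ccont_const | apply ccont_mult; [apply ccont_const | apply ccont_id]]. }
    assert (C2 : contrect f2 a b c d).
    { intros z Hz. apply ccont_plus; [apply Cg, Hr, Hz | apply ccont_mult; auto using ccont_const]. }
    rewrite (rint_ext g (fun z => f1 z + f2 z)%C); try lra.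
    2: { intros z _. unfold f2. ring. }
    rewrite rint_plus; try lra; auto; [| intros z _; apply C1].
    unfold f1 at 1. rewrite rint_affine, Cplus_0_l by lra.
    eapply Rle_trans; [apply (rint_bound f2 a b c d (e / 4 * ((b - a) + (d - c)))); auto; try lra |].
    + intros z Hz. destruct (Hr z Hz) as [_ L].
      replace (f2 z) with ((s z - s z0) * (z - z0))%C by (unfold f2, f1; rewrite (E z); ring).
      rewrite Cmod_mult. apply Rmult_le_compat; try apply Cmod_ge_0; auto.
      left. apply K. lra.
    + right. field.
Qed.

(** The complement of the small square is cut into four rectangles that avoid [z0], and Goursat's
    lemma applies to each. *)
Lemma rint_shrink q z0 r x0 x1 y0 y1 : 0 < r ->
  x0 <= fst z0 - r -> fst z0 + r <= x1 -> y0 <= snd z0 - r -> snd z0 + r <= y1 ->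
  (forall z, inrect x0 x1 y0 y1 z -> z <> z0 -> cdiff q z) ->
  rint q x0 x1 y0 y1 = rint q (fst z0 - r) (fst z0 + r) (snd z0 - r) (snd z0 + r).
Proof.
  intros Hr X0 X1 Y0 Y1 H.
  assert (Cq : forall z, inrect x0 x1 y0 y1 z -> z <> z0 -> ccont q z) by (intros; apply cdiff_ccont; auto).
  assert (HS : forall y, y0 <= y <= y1 -> y <> snd z0 -> contseg (hor q y) x0 x1).
  { intros y Y N s Hs. apply pcont_hor, Cq; [split; auto | intros E; apply N; rewrite <- E; auto]. }
  assert (VS : forall x, x0 <= x <= x1 -> x <> fst z0 -> contseg (ver q x) y0 y1).
  { intros x X N s Hs. apply pcont_ver, Cq; [split; auto | intros E; apply N; rewrite <- E; auto]. }
  rewrite (rint_split_x q x0 (fst z0 - r) x1); [| lra | lra | apply HS; lra | apply HS; lra].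
  rewrite (rint_split_x q (fst z0 - r) (fst z0 + r) x1); [| lra | lra | |].
  2, 3: eapply contseg_sub; [| | apply HS]; lra.
  rewrite (rint_split_y q (fst z0 - r) _ y0 (snd z0 - r) y1); [| lra | lra | apply VS; lra | apply VS; lra].
  rewrite (rint_split_y q (fst z0 - r) _ (snd z0 - r) (snd z0 + r) y1); [| lra | lra | |].
  2, 3: eapply contseg_sub; [| | apply VS]; lra.
  rewrite (Goursat q x0 (fst z0 - r)), (Goursat q (fst z0 + r) x1),
    (Goursat q (fst z0 - r) (fst z0 + r) y0), (Goursat q (fst z0 - r) (fst z0 + r) (snd z0 + r)); try lra.
  1: ring.
  all: intros z [A B]; apply H; [split; lra | intros ->; lra].
Qed.

Lemma sq_add_pos x r : 0 < r -> 0 < x * x + r * r.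
Proof. intros Hr. assert (Q := Rle_0_sqr x). unfold Rsqr in Q. nra. Qed.

Lemma RInt_poisson c r : 0 < r ->
  ex_RInt (fun s => r / ((s - c) * (s - c) + r * r)) (c - r) (c + r) /\
  RInt (fun s => r / ((s - c) * (s - c) + r * r)) (c - r) (c + r) = PI / 2.
Proof.
  intros Hr.
  enough (I : is_RInt (fun s => r / ((s - c) * (s - c) + r * r)) (c - r) (c + r) (PI / 2)).
  { split; [eexists; apply I | apply is_RInt_unique, I]. }
  replace (PI / 2) with (minus (atan ((c + r - c) / r)) (atan ((c - r - c) / r))).
  - apply (is_RInt_derive (fun s => atan ((s - c) / r))).
    + intros x _. auto_derive; [auto |]. assert (Q := sq_add_pos (x - c) r Hr). field. split; lra.
    + intros x _. apply continuity_pt_filterlim. assert (Q := sq_add_pos (x - c) r Hr).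
      apply continuity_pt_div; [| | lra]; apply derivable_continuous_pt; reg.
  - replace ((c + r - c) / r) with 1 by (field; lra).
    replace ((c - r - c) / r) with (Ropp 1) by (field; lra).
    rewrite atan_opp, atan_1. unfold minus, plus, opp; simpl. field.
Qed.

(** Along each side the integrand splits into an odd part [k], whose integrals cancel between
    opposite sides, and a Poisson kernel. The kernel contributes [PI / 2] on each of the four sides,
    by [RInt_poisson]. *)
Lemma rint_inverse z0 r : 0 < r ->
  rint (fun z => / (z - z0))%C (fst z0 - r) (fst z0 + r) (snd z0 - r) (snd z0 + r) = (RtoC (2 * PI) * Ci)%C.
Proof.
  intros Hr. unfold rint, cint, hor, ver.
  set (k := fun c s : R => (s - c) / ((s - c) * (s - c) + r * r)).
  set (h := fun c : R => (RInt (k c) (c - r) (c + r)) : R).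
  assert (Ek : forall c, ex_RInt (k c) (c - r) (c + r)).
  { intros c. apply (ex_RInt_continuous (V := R_CompleteNormedModule)). intros x _.
    apply continuity_pt_filterlim. assert (Q := sq_add_pos (x - c) r Hr).
    apply continuity_pt_div; [| | lra]; apply derivable_continuous_pt; reg. }
  assert (H1 : forall c v, v = r \/ v = - r ->
    RInt (fun s => (s + - c) / ((s + - c) * ((s + - c) * 1) + v * (v * 1))) (c - r) (c + r) = h c).
  { intros c v Hv. apply RInt_ext_R. intros s. unfold k, Rdiv. f_equal. f_equal.
    destruct Hv as [-> | ->]; ring. }
  assert (H2 : forall c v, v = r \/ v = - r ->
    RInt (fun s => - (s + - c) / (v * (v * 1) + (s + - c) * ((s + - c) * 1))) (c - r) (c + r) = - h c).
  { intros c v Hv. rewrite (RInt_ext_R _ (fun s => (-1) * k c s)).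
    - destruct (RInt_Rmult_l (-1) _ _ _ (Ek c)) as [_ ->]. change (-1 * h c = - h c). ring.
    - intros s. unfold k. assert (Q := sq_add_pos (s - c) r Hr).
      destruct Hv as [-> | ->]; field; lra. }
  assert (H3 : forall c v e, v = r \/ v = - r ->
    RInt (fun s => e / ((s + - c) * ((s + - c) * 1) + v * (v * 1))) (c - r) (c + r) = e / r * (PI / 2)).
  { intros c v e Hv. destruct (RInt_poisson c r Hr) as [X <-].
    destruct (RInt_Rmult_l (e / r) _ _ _ X) as [_ <-].
    apply RInt_ext_R. intros s. assert (Q := sq_add_pos (s - c) r Hr).
    destruct Hv as [-> | ->]; field; lra. }
  assert (H4 : forall c v e, v = r \/ v = - r ->
    RInt (fun s => e / (v * (v * 1) + (s + - c) * ((s + - c) * 1))) (c - r) (c + r) = e / r * (PI / 2)).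
  { intros c v e Hv. rewrite <- (H3 c v) by auto. apply RInt_ext_R. intros s.
    f_equal. apply Rplus_comm. }
  assert (A1 : forall x, x + r + - x = r \/ x + r + - x = - r) by (intros; left; ring).
  assert (A2 : forall x, x - r + - x = r \/ x - r + - x = - r) by (intros; right; ring).
  apply injective_projections; simpl;
    rewrite ?(H1 _ _ (A1 _)), ?(H1 _ _ (A2 _)), ?(H2 _ _ (A1 _)), ?(H2 _ _ (A2 _)),
      ?(H3 _ _ _ (A1 _)), ?(H3 _ _ _ (A2 _)), ?(H4 _ _ _ (A1 _)), ?(H4 _ _ _ (A2 _)); field; lra.
Qed.

Lemma bdry_square_far a r d z z0 : 0 < d ->
  bdry (fst a - r) (fst a + r) (snd a - r) (snd a + r) z ->
  inrect (fst a - r + d) (fst a + r - d) (snd a - r + d) (snd a + r - d) z0 ->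
  d <= Cmod (z - z0).
Proof.
  intros Hd [[X Y] N] [X0 Y0].
  assert (A := abs_fst_Cmod (z - z0)). assert (B := abs_snd_Cmod (z - z0)).
  change (fst (z - z0)%C) with (fst z - fst z0) in A.
  change (snd (z - z0)%C) with (snd z - snd z0) in B.
  apply Rnot_lt_le. intros L. apply N. unfold interior_rect.
  assert (A' := Rle_lt_trans _ _ _ A L). assert (B' := Rle_lt_trans _ _ _ B L).
  apply Rabs_def2 in A'. apply Rabs_def2 in B'. lra.
Qed.

(** Subtracting [g z0 / (z - z0)] leaves the slope [s] of [g] at [z0], which is bounded near [z0];
    its integral over a shrinking square tends to 0. *)
Lemma Cauchy_formula g x0 x1 y0 y1 z0 : interior_rect x0 x1 y0 y1 z0 ->
  (forall z, inrect x0 x1 y0 y1 z -> cdiff g z) ->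
  rint (fun z => g z * / (z - z0))%C x0 x1 y0 y1 = (RtoC (2 * PI) * Ci * g z0)%C.
Proof.
  intros [[X0 X1] [Y0 Y1]] Hg.
  destruct (Hg z0) as [s [Hs E]]; [split; lra |].
  assert (Dq : forall z, inrect x0 x1 y0 y1 z -> z <> z0 -> cdiff (fun z => g z * / (z - z0))%C z).
  { intros z Hz N. apply cdiff_mult; [apply Hg, Hz |].
    apply cdiff_inv; [apply cdiff_lin | apply Cminus_neq0, N]. }
  destruct (Hs 1) as [dl [D K]]; [lra |].
  set (M := Cmod (s z0) + 1). assert (HM : 0 < M) by (unfold M; assert (P := Cmod_ge_0 (s z0)); lra).
  enough (Z : (rint (fun z => g z * / (z - z0))%C x0 x1 y0 y1 - RtoC (2 * PI) * Ci * g z0)%C = 0%C).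
  { rewrite <- (Cplus_0_r (RtoC (2 * PI) * Ci * g z0)), <- Z. ring. }
  apply Cmod_eq_0, Rle_antisym; [| apply Cmod_ge_0].
  apply (le_0_of_le_small _ 1); [lra |]. intros e He. rewrite Rmult_1_r.
  (* For half side [r], [rint_bound] gives [4 * M * (4 * r)], hence the 16. Below, [dl / 8] keeps
     the whole small square within distance [dl] of [z0]. *)
  assert (P6 : 0 < e / (16 * M)) by (apply Rdiv_lt_0_compat; lra).
  destruct (pos_min (fst z0 - x0) (x1 - fst z0)) as (r1 & R1 & R2 & R3); [lra | lra |].
  destruct (pos_min (snd z0 - y0) (y1 - snd z0)) as (r2 & R4 & R5 & R6); [lra | lra |].
  destruct (pos_min (dl / 8) (e / (16 * M))) as (r3 & R7 & R8 & R9); [lra | lra |].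
  destruct (pos_min r1 r2) as (r4 & R10 & R11 & R12); [lra | lra |].
  destruct (pos_min r3 r4) as (r & R0 & R13 & R14); [lra | lra |].
  rewrite (rint_shrink _ z0 r) by (auto; lra).
  assert (Far : forall z, bdry (fst z0 - r) (fst z0 + r) (snd z0 - r) (snd z0 + r) z ->
    z <> z0 /\ Cmod (z - z0) < dl).
  { intros z Hz. split.
    - apply Cmod_sub_pos_neq. apply Rlt_le_trans with r; [auto |].
      apply (bdry_square_far z0 r); auto. split; lra.
    - eapply Rle_lt_trans; [apply (inrect_dist _ _ _ _ z z0 (proj1 Hz)) |]; [split; lra | lra]. }
  set (q1 := fun z => (g z0 * / (z - z0))%C).
  assert (C1 : contrect (fun z => / (z - z0))%C (fst z0 - r) (fst z0 + r) (snd z0 - r) (snd z0 + r)).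
  { intros z Hz. apply cdiff_ccont, cdiff_inv; [apply cdiff_lin | apply Cminus_neq0, Far, Hz]. }
  set (q2 := fun z => (g z * / (z - z0) + - RtoC 1 * q1 z)%C).
  assert (C3 : contrect q1 (fst z0 - r) (fst z0 + r) (snd z0 - r) (snd z0 + r)).
  { intros z Hz. apply ccont_mult; [apply ccont_const | apply C1, Hz]. }
  assert (C2 : contrect q2 (fst z0 - r) (fst z0 + r) (snd z0 - r) (snd z0 + r)).
  { intros z Hz. apply ccont_plus; [| apply ccont_mult; [apply ccont_const | apply C3, Hz]].
    apply cdiff_ccont, Dq; [destruct Hz as [[? ?] _]; split; lra | apply Far, Hz]. }
  rewrite (rint_ext _ (fun z => q1 z + q2 z)%C); [| lra | lra | intros z _; unfold q2; ring].
  rewrite rint_plus by (auto; lra). unfold q1 at 1.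
  rewrite (rint_scal (g z0) (fun z => / (z - z0))%C), rint_inverse by (auto; lra).
  match goal with |- Cmod ?w <= _ =>
    replace w with (rint q2 (fst z0 - r) (fst z0 + r) (snd z0 - r) (snd z0 + r)) by ring end.
  eapply Rle_trans; [apply (rint_bound q2 _ _ _ _ M); auto; try lra |].
  - intros z Hz. destruct (Far z Hz) as [N L].
    replace (q2 z) with (s z).
    + specialize (K z L). assert (U := Cmod_upper (s z) (s z0)). unfold M; lra.
    + unfold q2, q1. rewrite (E z). field. apply Cminus_neq0, N.
  - assert (r * (16 * M) <= e / (16 * M) * (16 * M)) by (apply Rmult_le_compat_r; lra).
    replace (e / (16 * M) * (16 * M)) with e in H by (field; lra). lra.
Qed.

Lemma Cauchy_factor_norm w : Cmod (RtoC (2 * PI) * Ci * w)%C = 2 * PI * Cmod w.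
Proof.
  assert (P := PI_RGT_0).
  rewrite !Cmod_mult, Cmod_Ci, Cmod_R, Rabs_pos_eq by lra. ring.
Qed.

(** A crude maximum principle. From the middle square the boundary is at distance at least [r / 2],
    so [2 * PI * Cmod (g z) <= 32 * M], and [PI > 3] leaves less than 6. *)
Lemma Cauchy_estimate g a r M : 0 < r ->
  (forall z, inrect (fst a - r) (fst a + r) (snd a - r) (snd a + r) z -> cdiff g z) ->
  (forall z, bdry (fst a - r) (fst a + r) (snd a - r) (snd a + r) z -> Cmod (g z) <= M) ->
  forall z, inrect (fst a - r / 2) (fst a + r / 2) (snd a - r / 2) (snd a + r / 2) z ->
    Cmod (g z) <= 6 * M.
Proof.
  intros Hr Hg B z Hz.
  assert (F := Cauchy_formula g (fst a - r) (fst a + r) (snd a - r) (snd a + r) z).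
  specialize (F ltac:(unfold inrect, interior_rect in *; lra) Hg).
  apply (f_equal Cmod) in F. rewrite Cauchy_factor_norm in F.
  assert (Far : forall w, bdry (fst a - r) (fst a + r) (snd a - r) (snd a + r) w -> r / 2 <= Cmod (w - z)).
  { intros w Hw. apply (bdry_square_far a r); [lra | auto | unfold inrect in *; lra]. }
  assert (Bd := rint_bound (fun w => g w * / (w - z))%C (fst a - r) (fst a + r) (snd a - r) (snd a + r)
    (M * (2 / r))).
  specialize (Bd ltac:(lra) ltac:(lra)). rewrite F in Bd.
  assert (PP := PI2_3_2). assert (Pz := Cmod_ge_0 (g z)).
  assert (Q : 2 * PI * Cmod (g z) <= 4 * (M * (2 / r)) * (fst a + r - (fst a - r) + (snd a + r - (snd a - r)))).
  { apply Bd.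
    - intros w Hw. apply cdiff_ccont, cdiff_mult; [apply Hg, Hw |].
      apply cdiff_inv; [apply cdiff_lin |]. apply Cminus_neq0, Cmod_sub_pos_neq.
      specialize (Far w Hw). lra.
    - intros w Hw. specialize (Far w Hw).
      assert (N : (w - z <> 0)%C) by (apply Cmod_gt_0; lra).
      rewrite Cmod_mult, Cmod_inv by auto.
      apply Rmult_le_compat; [apply Cmod_ge_0 | | apply B, Hw |].
      + left. apply Rinv_0_lt_compat. lra.
      + replace (2 / r) with (/ (r / 2)) by (field; lra). apply Rinv_le_contravar; lra. }
  replace (4 * (M * (2 / r)) * (fst a + r - (fst a - r) + (snd a + r - (snd a - r)))) with (32 * M) in Q
    by (field; lra).
  nra.
Qed.

(** Subtracting the Cauchy formulas at [z] and [w] leaves the kernel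
    [(z - w) / ((v - z) * (v - w))], of order [1 / r ^ 2] on a contour of length of order [r]. *)
Lemma Liouville g M : (forall z, cdiff g z) -> (forall z, Cmod (g z) <= M) ->
  forall z w, g z = g w.
Proof.
  intros Hg B z w.
  set (T := Cmod z + Cmod w + 1).
  assert (Pz := Cmod_ge_0 z). assert (Pw := Cmod_ge_0 w).
  assert (HT : 0 < T) by (unfold T; lra).
  assert (HM : 0 <= M) by (eapply Rle_trans; [apply Cmod_ge_0 | apply (B z)]).
  assert (Pd := Cmod_ge_0 (z - w)).
  enough (Q : forall r, 2 * T < r -> 2 * PI * Cmod (g z - g w) <= 64 * M * Cmod (z - w) / r).
  { assert (PP := PI2_3_2). assert (P0 := Cmod_ge_0 (g z - g w)).
    assert (Z : 2 * PI * Cmod (g z - g w) <= 0).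
    { set (k := 64 * M * Cmod (z - w)) in *.
      assert (Hk : 0 <= k) by (unfold k; apply Rmult_le_pos; [lra | auto]).
      apply (le_0_of_le_small _ k Hk). intros e He.
      assert (Ie : 0 < / e) by (apply Rinv_0_lt_compat, He).
      specialize (Q (2 * T + / e) ltac:(lra)). eapply Rle_trans; [exact Q |].
      apply Rle_trans with (k * / / e); [| rewrite Rinv_inv; lra].
      apply Rmult_le_compat_l; [auto |]. apply Rinv_le_contravar; lra. }
    assert (Z' : Cmod (g z - g w) = 0) by nra.
    apply Cmod_eq_0 in Z'. replace (g z) with (g z - g w + g w)%C by ring. rewrite Z'. ring. }
  intros r Hr.
  pose (Inn := inrect (0 - r + r / 2) (0 + r - r / 2) (0 - r + r / 2) (0 + r - r / 2)).
  pose (Bd := bdry (0 - r) (0 + r) (0 - r) (0 + r)).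
  assert (In0 : forall u, Cmod u <= T -> Inn u).
  { intros u Hu. assert (A := abs_fst_Cmod u). assert (A' := abs_snd_Cmod u).
    assert (L1 : Rabs (fst u) < r / 2) by lra. assert (L2 : Rabs (snd u) < r / 2) by lra.
    apply Rabs_def2 in L1. apply Rabs_def2 in L2. split; lra. }
  assert (Iz := In0 z ltac:(unfold T; lra)). assert (Iw := In0 w ltac:(unfold T; lra)).
  assert (Far : forall v u, Bd v -> Inn u -> r / 2 <= Cmod (v - u)).
  { intros v u Hv Hu. apply (bdry_square_far (0, 0) r); simpl; auto; lra. }
  assert (F1 := Cauchy_formula g (0 - r) (0 + r) (0 - r) (0 + r) z).
  assert (F2 := Cauchy_formula g (0 - r) (0 + r) (0 - r) (0 + r) w).
  specialize (F1 ltac:(unfold Inn, inrect, interior_rect in *; lra) ltac:(auto)).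
  specialize (F2 ltac:(unfold Inn, inrect, interior_rect in *; lra) ltac:(auto)).
  assert (N0 : forall v u, Bd v -> Inn u -> (v - u <> 0)%C).
  { intros v u Hv Hu. apply Cmod_gt_0. specialize (Far v u Hv Hu). lra. }
  assert (Cq : forall u, Inn u ->
    contrect (fun v => g v * / (v - u))%C (0 - r) (0 + r) (0 - r) (0 + r)).
  { intros u Hu v Hv. apply cdiff_ccont, cdiff_mult; [auto |]. apply cdiff_inv; [apply cdiff_lin | auto]. }
  set (q := fun v => (g v * / (v - z) + - RtoC 1 * (g v * / (v - w)))%C).
  assert (C2 : contrect (fun v => - RtoC 1 * (g v * / (v - w)))%C (0 - r) (0 + r) (0 - r) (0 + r)).
  { intros v Hv. apply ccont_mult; [apply ccont_const | apply Cq; auto]. }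
  assert (Fq : rint q (0 - r) (0 + r) (0 - r) (0 + r) = (RtoC (2 * PI) * Ci * (g z - g w))%C).
  { unfold q. rewrite (rint_plus (fun v => g v * / (v - z))%C) by (auto; lra).
    rewrite (rint_scal (- RtoC 1) (fun v => g v * / (v - w))%C) by (auto; lra).
    rewrite F1, F2. ring. }
  rewrite <- Cauchy_factor_norm, <- Fq.
  replace (64 * M * Cmod (z - w) / r)
    with (4 * (M * Cmod (z - w) * (4 / (r * r))) * (0 + r - (0 - r) + (0 + r - (0 - r))))
    by (field; lra).
  apply rint_bound; try lra.
  - intros v Hv. apply ccont_plus; [apply Cq; auto | apply C2; auto].
  - intros v Hv. assert (Nz := N0 v z Hv Iz). assert (Nw := N0 v w Hv Iw).
    replace (q v) with (g v * (z - w) * / ((v - z) * (v - w)))%C by (unfold q; field; auto).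
    rewrite !Cmod_mult, Cmod_inv, Cmod_mult by (apply Cmult_neq_0; auto).
    assert (F1' := Far v z Hv Iz). assert (F2' := Far v w Hv Iw).
    apply Rmult_le_compat.
    + apply Rmult_le_pos; auto using Cmod_ge_0.
    + left. apply Rinv_0_lt_compat. nra.
    + apply Rmult_le_compat_r; auto.
    + replace (4 / (r * r)) with (/ (r / 2 * (r / 2))) by (field; lra).
      apply Rinv_le_contravar; nra.
Qed.

(** * Orders, divisors and the argument principle *)

Lemma Cmod_sub_diag (a : C) : Cmod (a - a) = 0.
Proof. replace (a - a)%C with (RtoC 0) by ring. apply Cmod_0. Qed.

Lemma has_order_iff (f : C -> option C) (a : C) (m : Z) :
  has_order f a m <->
  exists r, 0 < r /\ exists g : C -> C,
    (forall z, Cmod (z - a) < r -> cdiff g z) /\ g a <> 0%C /\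
    (forall z, 0 < Cmod (z - a) < r -> f z = Some (zpow (z - a) m * g z)%C) /\
    f a = (if Z.ltb 0 m then Some (RtoC 0) else if Z.eqb m 0 then Some (g a) else None).
Proof.
  split; intros (r & Hr & g & H1 & H2 & H3 & H4); exists r; (split; [auto |]); exists g;
    repeat split; auto.
  - intros z Hz. apply Cdifferentiable_cdiff, H1. rewrite Cnorm_Cmod. exact Hz.
  - intros z Hz. apply H3. rewrite Cnorm_Cmod. exact Hz.
  - intros z Hz. apply Cdifferentiable_cdiff, H1. rewrite <- Cnorm_Cmod. exact Hz.
  - intros z Hz. apply H3. rewrite <- Cnorm_Cmod. exact Hz.
Qed.

Lemma ccont_neq0 g a : ccont g a -> g a <> 0%C ->
  exists r, 0 < r /\ forall z, Cmod (z - a) < r -> g z <> 0%C.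
Proof.
  intros C N. assert (P : 0 < Cmod (g a)) by (apply Cmod_gt_0, N).
  destruct (C _ P) as [r [Hr K]]. exists r; split; [auto |]. intros z Hz.
  apply Cmod_gt_0. specialize (K z Hz). assert (L := Cmod_lower (g z) (g a)). lra.
Qed.

Lemma point_near (a : C) r : 0 < r -> exists z : C, 0 < Cmod (z - a) < r.
Proof.
  intros Hr. exists (a + RtoC (r / 2))%C.
  replace (a + RtoC (r / 2) - a)%C with (RtoC (r / 2)) by ring.
  rewrite Cmod_R, Rabs_pos_eq; lra.
Qed.

Lemma Some_inj (A : Type) (x y : A) : Some x = Some y -> x = y.
Proof. congruence. Qed.

Lemma order_le (f : C -> option C) (a : C) (m n : Z) : has_order f a m -> has_order f a n -> (n <= m)%Z.
Proof.
  intros Hm Hn. apply has_order_iff in Hm. apply has_order_iff in Hn.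
  destruct Hm as (r & Hr & g & G1 & G2 & G3 & _), Hn as (r' & Hr' & g' & G1' & G2' & G3' & _).
  apply Z.nlt_ge. intros L.
  set (k := Z.to_nat (n - m - 1)).
  (* If [m < n], then [e] is zero on a punctured disc around [a], while it is continuous with
     [e a = g a], which is not 0. The factor [z - a] is split off the power so that its vanishing at
     [a] is visible. *)
  set (e := fun z => (g z + - RtoC 1 * ((z - a) * (z - a) ^ k * g' z))%C).
  assert (Ce : ccont e a).
  { apply cdiff_ccont. apply cdiff_plus; [apply G1; rewrite Cmod_sub_diag; auto |].
    apply cdiff_mult; [apply cdiff_const |]. apply cdiff_mult.
    - apply cdiff_mult; [apply cdiff_lin | apply cdiff_pow].
    - apply G1'. rewrite Cmod_sub_diag; auto. }
  destruct (ccont_neq0 e a Ce) as (d & D & K).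
  { unfold e. replace (a - a)%C with (RtoC 0) by ring.
    replace (g a + - RtoC 1 * (RtoC 0 * RtoC 0 ^ k * g' a))%C with (g a) by ring. exact G2. }
  destruct (pos_min r r' Hr Hr') as (d1 & D1 & D2 & D3).
  destruct (pos_min d d1 D D1) as (d2 & D4 & D5 & D6).
  destruct (point_near a d2 D4) as [z [Z1 Z2]].
  apply (K z); [lra |].
  assert (N : (z - a <> 0)%C) by (apply Cmod_gt_0; auto).
  assert (E := G3 z ltac:(lra)). rewrite (G3' z ltac:(lra)) in E. apply Some_inj in E.
  replace n with (m + Z.of_nat (S k))%Z in E by (unfold k; lia).
  rewrite zpow_add_nat, Cpow_S in E by auto.
  assert (Nz := zpow_neq0 _ m N).
  unfold e. replace (g z) with (/ zpow (z - a) m * (zpow (z - a) m * g z))%C by (field; auto).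
  rewrite <- E. field. auto.
Qed.

Lemma order_unique (f : C -> option C) (a : C) (m n : Z) : has_order f a m -> has_order f a n -> m = n.
Proof. intros Hm Hn. apply Z.le_antisymm; eapply order_le; eauto. Qed.

Lemma order_0_intro (f : C -> option C) (a : C) r (g : C -> C) : 0 < r -> g a <> 0%C ->
  (forall z, Cmod (z - a) < r -> cdiff g z /\ f z = Some (g z)) -> has_order f a 0.
Proof.
  intros Hr Ha H. apply has_order_iff. exists r; split; [auto |]. exists g.
  repeat split; auto.
  - intros; apply H; auto.
  - intros z [_ Hz]. rewrite zpow_0, Cmult_1_l. apply H, Hz.
  - simpl. apply H. rewrite Cmod_sub_diag; auto.
Qed.

(** Zeros and poles are isolated: off [a] the local representation is itself differentiable and
    without zeros. *)
Lemma order_punctured (f : C -> option C) (a : C) (m : Z) : has_order f a m ->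
  exists r, 0 < r /\ forall z, 0 < Cmod (z - a) < r -> has_order f z 0.
Proof.
  intros H. apply has_order_iff in H. destruct H as (r & Hr & g & G1 & G2 & G3 & _).
  assert (Cg : ccont g a) by (apply cdiff_ccont, G1; rewrite Cmod_sub_diag; auto).
  destruct (ccont_neq0 g a Cg G2) as (d & D & K).
  destruct (pos_min r d Hr D) as (e & E0 & E1 & E2).
  exists e; split; [auto |]. intros z [Z1 Z2].
  destruct (pos_min (Cmod (z - a)) (e - Cmod (z - a))) as (q & Q0 & Q1 & Q2); [auto | lra |].
  apply (order_0_intro f z q (fun w => zpow (w - a) m * g w)%C); [auto | |].
  - apply Cmult_neq_0; [apply zpow_neq0, Cmod_gt_0, Z1 | apply K; lra].
  - intros w Hw.
    assert (T1 := Cmod_triangle_sub w z a). assert (T2 := Cmod_triangle_sub z w a).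
    rewrite (Cmod_sub_comm z w) in T2.
    split; [| apply G3; lra].
    apply cdiff_mult; [apply cdiff_zpow, Cmod_sub_pos_neq; lra | apply G1; lra].
Qed.

(** Poles receive the dummy value 0. A positive lower bound for [Cmod (fin f z)] therefore excludes
    a pole as well as a zero at [z]. *)
Definition fin (f : C -> option C) (z : C) : C := match f z with Some u => u | None => RtoC 0 end.

Lemma order_nonneg (f : C -> option C) (a : C) (m : Z) : has_order f a m -> (0 <= m)%Z ->
  cdiff (fin f) a /\ f a = Some (fin f a).
Proof.
  intros H Hm. apply has_order_iff in H. destruct H as (r & Hr & g & G1 & G2 & G3 & G4).
  assert (E : forall z, Cmod (z - a) < r -> f z = Some ((z - a) ^ Z.to_nat m * g z)%C).
  { intros z Hz. destruct (Ceq_dec z a) as [-> | N].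
    - rewrite G4. destruct (Z.ltb_spec 0 m) as [L | L].
      + f_equal. replace (Z.to_nat m) with (S (Z.to_nat m - 1)) by lia. rewrite Cpow_S. ring.
      + replace m with 0%Z by lia. simpl. f_equal. ring.
    - rewrite G3 by (split; [apply Cmod_sub_neq, N | auto]).
      rewrite <- zpow_of_nat, Z2Nat.id by auto. reflexivity. }
  split.
    apply (cdiff_ext_loc (fun z => (z - a) ^ Z.to_nat m * g z)%C) with (r := r); auto.
    + intros z Hz. unfold fin. rewrite E; auto.
    + apply cdiff_mult; [apply cdiff_pow | apply G1; rewrite Cmod_sub_diag; auto].
  - unfold fin. rewrite E by (rewrite Cmod_sub_diag; auto). reflexivity.
Qed.

Lemma order_values (f : C -> option C) (a : C) (m : Z) : has_order f a m ->
  (f a = None <-> (m < 0)%Z) /\ (f a = Some (RtoC 0) <-> (0 < m)%Z).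
Proof.
  intros H. apply has_order_iff in H. destruct H as (r & Hr & g & G1 & G2 & G3 & G4).
  rewrite G4. destruct (Z.ltb_spec 0 m); [| destruct (Z.eqb_spec m 0)];
    repeat split; intros; try congruence; lia.
Qed.

Lemma order_0 (f : C -> option C) (a : C) : has_order f a 0 -> cdiff (fin f) a /\ f a = Some (fin f a) /\ fin f a <> 0%C.
Proof.
  intros H. destruct (order_nonneg f a 0 H) as [D E]; [lia |]. split; [auto | split; [auto |]].
  intros Z. rewrite Z in E. apply (order_values f a 0 H) in E. lia.
Qed.

Definition omul (k : C) (o : option C) : option C :=
  match o with Some u => Some (k * u)%C | None => None end.

(** The zero or pole at [c] is divided out, with the gap at [c] filled by the local factor [g]. All
    other orders are kept, so the step can be repeated. *)
Lemma order_divide (f : C -> option C) (c : C) (m : Z) : meromorphic f -> has_order f c m ->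
  exists f' : C -> option C, meromorphic f' /\ has_order f' c 0 /\
    (forall w n, w <> c -> has_order f w n -> has_order f' w n) /\
    (forall z, z <> c -> f z = omul (zpow (z - c) m) (f' z)).
Proof.
  intros Mf Hc. assert (Hc' := Hc). apply has_order_iff in Hc'.
  destruct Hc' as (r & Hr & g & G1 & G2 & G3 & G4).
  set (f' := fun z => if Ceq_dec z c then Some (g c) else omul (zpow (z - c) (- m)) (f z)).
  assert (Off : forall z, z <> c -> f' z = omul (zpow (z - c) (- m)) (f z)).
  { intros z N. unfold f'. destruct (Ceq_dec z c); [contradiction | reflexivity]. }
  assert (O0 : has_order f' c 0).
  { apply (order_0_intro f' c r g); auto. intros z Hz. split; [auto |].
    unfold f'. destruct (Ceq_dec z c) as [-> | N]; [reflexivity |].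
    rewrite G3 by (split; [apply Cmod_sub_neq, N | auto]). simpl. f_equal.
    rewrite zpow_opp. field. apply zpow_neq0, Cminus_neq0, N. }
  assert (On : forall w n, w <> c -> has_order f w n -> has_order f' w n).
  { intros w n N H. apply has_order_iff in H. destruct H as (s & Hs & k & K1 & K2 & K3 & K4).
    apply has_order_iff.
    assert (Pw := Cmod_sub_neq _ _ N).
    destruct (pos_min s (Cmod (w - c)) Hs Pw) as (q & Q0 & Q1 & Q2).
    exists q; split; [auto |]. exists (fun z => zpow (z - c) (- m) * k z)%C.
    assert (NC : forall z, Cmod (z - w) < q -> z <> c).
    { intros z Hz ->. rewrite Cmod_sub_comm in Hz. lra. }
    repeat split.
    - intros z Hz. apply cdiff_mult; [apply cdiff_zpow, NC, Hz | apply K1; lra].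
    - apply Cmult_neq_0; [apply zpow_neq0, Cminus_neq0, N | auto].
    - intros z [Z1 Z2]. rewrite Off, K3 by (auto; lra). simpl. f_equal. ring.
    - rewrite Off, K4 by auto. destruct (0 <? n)%Z; [simpl; f_equal; ring |].
      destruct (n =? 0)%Z; reflexivity. }
  exists f'. repeat split; auto.
  - intros w. destruct (Ceq_dec w c) as [-> | N]; [exists 0%Z; auto |].
    destruct (Mf w) as [n Hn]. exists n. auto.
  - intros z N. rewrite Off by auto. destruct (f z) as [u |]; [| reflexivity]. simpl. f_equal.
    rewrite zpow_opp. field. apply zpow_neq0, Cminus_neq0, N.
Qed.

Lemma finite_exceptional (f : C -> option C) x0 x1 y0 y1 : x0 <= x1 -> y0 <= y1 -> meromorphic f ->
  exists l, forall w m, inrect x0 x1 y0 y1 w -> has_order f w m -> m <> 0%Z -> In w l.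
Proof.
  intros Hx Hy Mf.
  apply (rect_compact (fun S => exists l, forall w m, S w -> has_order f w m -> m <> 0%Z -> In w l)); auto.
  - intros S T ST [l H]. exists l. eauto.
  - intros S T [l1 H1] [l2 H2]. exists (l1 ++ l2). intros w m Hw Hm N. rewrite in_app_iff.
    destruct Hw; [left; eapply H1 | right; eapply H2]; eauto.
  - intros a. destruct (Mf a) as [n Hn].
    destruct (order_punctured f a n Hn) as (r & Hr & K). exists r; split; [auto |].
    exists (a :: nil). intros w m Hw Hm Nm. left.
    apply NNPP. intros N. apply Nm. eapply order_unique; [apply Hm |]. apply K. split; [| exact Hw].
    apply Cmod_sub_neq. auto.
Qed.

Lemma zpow_split (z : C) m : z <> 0%C -> zpow z m = (z ^ Z.to_nat m * / z ^ Z.to_nat (- m))%C.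
Proof.
  intros N. destruct (Z_le_dec 0 m).
  - rewrite <- (Z2Nat.id m) at 1 by auto. rewrite zpow_of_nat.
    replace (Z.to_nat (- m)) with 0%nat by lia. simpl. field.
  - replace m with (- Z.of_nat (Z.to_nat (- m)))%Z at 1 by lia. rewrite zpow_opp_of_nat.
    replace (Z.to_nat m) with 0%nat by lia. simpl. ring.
Qed.

Lemma count_occ_repeat c n w :
  count_occ Ceq_dec (repeat c n) w = if Ceq_dec w c then n else 0%nat.
Proof.
  destruct (Ceq_dec w c) as [-> | N].
  - apply count_occ_repeat_eq. reflexivity.
  - apply count_occ_repeat_neq. auto.
Qed.

(** [Z.to_nat] cuts off negative numbers, so [A] lists the zeros and [B] the poles, with
    multiplicity. The first clause keeps points outside the rectangle from entering the lengths. *)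
Definition divisor_on (f : C -> option C) (x0 x1 y0 y1 : R) (A B : list C) : Prop :=
  (forall c, In c A \/ In c B -> inrect x0 x1 y0 y1 c) /\
  (forall w m, inrect x0 x1 y0 y1 w -> has_order f w m ->
     count_occ Ceq_dec A w = Z.to_nat m /\ count_occ Ceq_dec B w = Z.to_nat (- m)).

(** Induction on a finite list containing all exceptional points of the rectangle. Listed points
    that lie outside or have order 0 are skipped; every other one is divided out by
    [order_divide]. *)
Lemma factorization (f : C -> option C) x0 x1 y0 y1 : x0 <= x1 -> y0 <= y1 -> meromorphic f ->
  exists A B (f' : C -> option C), divisor_on f x0 x1 y0 y1 A B /\
    (forall w, inrect x0 x1 y0 y1 w -> has_order f' w 0) /\
    (forall z, ~ In z A -> ~ In z B -> f z = omul (prodl A z * / prodl B z) (f' z)).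
Proof.
  intros Hx Hy Mf.
  destruct (finite_exceptional f x0 x1 y0 y1 Hx Hy Mf) as [l Hl].
  revert f Mf Hl. induction l as [| c l IH]; intros f Mf Hl.
  - exists nil, nil, f.
    assert (Z0 : forall w m, inrect x0 x1 y0 y1 w -> has_order f w m -> m = 0%Z).
    { intros w m Hw Hm. apply NNPP. intros N. apply (Hl w m); auto. }
    split; [split | split].
    + simpl; tauto.
    + intros w m Hw Hm. rewrite (Z0 w m Hw Hm). auto.
    + intros w Hw. destruct (Mf w) as [m Hm]. rewrite (Z0 w m Hw Hm) in Hm. exact Hm.
    + intros z _ _. destruct (f z); simpl; [| reflexivity]. f_equal. field.
  - destruct (Mf c) as [m Hm].
    assert (Skip : (~ inrect x0 x1 y0 y1 c \/ m = 0%Z) ->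
      forall w n, inrect x0 x1 y0 y1 w -> has_order f w n -> n <> 0%Z -> In w l).
    { intros S w n Hw Hn Nn. destruct (Hl w n Hw Hn Nn) as [<- | I]; [| auto].
      exfalso. destruct S as [S | ->]; [auto |]. apply Nn. eapply order_unique; eauto. }
    destruct (classic (inrect x0 x1 y0 y1 c)) as [Ic | Nc]; [| apply (IH f Mf), Skip; auto].
    destruct (Z.eq_dec m 0) as [E0 | Nm]; [apply (IH f Mf), Skip; auto |]. clear Skip.
    destruct (order_divide f c m Mf Hm) as (f1 & M1 & O1 & On & Off).
    destruct (IH f1 M1) as (A & B & f' & [D1 D2] & D3 & D4).
    { intros w n Hw Hn Nn.
      assert (Ncw : w <> c) by (intros ->; apply Nn; eapply order_unique; eauto).
      destruct (Mf w) as [k Hk].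
      assert (k = n) by (eapply order_unique; [apply On; eauto | auto]). subst k.
      destruct (Hl w n Hw Hk Nn) as [E | I]; [congruence | auto]. }
    exists (repeat c (Z.to_nat m) ++ A), (repeat c (Z.to_nat (- m)) ++ B), f'.
    split; [split | split].
    + intros e He. rewrite !in_app_iff in He.
      assert (Q : In e (repeat c (Z.to_nat m)) \/ In e (repeat c (Z.to_nat (- m))) \/ In e A \/ In e B)
        by tauto.
      destruct Q as [Q | [Q | Q]]; [| | apply D1, Q]; apply repeat_spec in Q; subst e; apply Ic.
    + intros w k Hw Hk. rewrite !count_occ_app, !count_occ_repeat. destruct (Ceq_dec w c) as [-> | N].
      * destruct (D2 c 0%Z) as [-> ->]; auto. rewrite (order_unique f c m k); auto. simpl; lia.
      * destruct (D2 w k) as [-> ->]; auto.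
    + exact D3.
    + intros z NA NB. rewrite in_app_iff in NA, NB.
      assert (N : z <> c).
      { intros ->. destruct (Z_lt_le_dec 0 m).
        - apply NA. left. replace (Z.to_nat m) with (S (Z.to_nat m - 1)) by lia. left; auto.
        - apply NB. left. replace (Z.to_nat (- m)) with (S (Z.to_nat (- m) - 1)) by lia. left; auto. }
      rewrite Off, D4 by tauto. destruct (f' z) as [u |]; [| reflexivity]. simpl. f_equal.
      rewrite !prodl_app, !prodl_repeat, zpow_split by (apply Cminus_neq0, N).
      field. split; [apply prodl_neq0; tauto | apply Cpow_nz, Cminus_neq0, N].
Qed.

Lemma divisor_interior (f : C -> option C) x0 x1 y0 y1 A B : divisor_on f x0 x1 y0 y1 A B ->
  (forall z, bdry x0 x1 y0 y1 z -> has_order f z 0) ->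
  forall c, In c A \/ In c B -> interior_rect x0 x1 y0 y1 c.
Proof.
  intros [D1 D2] Hb c Hc. apply NNPP. intros N.
  assert (Bc : bdry x0 x1 y0 y1 c) by (split; auto).
  destruct (D2 c 0%Z) as [E1 E2]; [auto | auto |].
  destruct Hc as [Hc | Hc]; apply (count_occ_In Ceq_dec) in Hc; simpl in *; lia.
Qed.

Lemma divisor_perm (f : C -> option C) x0 x1 y0 y1 A B A' B' : meromorphic f ->
  divisor_on f x0 x1 y0 y1 A B -> divisor_on f x0 x1 y0 y1 A' B' ->
  length A = length A' /\ length B = length B'.
Proof.
  intros Mf [D1 D2] [E1 E2].
  assert (Out : forall w, ~ inrect x0 x1 y0 y1 w ->
    ~ In w A /\ ~ In w A' /\ ~ In w B /\ ~ In w B').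
  { intros w Nw. repeat split; intros I; apply Nw; auto. }
  split; apply Permutation_length, (Permutation_count_occ Ceq_dec); intros w.
  - destruct (classic (inrect x0 x1 y0 y1 w)) as [I | N].
    + destruct (Mf w) as [m Hm]. destruct (D2 w m I Hm) as [-> _], (E2 w m I Hm) as [-> _]. auto.
    + destruct (Out w N) as (N1 & N2 & _).
      apply (count_occ_not_In Ceq_dec) in N1, N2. congruence.
  - destruct (classic (inrect x0 x1 y0 y1 w)) as [I | N].
    + destruct (Mf w) as [m Hm]. destruct (D2 w m I Hm) as [_ ->], (E2 w m I Hm) as [_ ->]. auto.
    + destruct (Out w N) as (_ & _ & N1 & N2).
      apply (count_occ_not_In Ceq_dec) in N1, N2. congruence.
Qed.

(** By [factorization] each zero contributes a linear factor, which winds once, each pole the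
    inverse of one, and the remaining factor does not wind. No logarithmic derivative is
    involved. *)
Lemma argument_principle (f : C -> option C) x0 x1 y0 y1 A B : x0 <= x1 -> y0 <= y1 -> meromorphic f ->
  (forall z, bdry x0 x1 y0 y1 z -> has_order f z 0) -> divisor_on f x0 x1 y0 y1 A B ->
  Wind (fin f) x0 x1 y0 y1 (2 * PI * (INR (length A) - INR (length B))).
Proof.
  intros Hx Hy Mf Hb HD.
  destruct (factorization f x0 x1 y0 y1 Hx Hy Mf) as (A' & B' & f' & D & D3 & D4).
  destruct (divisor_perm f x0 x1 y0 y1 A B A' B' Mf HD D) as [-> ->]. clear A B HD.
  assert (Int := divisor_interior _ _ _ _ _ _ _ D Hb).
  assert (NI : forall z, bdry x0 x1 y0 y1 z -> ~ In z A' /\ ~ In z B').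
  { intros z [_ N]. split; intros I; apply N, Int; auto. }
  replace (2 * PI * (INR (length A') - INR (length B')))
    with (2 * PI * INR (length A') + - (2 * PI * INR (length B')) + 0) by ring.
  apply (Wind_ext (fun z => prodl A' z * / prodl B' z * fin f' z)%C).
  - intros z Hz. destruct (NI z Hz) as [NA NB].
    destruct (order_0 f' z (D3 z (proj1 Hz))) as (_ & E & _).
    unfold fin at 2. rewrite D4, E by auto. reflexivity.
  - apply (Wind_mul (fun z => prodl A' z * / prodl B' z)%C (fin f')).
    + apply (Wind_mul (prodl A') (fun z => / prodl B' z)%C); [| apply Wind_inv];
        apply Wind_prodl; auto.
    + apply Wind_nonvanishing; auto. intros z Hz.
      destruct (order_0 f' z (D3 z Hz)) as (E1 & _ & E2). split; [apply cdiff_ccont, E1 | auto].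
Qed.

(** * The spherical metric *)

Lemma rho_S_fin (u v : C) :
  rho_S (Some u) (Some v) = 2 * Cmod (u - v) / (sqrt (1 + Cmod u ^ 2) * sqrt (1 + Cmod v ^ 2)).
Proof.
  simpl rho_S. rewrite !Cnorm_Cmod. change (Csub u v) with (u - v)%C.
  assert (P := Cmod_ge_0 u). assert (Q := Cmod_ge_0 v).
  rewrite <- sqrt_mult by nra. repeat f_equal; ring.
Qed.

Lemma rho_S_inf (u : C) :
  rho_S (Some u) None = 2 / sqrt (1 + Cmod u ^ 2) /\ rho_S None (Some u) = 2 / sqrt (1 + Cmod u ^ 2).
Proof. simpl rho_S. rewrite !Cnorm_Cmod. split; repeat f_equal; ring. Qed.

Lemma sqrt_sq_bounds x : 0 <= x -> 1 <= sqrt (1 + x ^ 2) <= 1 + x.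
Proof.
  intros Hx. split.
  - rewrite <- sqrt_1 at 1. apply sqrt_le_1_alt. nra.
  - rewrite <- (sqrt_Rsqr (1 + x)) by lra. apply sqrt_le_1_alt. unfold Rsqr. nra.
Qed.

(** The spherical metric controls Euclidean distance only for bounded values, hence [B]. With [d]
    the distance, [2 * d < eps * (1 + B + d) * (1 + B) <= eta + d]; the infinite [v] is too far
    away. *)
Lemma rho_close B eta : 0 <= B -> 0 < eta -> exists eps, 0 < eps /\
  forall (u : C) (v : option C), Cmod u <= B -> rho_S v (Some u) < eps ->
    exists v', v = Some v' /\ Cmod (v' - u) < eta.
Proof.
  intros HB He.
  assert (P1 : 0 < 1 / (1 + B)) by (apply Rdiv_lt_0_compat; lra).
  assert (P2 : 0 < eta / (1 + B) ^ 2) by (apply Rdiv_lt_0_compat; [lra | apply pow_lt; lra]).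
  destruct (pos_min _ _ P1 P2) as (eps & E0 & E1 & E2). exists eps; split; [auto |].
  assert (E1' : eps * (1 + B) <= 1).
  { apply Rle_trans with (1 / (1 + B) * (1 + B)); [apply Rmult_le_compat_r; lra | right; field; lra]. }
  assert (E2' : eps * (1 + B) ^ 2 <= eta).
  { apply Rle_trans with (eta / (1 + B) ^ 2 * (1 + B) ^ 2); [| right; field; lra].
    apply Rmult_le_compat_r; [apply pow_le |]; lra. }
  intros u v Hu Hv. assert (Pu := Cmod_ge_0 u). destruct (sqrt_sq_bounds _ Pu) as [U1 U2].
  destruct v as [v |].
  - exists v. split; [auto |]. rewrite rho_S_fin in Hv.
    assert (Pv := Cmod_ge_0 v). destruct (sqrt_sq_bounds _ Pv) as [V1 V2].
    set (p := sqrt (1 + Cmod u ^ 2)) in *. set (q := sqrt (1 + Cmod v ^ 2)) in *.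
    assert (Hd := Cmod_upper v u). set (d := Cmod (v - u)) in *.
    assert (Pd : 0 <= d) by apply Cmod_ge_0.
    assert (L : 2 * d < eps * (q * p)).
    { replace (2 * d) with (2 * d / (q * p) * (q * p)) by (field; lra).
      apply Rmult_lt_compat_r; [nra | auto]. }
    assert (q * p <= (1 + B + d) * (1 + B)) by (apply Rmult_le_compat; lra).
    assert (eps * (q * p) <= eps * ((1 + B + d) * (1 + B))) by (apply Rmult_le_compat_l; lra).
    nra.
  - exfalso. destruct (rho_S_inf u) as [_ E].
    assert (Hv' := Rle_lt_trans _ _ _ (Req_le _ _ (eq_sym E)) Hv). clear Hv.
    set (p := sqrt (1 + Cmod u ^ 2)) in *.
    assert (2 < eps * p).
    { replace 2 with (2 / p * p) by (field; lra). apply Rmult_lt_compat_r; lra. }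
    nra.
Qed.

Definition oinv (o : option C) : option C :=
  match o with
  | None => Some (RtoC 0)
  | Some u => if Ceq_dec u 0 then None else Some (/ u)%C
  end.

Lemma oinv_0 : oinv (Some (RtoC 0)) = None.
Proof. simpl. destruct (Ceq_dec 0 0); [reflexivity | congruence]. Qed.

Lemma oinv_fin (u : C) : u <> 0%C -> oinv (Some u) = Some (/ u)%C.
Proof. intros N. simpl. destruct (Ceq_dec u 0); [contradiction | reflexivity]. Qed.

Lemma Cinv_neq0 (u : C) : u <> 0%C -> (/ u <> 0)%C.
Proof. intros N E. apply C1_nz. rewrite <- (Cinv_r u N), E. ring. Qed.

Lemma oinv_involutive o : oinv (oinv o) = o.
Proof.
  destruct o as [u |]; [| apply oinv_0].
  destruct (Ceq_dec u 0) as [-> | N]; [rewrite oinv_0; reflexivity |].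
  rewrite oinv_fin, oinv_fin by auto using Cinv_neq0. f_equal. field. exact N.
Qed.

Lemma sqrt_inv_sq x : 0 < x -> sqrt (1 + (/ x) ^ 2) = sqrt (1 + x ^ 2) / x.
Proof.
  intros Hx. rewrite <- (sqrt_Rsqr x) at 3 by lra.
  rewrite <- sqrt_div_alt by (unfold Rsqr; nra). f_equal. unfold Rsqr. field. lra.
Qed.

(** Inversion is a rotation of the sphere. So [finv f] is again almost elliptic, and an estimate for
    bounded [f] also serves where the inverse is bounded. *)
Lemma rho_S_oinv a b : rho_S (oinv a) (oinv b) = rho_S a b.
Proof.
  assert (Pos : forall x, 0 < sqrt (1 + x ^ 2)).
  { intros x. apply sqrt_lt_R0. assert (Q := pow2_ge_0 x). lra. }
  assert (S0 : sqrt (1 + Cmod 0 ^ 2) = 1).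
  { rewrite Cmod_0. rewrite <- sqrt_1 at 2. f_equal. ring. }
  assert (Sw : forall x y, rho_S x y = rho_S y x).
  { intros [x |] [y |]; rewrite ?rho_S_fin, ?(proj1 (rho_S_inf _)), ?(proj2 (rho_S_inf _)); auto.
    rewrite Cmod_sub_comm. f_equal. ring. }
  assert (H0 : forall v, rho_S None (oinv (Some v)) = rho_S (Some (RtoC 0)) (Some v)).
  { intros v. rewrite rho_S_fin, S0. destruct (Ceq_dec v 0) as [-> | N].
    - rewrite oinv_0. simpl rho_S. rewrite S0. replace (RtoC 0 - RtoC 0)%C with (RtoC 0) by ring.
      rewrite Cmod_0. field.
    - rewrite oinv_fin by auto. destruct (rho_S_inf (/ v)%C) as [_ ->].
      assert (P : 0 < Cmod v) by (apply Cmod_gt_0, N).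
      rewrite Cmod_inv, sqrt_inv_sq by auto.
      replace (RtoC 0 - v)%C with (- v)%C by ring. rewrite Cmod_opp.
      specialize (Pos (Cmod v)). field. lra. }
  assert (H1 : forall v, rho_S (Some (RtoC 0)) (oinv (Some v)) = rho_S None (Some v)).
  { intros v. rewrite <- (oinv_involutive (Some v)) at 2.
    destruct (oinv (Some v)) as [k |] eqn:E; [symmetry; apply H0 |].
    rewrite <- E at 1. rewrite <- oinv_0, oinv_involutive. rewrite E.
    rewrite (proj1 (rho_S_inf _)), (proj2 (rho_S_inf _)). reflexivity. }
  destruct a as [a |]; [destruct (Ceq_dec a 0) as [-> | Na] |].
  - rewrite oinv_0. destruct b as [b |]; [apply H0 | simpl oinv; apply Sw].
  - destruct b as [b |]; [destruct (Ceq_dec b 0) as [-> | Nb] |].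
    + rewrite oinv_0, Sw, (Sw (Some a)). apply H0.
    + rewrite !oinv_fin, !rho_S_fin by auto.
      assert (Pa : 0 < Cmod a) by (apply Cmod_gt_0, Na).
      assert (Pb : 0 < Cmod b) by (apply Cmod_gt_0, Nb).
      rewrite !Cmod_inv, !sqrt_inv_sq by auto.
      replace (/ a - / b)%C with ((b - a) / (a * b))%C by (field; auto).
      rewrite Cmod_div, Cmod_mult, Cmod_sub_comm by (apply Cmult_neq_0; auto).
      assert (Qa := Pos (Cmod a)). assert (Qb := Pos (Cmod b)). field. lra.
    + simpl (oinv None). rewrite Sw, (Sw (Some a)). apply H1.
  - destruct b as [b |]; [apply H1 |]. simpl (oinv None).
    rewrite rho_S_fin. replace (RtoC 0 - RtoC 0)%C with (RtoC 0) by ring.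
    rewrite Cmod_0. simpl. unfold Rdiv. ring.
Qed.

Definition finv (f : C -> option C) (z : C) : option C := oinv (f z).

Lemma order_finv (f : C -> option C) (a : C) (m : Z) : has_order f a m -> has_order (finv f) a (- m).
Proof.
  intros H. apply has_order_iff in H. destruct H as (r & Hr & g & G1 & G2 & G3 & G4).
  assert (Cg : ccont g a) by (apply cdiff_ccont, G1; rewrite Cmod_sub_diag; auto).
  destruct (ccont_neq0 g a Cg G2) as (d & D & K).
  destruct (pos_min r d Hr D) as (e & E0 & E1 & E2).
  apply has_order_iff. exists e; split; [auto |]. exists (fun z => / g z)%C.
  split; [| split; [| split]].
  - intros z Hz. apply cdiff_inv; [apply G1 | apply K]; lra.
  - apply Cinv_neq0, G2.
  - intros z [Z1 Z2]. unfold finv. rewrite G3 by lra.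
    assert (N1 : zpow (z - a) m <> 0%C) by (apply zpow_neq0, Cmod_gt_0, Z1).
    assert (N2 : g z <> 0%C) by (apply K; lra).
    rewrite oinv_fin by (apply Cmult_neq_0; auto). f_equal. rewrite zpow_opp. field. auto.
  - unfold finv. rewrite G4.
    destruct (Z.ltb_spec 0 m), (Z.eqb_spec m 0), (Z.ltb_spec 0 (- m)), (Z.eqb_spec (- m) 0);
      try lia; auto using oinv_0, oinv_fin.
Qed.

Lemma almost_elliptic_finv f : almost_elliptic f -> almost_elliptic (finv f).
Proof.
  intros (M & (z1 & z2 & N) & A). split; [| split].
  - intros a. destruct (M a) as [m Hm]. exists (- m)%Z. apply order_finv, Hm.
  - exists z1, z2. unfold finv. intros E. apply N.
    rewrite <- (oinv_involutive (f z1)), E. apply oinv_involutive.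
  - intros e He. destruct (A e He) as (L & HL & K). exists L; split; [auto |].
    intros c. destruct (K c) as (tau & T1 & T2). exists tau; split; [auto |].
    intros z. unfold finv. rewrite rho_S_oinv. apply T2.
Qed.

(** With an almost period [tau] near [w], the vector [u = w - tau] is bounded. Every translate of
    [f] thus resembles one from a bounded family, which turns local statements into uniform ones. *)
Lemma almost_elliptic_recentre (f : C -> option C) : almost_elliptic f -> forall eps, 0 < eps ->
  exists L, 0 < L /\ forall w : C, exists u : C, Cmod u < L /\
    forall z : C, rho_S (f (z + w)%C) (f (z + u)%C) < eps.
Proof.
  intros (_ & _ & A) e He. destruct (A e He) as (L & HL & K). exists L; split; [auto |].
  intros w. destruct (K w) as (tau & T1 & T2).
  exists (w - tau)%C. split.
  - rewrite Cnorm_Cmod in T1. rewrite Cmod_sub_comm. exact T1.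
  - intros z. specialize (T2 (z + (w - tau))%C).
    assert (E : (z + w)%C = (z + (w - tau) + tau)%C :> C) by ring. rewrite E. exact T2.
Qed.

(** * Squares of fixed size on which the function or its inverse is bounded *)

Definition sq (a : C) (r : R) (z : C) : Prop :=
  inrect (fst a - r) (fst a + r) (snd a - r) (snd a + r) z.

Lemma sq_iff a r z : sq a r z <-> Rabs (fst z - fst a) <= r /\ Rabs (snd z - snd a) <= r.
Proof.
  unfold sq, inrect. split.
  - intros [? ?]; split; apply Rabs_le; lra.
  - intros [A B]. apply Rabs_le_between in A. apply Rabs_le_between in B. lra.
Qed.

Lemma sq_of_Cmod a r z : Cmod (z - a) <= r -> sq a r z.
Proof.
  intros H. apply sq_iff.
  assert (A := abs_fst_Cmod (z - a)). assert (B := abs_snd_Cmod (z - a)).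
  change (fst (z - a)%C) with (fst z - fst a) in A.
  change (snd (z - a)%C) with (snd z - snd a) in B. lra.
Qed.

Lemma sq_Cmod a r z : sq a r z -> Cmod (z - a) <= 2 * r.
Proof.
  intros H. apply sq_iff in H. destruct H. replace (2 * r) with (r + r) by ring.
  apply Cmod_le_sides; auto.
Qed.

Definition bounded_on (f : C -> option C) (M : R) (S : C -> Prop) : Prop :=
  forall z, S z -> exists u, f z = Some u /\ Cmod u <= M.

Lemma locally_bounded (f : C -> option C) (a : C) M : meromorphic f ->
  (exists u, f a = Some u /\ Cmod u < M) ->
  exists r, 0 < r /\ bounded_on f M (fun z => Cmod (z - a) < r).
Proof.
  intros Mf (u & E & Hu). destruct (Mf a) as [m Hm].
  assert (Pm : (0 <= m)%Z).
  { apply Z.nlt_ge. intros L. apply (order_values f a m Hm) in L. congruence. }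
  destruct (order_nonneg f a m Hm Pm) as [D E'].
  assert (Eu : fin f a = u) by congruence.
  destruct (cdiff_ccont _ _ D (M - Cmod u)) as (r & Hr & K); [lra |].
  destruct (order_punctured f a m Hm) as (r' & Hr' & K').
  destruct (pos_min r r' Hr Hr') as (q & Q0 & Q1 & Q2). exists q; split; [auto |].
  intros z Hz. exists (fin f z). split.
  - destruct (Ceq_dec z a) as [-> | N]; [exact E' |].
    apply order_0, K'. split; [apply Cmod_sub_neq, N | lra].
  - specialize (K z ltac:(lra)). rewrite Eu in K. assert (Up := Cmod_upper (fin f z) u). lra.
Qed.

Definition dichotomy (f : C -> option C) (s : R) : Prop :=
  forall w, bounded_on f 2 (sq w s) \/ bounded_on (finv f) 2 (sq w s).

(** Compactness of [sq 0 L] gives one size [s] for all centres there, and [almost_elliptic_recentre]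
    carries it to every centre in the plane. *)
Lemma bounded_or_inverse_bounded (f : C -> option C) : almost_elliptic f ->
  exists s, 0 < s /\ dichotomy f s.
Proof.
  intros AE. assert (AEi := almost_elliptic_finv f AE).
  assert (Mf := proj1 AE). assert (Mfi := proj1 AEi).
  (* The compactness argument yields the bound [3 / 2], above 1 so that a value or its inverse is
     always below it; the remaining [1 / 2] absorbs the error of the translation. *)
  destruct (rho_close (3 / 2) (1 / 2)) as (eps & E0 & EC); [lra | lra |].
  destruct (almost_elliptic_recentre f AE eps E0) as (L & HL & HR).
  assert (Main : exists s, 0 < s /\ forall w, sq 0 L w ->
    bounded_on f (3 / 2) (sq w s) \/ bounded_on (finv f) (3 / 2) (sq w s)).
  { apply (rect_compact (fun S => exists s, 0 < s /\ forall w, S w ->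
      bounded_on f (3 / 2) (sq w s) \/ bounded_on (finv f) (3 / 2) (sq w s))); [| | | lra | lra].
    - intros S T H (s & S0 & S1). exists s; auto.
    - intros S T (s & S0 & S1) (t & T0 & T1). destruct (pos_min s t S0 T0) as (q & Q0 & Q1 & Q2).
      assert (Sub : forall w p, q <= p -> forall z, sq w q z -> sq w p z)
        by (intros w p Hp z [? ?]; split; lra).
      exists q; split; [auto |]. intros w [Hw | Hw].
      + destruct (S1 w Hw) as [H | H]; [left | right]; intros z Hz; apply H, (Sub w s); auto.
      + destruct (T1 w Hw) as [H | H]; [left | right]; intros z Hz; apply H, (Sub w t); auto.
    - intros a.
      assert (Near : forall h, meromorphic h -> (exists u, h a = Some u /\ Cmod u < 3 / 2) ->
        exists r, 0 < r /\ forall w, Cmod (w - a) < r -> bounded_on h (3 / 2) (sq w r)).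
      { intros h Mh Hu. destruct (locally_bounded h a (3 / 2) Mh Hu) as (r & Hr & B).
        exists (r / 4). split; [lra |]. intros w Hw z Hz. apply B.
        assert (T := Cmod_triangle_sub z w a). apply sq_Cmod in Hz. lra. }
      assert (Alt : (exists u, f a = Some u /\ Cmod u < 3 / 2) \/
        (exists u, finv f a = Some u /\ Cmod u < 3 / 2)).
      { unfold finv. destruct (f a) as [u |].
        - destruct (Rlt_dec (Cmod u) (3 / 2)); [left; eauto | right].
          assert (N : u <> 0%C) by (apply Cmod_gt_0; lra).
          exists (/ u)%C. split; [apply oinv_fin, N |]. rewrite Cmod_inv by auto.
          assert (/ Cmod u <= / (3 / 2)) by (apply Rinv_le_contravar; lra). lra.
        - right. exists (RtoC 0). split; [reflexivity |]. rewrite Cmod_0. lra. }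
      destruct Alt as [H | H].
      + destruct (Near f Mf H) as (r & Hr & B). exists r; split; [auto |].
        exists r; split; [auto |]. auto.
      + destruct (Near _ Mfi H) as (r & Hr & B). exists r; split; [auto |].
        exists r; split; [auto |]. auto. }
  destruct Main as (s & S0 & S1). exists s; split; [auto |]. intros w.
  destruct (HR w) as (u & U0 & U1).
  assert (Tr : forall z, sq w s z -> sq u s (z - w + u)%C).
  { intros z Hz. apply sq_iff in Hz. apply sq_iff. destruct z, w, u; simpl in *.
    replace (r + - r1 + r3 - r3) with (r - r1) by ring.
    replace (r0 + - r2 + r4 - r4) with (r0 - r2) by ring. auto. }
  assert (Close : forall h, (forall z, rho_S (h (z + w)%C) (h (z + u)%C) < eps) ->
    bounded_on h (3 / 2) (sq u s) -> bounded_on h 2 (sq w s)).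
  { intros h Hh B z Hz. destruct (B _ (Tr z Hz)) as (v & Ev & Bv).
    specialize (Hh (z - w)%C). rewrite Ev in Hh. replace (z - w + w)%C with z in Hh by ring.
    destruct (EC v (h z) Bv Hh) as (v' & Ev' & Bv').
    exists v'. split; [auto |]. assert (Up := Cmod_upper v' v). lra. }
  destruct (S1 u) as [H | H].
  { apply sq_of_Cmod. replace (u - 0)%C with u by ring. lra. }
  - left. apply Close; auto.
  - right. apply Close; auto. intros z. unfold finv. rewrite rho_S_oinv. apply U1.
Qed.

(** * Spreading of smallness *)

Lemma prodl_root A z : In z A -> prodl A z = 0%C.
Proof.
  induction A as [| c A IH]; intros H; [contradiction |].
  change (prodl (c :: A) z) with ((z - c) * prodl A z)%C. destruct H as [-> | H]; [ring |].
  rewrite IH by auto. ring.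
Qed.

Lemma prodl_middle A c B z : prodl (A ++ c :: B) z = ((z - c) * prodl (A ++ B) z)%C.
Proof.
  rewrite !prodl_app. change (prodl (c :: B) z) with ((z - c) * prodl B z)%C. ring.
Qed.

Lemma prodl_upper A z d : (forall c, In c A -> Cmod (z - c) <= d) -> Cmod (prodl A z) <= d ^ length A.
Proof.
  induction A as [| c A IH]; intros H; [simpl; rewrite Cmod_1; lra |].
  change (prodl (c :: A) z) with ((z - c) * prodl A z)%C. rewrite Cmod_mult. simpl.
  apply Rmult_le_compat; try apply Cmod_ge_0; [apply H; left; auto | apply IH; intros; apply H; right; auto].
Qed.

Lemma prodl_lower A z d : 0 <= d -> (forall c, In c A -> d <= Cmod (z - c)) -> d ^ length A <= Cmod (prodl A z).
Proof.
  intros Hd. induction A as [| c A IH]; intros H; [simpl; rewrite Cmod_1; lra |].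
  change (prodl (c :: A) z) with ((z - c) * prodl A z)%C. rewrite Cmod_mult. simpl.
  apply Rmult_le_compat; auto using pow_le; [apply H; left; auto | apply IH; intros; apply H; right; auto].
Qed.

Lemma list_away A z : ~ In z A -> exists r, 0 < r /\ forall w, Cmod (w - z) < r -> ~ In w A.
Proof.
  intros N. destruct (ccont_neq0 (prodl A) z) as (r & Hr & K).
  - apply cdiff_ccont, cdiff_prodl.
  - apply prodl_neq0, N.
  - exists r; split; [auto |]. intros w Hw I. apply (K w Hw), prodl_root, I.
Qed.

(* Squaring [g] makes the singularities removable without any theory: near a zero [c] the
   quotient is [(z - c)] times a continuous function. *)
Definition sq_quot (g : C -> C) (A : list C) (z : C) : C :=
  if in_dec Ceq_dec z A then RtoC 0 else (g z * g z * / prodl A z)%C.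

Lemma cdiff_sq_quot (g : C -> C) A z : NoDup A -> (forall c, In c A -> g c = 0%C) -> cdiff g z ->
  cdiff (sq_quot g A) z.
Proof.
  intros ND Z Dg. destruct (in_dec Ceq_dec z A) as [I | N].
  - destruct (in_split z A I) as (l1 & l2 & E).
    assert (Nr : ~ In z (l1 ++ l2)) by (rewrite E in ND; apply NoDup_remove_2, ND).
    destruct (list_away _ _ Nr) as (r & Hr & K).
    destruct Dg as (s & Hs & Es). rewrite (Z z I) in Es.
    set (psi := fun w => (s w * s w * / prodl (l1 ++ l2) w)%C).
    apply (cdiff_ext_loc (fun w => (w - z) * psi w)%C) with (r := r); auto.
    + intros w Hw. unfold sq_quot. destruct (in_dec Ceq_dec w A) as [Iw | Nw].
      * assert (w = z).
        { rewrite E in Iw. apply in_app_or in Iw. specialize (K w Hw). rewrite in_app_iff in K.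
          destruct Iw as [? | [? | ?]]; [tauto | auto | tauto]. }
        subst w. ring.
      * rewrite E, prodl_middle, (Es w). unfold psi. field.
        split; [apply prodl_neq0, K, Hw |]. apply Cminus_neq0. intros ->. auto.
    + exists psi. split; [| intros w; ring].
      apply ccont_mult; [apply ccont_mult; auto |].
      apply ccont_inv; [apply cdiff_ccont, cdiff_prodl | apply prodl_neq0, Nr].
  - destruct (list_away _ _ N) as (r & Hr & K).
    apply (cdiff_ext_loc (fun w => g w * g w * / prodl A w)%C) with (r := r); auto.
    + intros w Hw. unfold sq_quot. destruct (in_dec Ceq_dec w A); [| auto].
      exfalso. apply (K w Hw); auto.
    + apply cdiff_mult; [apply cdiff_mult; auto |].
      apply cdiff_inv; [apply cdiff_prodl | apply prodl_neq0, N].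
Qed.

Lemma sq_mono a r s z : r <= s -> sq a r z -> sq a s z.
Proof. intros H [? ?]; split; lra. Qed.

(** A Schwarz lemma for many zeros. With [d = 9 * s / 10], each factor of [prodl A] is at least [d]
    on the boundary and at most [d / 2] on the inner square, so each zero gains a factor 2. The
    constant 6 is that of [Cauchy_estimate]. *)
Lemma many_zeros_small (g : C -> C) s M A : 0 < s ->
  (forall z, sq 0 s z -> cdiff g z) -> (forall z, sq 0 s z -> Cmod (g z) <= M) ->
  NoDup A -> (forall c, In c A -> sq 0 (s / 10) c /\ g c = 0%C) ->
  forall z, sq 0 (s / 10) z -> Cmod (g z) ^ 2 <= 6 * M ^ 2 / 2 ^ length A.
Proof.
  intros Hs Dg Bg ND HA z Hz. set (N := length A).
  assert (P2 : 0 < 2 ^ N) by (apply pow_lt; lra).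
  assert (M0 := Bg 0%C). assert (HM : 0 <= M).
  { eapply Rle_trans; [apply Cmod_ge_0 | apply (Bg z), (sq_mono _ (s / 10)); auto; lra]. }
  destruct (in_dec Ceq_dec z A) as [I | NI].
  { destruct (HA z I) as [_ ->]. rewrite Cmod_0. simpl. rewrite Rmult_0_l.
    apply Rdiv_le_0_compat; [nra | auto]. }
  set (d := 9 * s / 10).
  assert (Pd : 0 < d ^ N) by (apply pow_lt; unfold d; lra).
  assert (E := Cauchy_estimate (sq_quot g A) (RtoC 0) s (M ^ 2 / d ^ N) Hs).
  assert (Q : Cmod (sq_quot g A z) <= 6 * (M ^ 2 / d ^ N)).
  { apply E.
    - intros w Hw. apply cdiff_sq_quot; auto. intros c Hc. apply HA, Hc.
    - intros w Hw.
      assert (Far : forall c, In c A -> d <= Cmod (w - c)).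
      { intros c Hc. apply (bdry_square_far (RtoC 0) s); [unfold d; lra | auto |].
        destruct (HA c Hc) as [[? ?] _]. unfold d. split; simpl in *; lra. }
      assert (Nw : ~ In w A).
      { intros I. specialize (Far w I). rewrite Cmod_sub_diag in Far. unfold d in Far. lra. }
      unfold sq_quot. destruct (in_dec Ceq_dec w A); [contradiction |].
      rewrite !Cmod_mult, Cmod_inv by (apply prodl_neq0, Nw).
      assert (L := prodl_lower A w d ltac:(unfold d; lra) Far). fold N in L.
      assert (Bw := Bg w (proj1 Hw)). assert (P := Cmod_ge_0 (g w)).
      apply Rmult_le_compat; [nra | | nra | apply Rinv_le_contravar; auto].
      left. apply Rinv_0_lt_compat. lra.
    - destruct Hz as [? ?]. split; simpl in *; lra. }
  unfold sq_quot in Q. destruct (in_dec Ceq_dec z A); [contradiction |].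
  assert (Np := prodl_neq0 A z NI).
  rewrite !Cmod_mult, Cmod_inv in Q by auto.
  assert (U : Cmod (prodl A z) <= (d / 2) ^ N).
  { apply prodl_upper. intros c Hc. destruct (HA c Hc) as [Sc _].
    assert (A1 := inrect_dist _ _ _ _ z c Hz Sc). unfold d. simpl in *. lra. }
  assert (Pp : 0 < Cmod (prodl A z)) by (apply Cmod_gt_0, Np).
  replace (Cmod (g z) ^ 2) with (Cmod (g z) * Cmod (g z) * / Cmod (prodl A z) * Cmod (prodl A z))
    by (field; lra).
  eapply Rle_trans; [apply Rmult_le_compat; [| | apply Q | apply U] |].
  - apply Rmult_le_pos; [apply Rle_0_sqr | left; apply Rinv_0_lt_compat, Pp].
  - lra.
  - right. unfold Rdiv at 2. rewrite Rpow_mult_distr, pow_inv. field. split; lra.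
Qed.

(** * Interpolation at separated nodes *)

Fixpoint separated (sigma : R) (A : list C) : Prop :=
  match A with
  | nil => True
  | c :: A' => (forall c', In c' A' -> sigma <= Cmod (c - c')) /\ separated sigma A'
  end.

Lemma separated_NoDup sigma A : 0 < sigma -> separated sigma A -> NoDup A.
Proof.
  intros Hs. induction A as [| c A IH]; intros H; constructor.
  - intros I. destruct H as [H _]. specialize (H c I). rewrite Cmod_sub_diag in H. lra.
  - apply IH, H.
Qed.

(* [K] depends on the nodes only through their number and separation. *)
Lemma interpolation (N : nat) (r sigma : R) : 0 < r -> 0 < sigma ->
  exists K, 0 <= K /\ forall A : list C, length A = N -> separated sigma A ->
    (forall c, In c A -> sq 0 r c) ->
    forall (v : C -> C) mu, 0 <= mu -> (forall c, In c A -> Cmod (v c) <= mu) ->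
    exists p : C -> C, (forall z, cdiff p z) /\ (forall c, In c A -> p c = v c) /\
      (forall z, sq 0 r z -> Cmod (p z) <= K * mu).
Proof.
  intros Hr Hs. induction N as [| N (K & K0 & HK)].
  - exists 0. split; [lra |]. intros [| ? ?] LA; [| discriminate]. intros _ _ v mu Hmu _.
    exists (fun _ => RtoC 0).
    split; [intros; apply cdiff_const | split; [intros ? [] |]]. intros. rewrite Cmod_0. lra.
  - set (T := (4 * r) ^ N). assert (HT : 0 <= T) by (apply pow_le; lra).
    assert (Ps : 0 < sigma ^ N) by (apply pow_lt, Hs).
    assert (I0 : 0 < / sigma ^ N) by (apply Rinv_0_lt_compat, Ps).
    exists (K + (1 + K) * / sigma ^ N * T). split.
    { apply Rplus_le_le_0_compat; [auto |]. repeat apply Rmult_le_pos; lra. }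
    intros [| c A] LA; [discriminate |]. injection LA as LA. intros [S1 S2] HA v mu Hmu Hv.
    assert (Low := prodl_lower A c sigma (Rlt_le _ _ Hs) S1). rewrite LA in Low.
    assert (Np : prodl A c <> 0%C) by (apply Cmod_gt_0; lra).
    destruct (HK A LA S2 (fun c I => HA c (or_intror I)) v mu Hmu (fun c I => Hv c (or_intror I)))
      as (p & P1 & P2 & P3).
    (* Newton's form: the correction vanishes at the old nodes and repairs the value at [c].
       Separation bounds the denominator [prodl A c] from below. *)
    exists (fun z => p z + ((v c - p c) * / prodl A c) * prodl A z)%C. split; [| split].
    + intros z. apply cdiff_plus; [auto |].
      apply cdiff_mult; [apply cdiff_const | apply cdiff_prodl].
    + intros w [<- | I]; [field; auto |]. rewrite (prodl_root A w I), (P2 w I). ring.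
    + intros z Hz. eapply Rle_trans; [apply Cmod_triangle |].
      rewrite !Cmod_mult, Cmod_inv by auto.
      assert (Bz := P3 z Hz). assert (Bc := P3 c (HA c (or_introl eq_refl))).
      assert (Bv := Hv c (or_introl eq_refl)).
      assert (Bd : Cmod (v c - p c) <= (1 + K) * mu).
      { unfold Cminus. eapply Rle_trans; [apply Cmod_triangle |]. rewrite Cmod_opp. lra. }
      assert (Bp : Cmod (prodl A z) <= T).
      { unfold T. rewrite <- LA. apply prodl_upper. intros w Hw.
        assert (Q := inrect_dist _ _ _ _ z w Hz (HA w (or_intror Hw))). simpl in Q. lra. }
      assert (Bi : / Cmod (prodl A c) <= / sigma ^ N) by (apply Rinv_le_contravar; auto).
      assert (Bi0 : 0 < / Cmod (prodl A c)) by (apply Rinv_0_lt_compat; lra).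
      assert (Cmod (v c - p c) * / Cmod (prodl A c) * Cmod (prodl A z)
        <= (1 + K) * mu * / sigma ^ N * T).
      { apply Rmult_le_compat; auto using Cmod_ge_0.
        - apply Rmult_le_pos; [apply Cmod_ge_0 | lra].
        - apply Rmult_le_compat; auto using Cmod_ge_0; lra. }
      nra.
Qed.

Lemma sq_le_le a b : 0 <= b -> a ^ 2 <= b ^ 2 -> a <= b.
Proof. intros Hb H. apply Rnot_lt_le. intros L. nra. Qed.

(** Subtracting the interpolation polynomial of [g] at the nodes makes them zeros, so
    [many_zeros_small] applies; the polynomial is small because its data are. [N] is fixed before
    [sigma], so the separation may later depend on the number of nodes. *)
Lemma small_at_separated_points s mu' : 0 < s -> 0 < mu' -> exists N : nat, forall sigma, 0 < sigma ->
  exists mu, 0 < mu /\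
  forall (g : C -> C) (A : list C), (forall z, sq 0 s z -> cdiff g z) ->
    (forall z, sq 0 s z -> Cmod (g z) <= 2) -> length A = N -> separated sigma A ->
    (forall c, In c A -> sq 0 (s / 10) c /\ Cmod (g c) <= mu) ->
    forall z, sq 0 (s / 10) z -> Cmod (g z) <= mu'.
Proof.
  intros Hs Hm.
  (* 54 is [6 * 3 ^ 2]: the difference is at most 3, namely 2 for [g] and 1 for the polynomial. The
     difference and the polynomial get [mu' / 2] each. *)
  destruct (halving_lt 54 ((mu' / 2) ^ 2)) as [N HN]; [lra | apply pow_lt; lra |].
  specialize (HN N (le_n N)). exists N. intros sigma Hsig.
  destruct (interpolation N s sigma Hs Hsig) as (K & K0 & HK).
  assert (P1 : 0 < 1 / (K + 1)) by (apply Rdiv_lt_0_compat; lra).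
  assert (P2 : 0 < mu' / 2 / (K + 1)) by (apply Rdiv_lt_0_compat; lra).
  destruct (pos_min _ _ P1 P2) as (mu & M0 & M1 & M2). exists mu; split; [auto |].
  assert (M1' : K * mu <= 1).
  { apply Rle_trans with ((K + 1) * (1 / (K + 1))); [nra | right; field; lra]. }
  assert (M2' : K * mu <= mu' / 2).
  { apply Rle_trans with ((K + 1) * (mu' / 2 / (K + 1))); [nra | right; field; lra]. }
  intros g A Dg Bg LA SA HA z Hz.
  assert (Sub : forall x, sq 0 (s / 10) x -> sq 0 s x) by (intros x; apply sq_mono; lra).
  destruct (HK A LA SA (fun c I => Sub c (proj1 (HA c I))) g mu) as (p & Q1 & Q2 & Q3);
    [lra | intros c Hc; apply HA, Hc |].
  set (k := fun w => (g w - p w)%C).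
  assert (Bk := many_zeros_small k s 3 A Hs).
  assert (Bz : Cmod (k z) ^ 2 <= 6 * 3 ^ 2 / 2 ^ length A).
  { apply Bk; auto.
    - intros w Hw. apply cdiff_minus; auto.
    - intros w Hw. unfold k, Cminus. eapply Rle_trans; [apply Cmod_triangle |]. rewrite Cmod_opp.
      specialize (Bg w Hw). specialize (Q3 w Hw). lra.
    - apply (separated_NoDup sigma); auto.
    - intros c Hc. split; [apply HA, Hc |]. unfold k. rewrite Q2 by auto. ring. }
  rewrite LA in Bz. replace (6 * 3 ^ 2) with 54 in Bz by ring.
  assert (Kz : Cmod (k z) <= mu' / 2) by (apply sq_le_le; lra).
  specialize (Q3 z (Sub z Hz)).
  replace (g z) with (k z + p z)%C by (unfold k; ring).
  eapply Rle_trans; [apply Cmod_triangle | lra].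
Qed.

(* Otherwise every contour carries a small value, and these are enough separated nodes. *)
Lemma minimum_modulus s mu' : 0 < s -> 0 < mu' -> exists eta, 0 < eta /\
  forall g : C -> C, (forall z, sq 0 s z -> cdiff g z) -> (forall z, sq 0 s z -> Cmod (g z) <= 2) ->
    (exists z, sq 0 (s / 10) z /\ mu' < Cmod (g z)) ->
    exists r, 0 < r <= s / 20 /\ forall z, bdry (0 - r) (0 + r) (0 - r) (0 + r) z -> eta < Cmod (g z).
Proof.
  intros Hs Hm. destruct (small_at_separated_points s mu' Hs Hm) as (N & HN).
  assert (PN : 0 < INR (S N)) by apply lt_0_INR, Nat.lt_0_succ.
  (* Concentric squares with half sides [sigma * n] have boundaries at least [sigma] apart, so one
     node on each gives separated nodes; [N + 1] of these squares fit into half side [s / 20]. *)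
  set (sigma := s / 20 / INR (S N)).
  assert (Sg0 : 0 < sigma) by (apply Rdiv_lt_0_compat; lra).
  assert (SgN : sigma * INR (S N) = s / 20) by (unfold sigma; field; lra).
  destruct (HN sigma Sg0) as (eta & E0 & HE). exists eta; split; [auto |].
  intros g Dg Bg (z0 & Sz0 & Hz0). apply NNPP. intros NE.
  enough (H : forall n, (n <= N)%nat -> exists A, length A = n /\ separated sigma A /\
    forall c, In c A -> sq 0 (sigma * INR n) c /\ Cmod (g c) <= eta).
  { destruct (H N (le_n N)) as (A & A1 & A2 & A3).
    assert (B := HE g A Dg Bg A1 A2). apply (Rlt_not_le _ _ Hz0), B; auto.
    intros c Hc. destruct (A3 c Hc) as [S1 S2]. split; [| auto].
    apply (sq_mono _ (sigma * INR N)); [| auto]. rewrite S_INR in SgN. nra. }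
  induction n as [| n IH]; intros Hn.
  - exists nil. split; [auto | split; [exact I | intros c []]].
  - destruct IH as (A & A1 & A2 & A3); [lia |].
    assert (Pn := pos_INR n). rewrite S_INR. set (r := sigma * (INR n + 1)).
    assert (Hr : 0 < r) by (unfold r; nra).
    assert (Hr' : r <= s / 20).
    { rewrite <- SgN, S_INR. unfold r. apply Rmult_le_compat_l; [lra |].
      apply le_INR in Hn. rewrite S_INR in Hn. lra. }
    assert (Hz : exists z, bdry (0 - r) (0 + r) (0 - r) (0 + r) z /\ Cmod (g z) <= eta).
    { apply NNPP. intros NZ. apply NE. exists r. split; [auto |]. intros z Hz.
      apply Rnot_le_lt. intros L. apply NZ. exists z; auto. }
    destruct Hz as (z & Bz & Ez). exists (z :: A). split; [simpl; congruence | split; [split |]]; auto.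
    + intros c Hc. apply (bdry_square_far (RtoC 0) r); auto.
      destruct (A3 c Hc) as [[X Y] _]. unfold r. split; simpl in *; lra.
    + intros c [<- | Hc]; [split; [exact (proj1 Bz) | auto] |].
      destruct (A3 c Hc) as [S1 S2]. split; [| auto].
      apply (sq_mono _ (sigma * INR n)); [unfold r; nra | auto].
Qed.

(** If [g] exceeded [mu'] in the larger square, [minimum_modulus] would give a contour inside the
    smaller one on which [g] exceeds [mu]. *)
Lemma smallness_spreads s mu' : 0 < s -> 0 < mu' -> exists mu, 0 < mu /\
  forall g : C -> C, (forall z, sq 0 s z -> cdiff g z) -> (forall z, sq 0 s z -> Cmod (g z) <= 2) ->
    (forall z, sq 0 (s / 20) z -> Cmod (g z) <= mu) ->
    forall z, sq 0 (s / 10) z -> Cmod (g z) <= mu'.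
Proof.
  intros Hs Hm. destruct (minimum_modulus s mu' Hs Hm) as (mu & M0 & HM). exists mu; split; [auto |].
  intros g Dg Bg Sg z Hz. apply Rnot_lt_le. intros L.
  destruct (HM g Dg Bg (ex_intro _ z (conj Hz L))) as (r & Hr & Hb).
  apply (Rlt_not_le _ _ (Hb (r, 0) ltac:(unfold bdry, inrect, interior_rect; simpl; lra))).
  apply Sg. split; simpl; lra.
Qed.

(** * Propagation of smallness over bounded distances *)

Lemma fin_cdiff (f : C -> option C) z u : meromorphic f -> f z = Some u -> cdiff (fin f) z /\ fin f z = u.
Proof.
  intros Mf E. destruct (Mf z) as [m Hm]. destruct (order_nonneg f z m Hm) as [D E'].
  - apply Z.nlt_ge. intros L. apply (order_values f z m Hm) in L. congruence.
  - split; [auto | congruence].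
Qed.

Lemma cdiff_affine_comp g k c z : cdiff g (k * z + c)%C -> cdiff (fun w => g (k * w + c))%C z.
Proof.
  intros (s & Hs & E). exists (fun w => s (k * w + c) * k)%C. split.
  - apply ccont_mult; [| apply ccont_const]. intros e He. destruct (Hs e He) as (d & D & K).
    assert (Pk := Cmod_ge_0 k).
    exists (d / (Cmod k + 1)). split; [apply Rdiv_lt_0_compat; lra |]. intros w Hw. apply K.
    replace (k * w + c - (k * z + c))%C with (k * (w - z))%C by ring. rewrite Cmod_mult.
    assert (P := Cmod_ge_0 (w - z)).
    apply Rle_lt_trans with ((Cmod k + 1) * Cmod (w - z)); [nra |].
    apply Rlt_le_trans with ((Cmod k + 1) * (d / (Cmod k + 1))); [| right; field; lra].
    apply Rmult_lt_compat_l; lra.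
  - intros w. rewrite E. ring.
Qed.

(** A quarter turn maps the square to itself, so the charts with [k = Ci] reduce vertical segments
    to the real axis. *)
Lemma sq_chart (k w : C) r (z : C) : k = RtoC 1 \/ k = Ci -> (sq 0 r z <-> sq w r (k * z + w)%C).
Proof.
  intros Hk. rewrite !sq_iff. destruct z as [x y], w as [a b]. destruct Hk as [-> | ->]; simpl.
  - replace (1 * x - 0 * y + a - a) with (x - 0) by ring.
    replace (1 * y + 0 * x + b - b) with (y - 0) by ring. tauto.
  - replace (0 * x - 1 * y + a - a) with (- (y - 0)) by ring.
    replace (0 * y + 1 * x + b - b) with (x - 0) by ring. rewrite Rabs_Ropp. tauto.
Qed.

Lemma small_not_inverse_bounded (f : C -> option C) (w : C) mu S : S w -> mu < 1 / 2 ->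
  bounded_on f mu S -> ~ bounded_on (finv f) 2 S.
Proof.
  intros Sw Hmu B Bi. destruct (B w Sw) as (u & E & Hu), (Bi w Sw) as (v & Ev & Hv).
  unfold finv in Ev. rewrite E in Ev. simpl in Ev. destruct (Ceq_dec u 0) as [| N]; [congruence |].
  apply Some_inj in Ev. rewrite <- Ev, Cmod_inv in Hv by auto.
  assert (P : 0 < Cmod u) by (apply Cmod_gt_0, N).
  assert (Cmod u * / Cmod u = 1) by (field; lra). nra.
Qed.

Lemma bounded_on_chart (f : C -> option C) (k w : C) M s : meromorphic f ->
  k = RtoC 1 \/ k = Ci -> bounded_on f M (sq w s) ->
  forall z, sq 0 s z -> cdiff (fun z => fin f (k * z + w)%C) z /\ Cmod (fin f (k * z + w)%C) <= M.
Proof.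
  intros Mf Hk B z Hz. destruct (B (k * z + w)%C) as (u & E & Hu); [apply sq_chart; auto |].
  destruct (fin_cdiff f _ u Mf E) as [D F]. split; [apply cdiff_affine_comp, D | rewrite F; auto].
Qed.

(** Values below [1 / 2] are incompatible with an inverse bounded by 2, so [dichotomy] bounds [f]
    itself on the large square. [smallness_spreads] then reaches half side [s / 10], which covers
    each small square centred in [sq w (s / 20)]. *)
Lemma smallness_step (f : C -> option C) s mu' : almost_elliptic f -> 0 < s ->
  dichotomy f s -> 0 < mu' ->
  exists mu, 0 < mu /\ forall w, bounded_on f mu (sq w (s / 20)) ->
    forall w', sq w (s / 20) w' -> bounded_on f mu' (sq w' (s / 20)).
Proof.
  intros AE Hs Alt Hm. destruct (smallness_spreads s mu' Hs Hm) as (m1 & M1 & HS).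
  destruct (pos_min m1 (1 / 4)) as (mu & M0 & M2 & M3); [auto | lra |].
  exists mu; split; [auto |]. intros w B w' Hw' z Hz.
  assert (B2 : bounded_on f 2 (sq w s)).
  { destruct (Alt w) as [H | H]; [auto |]. exfalso.
    apply (small_not_inverse_bounded f w mu (sq w (s / 20))); [| lra | auto |].
    - apply sq_of_Cmod. rewrite Cmod_sub_diag. lra.
    - intros x Hx. apply H, (sq_mono _ (s / 20)); [lra | auto]. }
  assert (Ch := bounded_on_chart f 1 w 2 s (proj1 AE) (or_introl eq_refl) B2).
  assert (Hz1 : sq w (s / 10) z).
  { apply sq_iff in Hz. apply sq_iff in Hw'. apply sq_iff.
    destruct Hz as [A1 A2], Hw' as [A3 A4].
    apply Rabs_le_between in A1, A2, A3, A4. split; apply Rabs_le; lra. }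
  destruct (B2 z) as (u & Eu & _); [apply (sq_mono _ (s / 10)); [lra | auto] |].
  exists u; split; [auto |].
  destruct (fin_cdiff f z u (proj1 AE) Eu) as [_ <-].
  replace (fin f z) with ((fun x => fin f (1 * x + w)%C) (z - w)%C) by (cbv beta; f_equal; ring).
  apply (HS (fun x => fin f (1 * x + w)%C)).
  - intros x Hx. apply Ch, Hx.
  - intros x Hx. apply Ch, Hx.
  - intros x Hx. destruct (B (1 * x + w)%C) as (v & Ev & Hv).
    + apply sq_chart; auto.
    + destruct (fin_cdiff f _ v (proj1 AE) Ev) as [_ ->]. lra.
  - apply (sq_chart 1 w); [auto |]. replace (1 * (z - w) + w)%C with z by ring. exact Hz1.
Qed.

Lemma smallness_chain (f : C -> option C) s : almost_elliptic f -> 0 < s ->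
  dichotomy f s ->
  forall (J : nat) mu', 0 < mu' ->
  exists mu, 0 < mu /\ forall w, bounded_on f mu (sq w (s / 20)) ->
    forall w', sq w (INR J * (s / 20)) w' -> bounded_on f mu' (sq w' (s / 20)).
Proof.
  intros AE Hs Alt. induction J as [| J IH]; intros mu' Hm.
  - exists mu'; split; [auto |]. intros w B w' Hw'. simpl in Hw'. rewrite Rmult_0_l in Hw'.
    replace w' with w; [auto |]. destruct Hw' as [? ?], w, w'; simpl in *. f_equal; lra.
  - destruct (smallness_step f s mu' AE Hs Alt Hm) as (m1 & M1 & H1).
    destruct (IH m1 M1) as (mu & M0 & H0). exists mu; split; [auto |]. intros w B w' Hw'.
    rewrite S_INR in Hw'. assert (PJ := pos_INR J).
    (* The intermediate centre [w2] divides the way from [w] to [w'] in the ratio [J : 1]; it is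
       reached in [J] steps, and [w'] in one more. *)
    set (q := INR J / (INR J + 1)).
    assert (Hq : q * (INR J + 1) = INR J) by (unfold q; field; lra).
    assert (Hq0 : 0 <= q) by (apply Rdiv_le_0_compat; lra).
    assert (Hq1 : (1 - q) * (INR J + 1) = 1) by lra.
    assert (Hq2 : 0 <= 1 - q) by nra.
    set (t := s / 20) in *. assert (Ht : 0 < t) by (unfold t; lra).
    assert (Sc : forall x, Rabs x <= (INR J + 1) * t -> Rabs (q * x) <= INR J * t /\ Rabs ((1 - q) * x) <= t).
    { intros x Hx. rewrite !Rabs_mult, !(Rabs_pos_eq q), (Rabs_pos_eq (1 - q)) by auto.
      split.
      - rewrite <- Hq, Rmult_assoc. apply Rmult_le_compat_l; auto.
      - replace t with ((1 - q) * ((INR J + 1) * t)) by (rewrite <- Rmult_assoc, Hq1; ring).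
        apply Rmult_le_compat_l; auto. }
    set (w2 := (fst w + q * (fst w' - fst w), snd w + q * (snd w' - snd w)) : C).
    apply sq_iff in Hw'. destruct Hw' as [A1 A2].
    destruct (Sc _ A1) as [B1 B2], (Sc _ A2) as [B3 B4].
    apply (H1 w2).
    + apply (H0 w B). apply sq_iff. unfold w2; simpl.
      replace (fst w + q * (fst w' - fst w) - fst w) with (q * (fst w' - fst w)) by ring.
      replace (snd w + q * (snd w' - snd w) - snd w) with (q * (snd w' - snd w)) by ring. auto.
    + apply sq_iff. unfold w2; simpl.
      replace (fst w' - (fst w + q * (fst w' - fst w))) with ((1 - q) * (fst w' - fst w)) by ring.
      replace (snd w' - (snd w + q * (snd w' - snd w))) with ((1 - q) * (snd w' - snd w)) by ring. auto.
Qed.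

Lemma values_recur (f : C -> option C) (p0 u0 : C) eta : almost_elliptic f -> f p0 = Some u0 -> 0 < eta ->
  exists K, 0 < K /\ forall w : C, exists p v, Cmod (p - w) < K /\ f p = Some v /\ Cmod (v - u0) < eta.
Proof.
  intros AE E He. destruct (rho_close (Cmod u0) eta (Cmod_ge_0 _) He) as (eps & E0 & EC).
  destruct (almost_elliptic_recentre f AE eps E0) as (L & HL & HR).
  assert (P0 := Cmod_ge_0 p0). exists (Cmod p0 + L). split; [lra |].
  intros w. destruct (HR w) as (u & U0 & U1). specialize (U1 (p0 - u)%C).
  replace (p0 - u + u)%C with p0 in U1 by ring. rewrite E in U1.
  destruct (EC u0 _ (Rle_refl _) U1) as (v & Ev & Bv).
  exists (p0 - u + w)%C, v. split; [| auto].
  replace (p0 - u + w - w)%C with (p0 + - u)%C by ring.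
  eapply Rle_lt_trans; [apply Cmod_triangle |]. rewrite Cmod_opp. lra.
Qed.

(** Some value close to a fixed nonzero [u0] is taken within distance [K0] of any [w]. The number
    [J] of steps needed to get there is independent of [w], so smallness near [w] would reach such a
    point. *)
Lemma nondegenerate (f : C -> option C) s : almost_elliptic f -> 0 < s ->
  dichotomy f s ->
  exists mu, 0 < mu /\ forall w, ~ bounded_on f mu (sq w (s / 20)).
Proof.
  intros AE Hs Alt. destruct (proj1 AE (RtoC 0)) as [m Hm].
  destruct (order_punctured f (RtoC 0) m Hm) as (r & Hr & K).
  destruct (point_near (RtoC 0) r Hr) as (p0 & Hp0).
  destruct (order_0 f p0 (K p0 Hp0)) as (_ & E & N). set (u0 := fin f p0) in *.
  assert (Pu : 0 < Cmod u0) by (apply Cmod_gt_0, N).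
  destruct (values_recur f p0 u0 (Cmod u0 / 2) AE E) as (K0 & HK0 & HP); [lra |].
  destruct (INR_unbounded (K0 / (s / 20))) as [J HJ].
  destruct (smallness_chain f s AE Hs Alt J (Cmod u0 / 2)) as (mu & M0 & HM); [lra |].
  exists mu; split; [auto |]. intros w B.
  destruct (HP w) as (p & v & P1 & P2 & P3).
  destruct (HM w B p) with (z := p) as (v' & Ev & Hv).
  - apply (sq_mono _ K0); [| apply sq_of_Cmod; lra].
    apply Rle_trans with (K0 / (s / 20) * (s / 20)); [right; field; lra |].
    apply Rmult_le_compat_r; lra.
  - apply sq_of_Cmod. rewrite Cmod_sub_diag. lra.
  - assert (v' = v) by congruence. subst v'.
    assert (L := Cmod_lower v u0). lra.
Qed.

Lemma nondegenerate_chart (f : C -> option C) (k w : C) s mu : almost_elliptic f -> 0 < s ->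
  k = RtoC 1 \/ k = Ci -> bounded_on f 2 (sq w s) -> ~ bounded_on f mu (sq w (s / 20)) ->
  (forall z, sq 0 s z -> cdiff (fun z => fin f (k * z + w)%C) z /\ Cmod (fin f (k * z + w)%C) <= 2) /\
  exists z, sq 0 (s / 20) z /\ mu < Cmod (fin f (k * z + w)%C).
Proof.
  intros AE Hs Hk B ND.
  assert (Tr := fun r z => sq_chart k w r z Hk).
  split.
  - intros z Hz. apply (bounded_on_chart f k w 2 s (proj1 AE)); auto.
  - apply NNPP. intros NE. apply ND. intros z Hz.
    destruct (B z) as (u & E & Hu); [apply (sq_mono _ (s / 20)); [lra | auto] |].
    exists u; split; [auto |]. apply Rnot_lt_le. intros L. apply NE.
    set (z' := ((z - w) * Cconj k)%C).
    assert (Ez : (k * z' + w)%C = z).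
    { unfold z'. destruct Hk as [-> | ->]; apply injective_projections; simpl; ring. }
    exists z'. split; [apply (Tr (s / 20)); rewrite Ez; auto |].
    rewrite Ez. destruct (fin_cdiff f z u (proj1 AE) E) as [_ ->]. exact L.
Qed.

(** * Increments of the argument and recurrence of zeros *)

(** [N] consecutive levels [y n] lie strictly between [phi a] and [phi b]: the first exceeds [phi a]
    by at most [PI]. Each is attained by the intermediate value theorem, and distinct levels give
    distinct points. *)
Lemma increasing_crossings (phi : R -> R) a b alpha N : a <= b ->
  (forall t, a <= t <= b -> continuity_pt phi t) -> (INR N + 1) * PI < phi b - phi a ->
  exists l, NoDup l /\ length l = N /\
    forall x, In x l -> a <= x <= b /\ exists k : Z, phi x = IZR k * PI + alpha.
Proof.
  intros Hab HC HL. assert (PP := PI_RGT_0).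
  set (k0 := up ((phi a - alpha) / PI)).
  destruct (archimed ((phi a - alpha) / PI)) as [U1 U2]. fold k0 in U1, U2.
  set (y := fun n : nat => IZR (k0 + Z.of_nat n) * PI + alpha).
  assert (Ey : forall n, y n = (IZR k0 + INR n) * PI + alpha).
  { intros n. unfold y. rewrite plus_IZR, <- INR_IZR_INZ. reflexivity. }
  assert (Q : (phi a - alpha) / PI * PI = phi a - alpha) by (field; lra).
  assert (Y0 : forall n, phi a < y n).
  { intros n. rewrite Ey. assert (0 <= INR n) by apply pos_INR. nra. }
  assert (Y1 : forall n, (n < N)%nat -> y n < phi b).
  { intros n Hn. rewrite Ey. assert (INR n + 1 <= INR N) by (rewrite <- S_INR; apply le_INR; lia). nra. }
  enough (H : forall n, (n <= N)%nat -> exists l, NoDup l /\ length l = n /\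
    forall x, In x l -> a <= x <= b /\ exists i, (i < n)%nat /\ phi x = y i).
  { destruct (H N (le_n N)) as (l & L1 & L2 & L3). exists l. repeat split; auto.
    - apply L3; auto.
    - apply L3; auto.
    - destruct (L3 x H0) as (_ & i & _ & E). exists (k0 + Z.of_nat i)%Z. exact E. }
  induction n as [| n IH]; intros Hn.
  - exists nil. split; [constructor | split; [auto | intros x []]].
  - destruct IH as (l & L1 & L2 & L3); [lia |].
    assert (Hab' : a < b).
    { destruct (Req_dec a b) as [-> | N']; [| lra].
      assert (P := Y0 n). assert (P' := Y1 n Hn). lra. }
    destruct (IVT_interv (fun t => phi t - y n) a b) as [x [X1 X2]]; auto.
    + intros t Ht. apply continuity_pt_minus; [auto |].
      apply continuity_pt_const. intros ? ?; reflexivity.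
    + assert (P := Y0 n). lra.
    + assert (P := Y1 n Hn). lra.
    + exists (x :: l). split; [| split; [simpl; congruence |]].
      * constructor; auto. intros I. destruct (L3 x I) as (_ & i & Hi & E).
        assert (Eyy : y n = y i) by lra. rewrite !Ey in Eyy.
        assert (INR i < INR n) by (apply lt_INR; auto). nra.
      * intros z [<- | I].
        -- split; [auto |]. exists n. split; [lia | lra].
        -- destruct (L3 z I) as (Z1 & i & Hi & E). split; [auto |]. exists i. split; [lia | auto].
Qed.

Lemma crossings (phi : R -> R) a b alpha N : a <= b ->
  (forall t, a <= t <= b -> continuity_pt phi t) -> (INR N + 1) * PI < Rabs (phi b - phi a) ->
  exists l, NoDup l /\ length l = N /\
    forall x, In x l -> a <= x <= b /\ exists k : Z, phi x = IZR k * PI + alpha.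
Proof.
  intros Hab HC HL. unfold Rabs in HL. destruct (Rcase_abs (phi b - phi a)) as [l | g].
  - destruct (increasing_crossings (fun t => - phi t) a b (- alpha) N) as (L & L1 & L2 & L3); auto.
    + intros t Ht. apply (continuity_pt_opp phi), HC, Ht.
    + lra.
    + exists L. split; [auto | split; [auto |]]. intros x Hx. destruct (L3 x Hx) as (X & k & E).
      split; [auto |]. exists (- k)%Z. rewrite opp_IZR. lra.
  - apply increasing_crossings; auto.
Qed.

Lemma cdiff_conj (g : C -> C) z : cdiff g (Cconj z) -> cdiff (fun w => Cconj (g (Cconj w))) z.
Proof.
  intros (s & Hs & E). exists (fun w => Cconj (s (Cconj w))). split.
  - intros e He. destruct (Hs e He) as (d & D & K). exists d; split; [auto |]. intros w Hw.
    rewrite <- Cminus_conj, Cmod_conj. apply K. rewrite <- Cminus_conj, Cmod_conj. exact Hw.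
  - intros w. rewrite (E (Cconj w)), Cplus_conj, Cmult_conj, Cminus_conj, !Cconj_conj. reflexivity.
Qed.

Lemma sq_conj r z : sq 0 r z -> sq 0 r (Cconj z).
Proof. intros [? ?]; split; simpl in *; lra. Qed.

(* If the argument of [g] turned a lot along a real segment, [Re g] and [Im g] would have many
   zeros on it; these are also zeros of the holomorphic functions that extend [Re g] and [Im g]
   from the real axis by reflection, which would make [g] small. *)
Lemma Inc_bound_real_axis s mu : 0 < s -> 0 < mu -> exists N : nat, forall g : C -> C,
  (forall z, sq 0 s z -> cdiff g z) -> (forall z, sq 0 s z -> Cmod (g z) <= 2) ->
  (exists z, sq 0 (s / 20) z /\ mu < Cmod (g z)) ->
  forall th, Inc (fun x => g (RtoC x)) 0 (s / 10) th -> Rabs th <= (INR N + 1) * PI.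
Proof.
  intros Hs Hm.
  destruct (halving_lt 24 ((mu / 2) ^ 2)) as [N HN]; [lra | apply pow_lt; lra |].
  specialize (HN N (le_n N)). exists N. intros g Dg Bg (z0 & Sz0 & Hz0) th [_ (phi & Lp & ->)].
  apply Rnot_lt_le. intros HL.
  set (H0 := fun w => ((g w + Cconj (g (Cconj w))) * RtoC (/ 2))%C).
  set (H1 := fun w => ((g w - Cconj (g (Cconj w))) * (- Ci * RtoC (/ 2)))%C).
  (* [alpha] is [PI / 2] for [H0], at zeros of the cosine, and [0] for [H1], at zeros of the sine.
     Since [g = H0 + Ci * H1] also off the axis, the bound [mu / 2] for both contradicts the size of
     [g z0]. The 24 above is [6 * 2 ^ 2]. *)
  assert (Small : forall (h : C -> C) (alpha : R),
    (forall w, sq 0 s w -> cdiff h w) -> (forall w, sq 0 s w -> Cmod (h w) <= 2) ->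
    (forall x k, 0 <= x <= s / 10 -> phi x = IZR k * PI + alpha -> h (RtoC x) = 0%C) ->
    Cmod (h z0) <= mu / 2).
  { intros h alpha Dh Bh Zh.
    destruct (crossings phi 0 (s / 10) alpha N) as (l & L1 & L2 & L3); [lra | | auto |].
    { intros t Ht. apply Lp, Ht. }
    assert (B := many_zeros_small h s 2 (map RtoC l) Hs Dh Bh).
    assert (Bz : Cmod (h z0) ^ 2 <= 6 * 2 ^ 2 / 2 ^ length (map RtoC l)).
    { apply B.
      - apply FinFun.Injective_map_NoDup; [intros x y; apply RtoC_inj | auto].
      - intros c Hc. apply in_map_iff in Hc. destruct Hc as (x & <- & Hx).
        destruct (L3 x Hx) as (X & k & E). split; [split; simpl; lra | eapply Zh; eauto].
      - apply (sq_mono _ (s / 20)); [lra | auto]. }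
    rewrite length_map, L2 in Bz. replace (6 * 2 ^ 2) with 24 in Bz by ring.
    apply sq_le_le; lra. }
  assert (Half : Cmod (RtoC (/ 2)) = / 2) by (rewrite Cmod_R, Rabs_pos_eq; lra).
  assert (Bc : forall w, sq 0 s w -> Cmod (Cconj (g (Cconj w))) <= 2).
  { intros w Hw. rewrite Cmod_conj. apply Bg, sq_conj, Hw. }
  assert (S0 : Cmod (H0 z0) <= mu / 2).
  { apply (Small H0 (PI / 2)).
    - intros w Hw. apply cdiff_mult; [| apply cdiff_const].
      apply cdiff_plus; [auto | apply cdiff_conj, Dg, sq_conj, Hw].
    - intros w Hw. unfold H0. rewrite Cmod_mult, Half.
      assert (T := Cmod_triangle (g w) (Cconj (g (Cconj w)))).
      specialize (Bg w Hw). specialize (Bc w Hw). lra.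
    - intros x k Hx E. destruct (Lp x Hx) as (_ & _ & P). unfold H0.
      replace (Cconj (RtoC x)) with (RtoC x) by (apply injective_projections; simpl; ring).
      rewrite P. apply injective_projections; simpl; [| ring].
      rewrite (cos_eq_0_1 (phi x)) by (exists k; auto). ring. }
  assert (S1 : Cmod (H1 z0) <= mu / 2).
  { apply (Small H1 0).
    - intros w Hw. apply cdiff_mult; [| apply cdiff_const].
      apply cdiff_minus; [auto | apply cdiff_conj, Dg, sq_conj, Hw].
    - intros w Hw. unfold H1. rewrite !Cmod_mult, Cmod_opp, Cmod_Ci, Half.
      assert (T := Cmod_triangle (g w) (- Cconj (g (Cconj w)))). rewrite Cmod_opp in T.
      change (g w + - Cconj (g (Cconj w)))%C with (g w - Cconj (g (Cconj w)))%C in T.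
      specialize (Bg w Hw). specialize (Bc w Hw). lra.
    - intros x k Hx E. destruct (Lp x Hx) as (_ & _ & P). unfold H1.
      replace (Cconj (RtoC x)) with (RtoC x) by (apply injective_projections; simpl; ring).
      rewrite P. apply injective_projections; simpl; [| ring].
      rewrite (sin_eq_0_1 (phi x)) by (exists k; lra). ring. }
  assert (E : g z0 = (H0 z0 + Ci * H1 z0)%C).
  { unfold H0, H1. apply injective_projections; simpl; field. }
  assert (T := Cmod_triangle (H0 z0) (Ci * H1 z0)). rewrite <- E, Cmod_mult, Cmod_Ci in T. lra.
Qed.

Lemma Inc_shift w c a b th : Inc w a b th -> Inc (fun t => w (t + c)) (a - c) (b - c) th.
Proof.
  intros [Hab (phi & Lp & ->)]. split; [lra |]. exists (fun t => phi (t + c)). split.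
  - intros t Ht. destruct (Lp (t + c)) as (P1 & P2 & P3); [lra |]. split; [| split; auto].
    apply (continuity_pt_comp (fun t => t + c) phi); [| exact P1].
    apply continuity_pt_plus; [apply derivable_continuous_pt, derivable_pt_id |].
    apply continuity_pt_const. intros ? ?; reflexivity.
  - f_equal; f_equal; ring.
Qed.

Lemma Inc_oinv (f : C -> option C) (p : R -> C) a b th :
  (forall s, a <= s <= b -> has_order f (p s) 0) ->
  Inc (fun s => fin f (p s)) a b th -> Inc (fun s => fin (finv f) (p s)) a b (- th).
Proof.
  intros H I. apply Inc_inv in I. eapply Inc_ext; [| exact I]. intros s Hs. simpl.
  destruct (order_0 f (p s) (H s Hs)) as (_ & E & N).
  unfold fin at 2, finv. rewrite E, oinv_fin by auto. reflexivity.
Qed.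

(** On the square around the starting point [f] or its inverse is bounded by 2, and their increments
    differ only in sign. The bound on the crossings depends on [s] and [mu] alone, so it is the same
    for all segments. *)
Lemma Inc_bound_segment (f : C -> option C) : almost_elliptic f -> exists ell B, 0 < ell /\ 0 <= B /\
  forall (k w : C), k = RtoC 1 \/ k = Ci ->
    (forall s, 0 <= s <= ell -> has_order f (k * RtoC s + w)%C 0) ->
    forall th, Inc (fun s => fin f (k * RtoC s + w)%C) 0 ell th -> Rabs th <= B.
Proof.
  intros AE. assert (AEi := almost_elliptic_finv f AE).
  destruct (bounded_or_inverse_bounded f AE) as (s & Hs & Alt).
  assert (Alti : dichotomy (finv f) s).
  { intros w. destruct (Alt w) as [H | H]; [right | left; auto].
    intros z Hz. destruct (H z Hz) as (u & E & Hu). exists u; split; [| auto].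
    unfold finv. rewrite oinv_involutive. exact E. }
  assert (Main : forall h, almost_elliptic h ->
    dichotomy h s ->
    exists N : nat, forall (k w : C), k = RtoC 1 \/ k = Ci -> bounded_on h 2 (sq w s) ->
    forall th, Inc (fun s => fin h (k * RtoC s + w)%C) 0 (s / 10) th -> Rabs th <= (INR N + 1) * PI).
  { intros h AEh Ah. destruct (nondegenerate h s AEh Hs Ah) as (mu & M0 & ND).
    destruct (Inc_bound_real_axis s mu Hs M0) as (N & HN). exists N. intros k w Hk B th Hth.
    destruct (nondegenerate_chart h k w s mu AEh Hs Hk B (ND w)) as [Ch Ex].
    apply (HN (fun z => fin h (k * z + w)%C)); auto; intros z Hz; apply Ch, Hz. }
  destruct (Main f AE Alt) as (N1 & B1), (Main (finv f) AEi Alti) as (N2 & B2).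
  assert (PP := PI_RGT_0). assert (P1 := pos_INR N1). assert (P2 := pos_INR N2).
  exists (s / 10), ((INR N1 + 1) * PI + (INR N2 + 1) * PI).
  split; [lra | split; [nra |]]. intros k w Hk HO th Hth.
  destruct (Alt w) as [H | H].
  - specialize (B1 k w Hk H th Hth). nra.
  - assert (I := Inc_oinv f (fun s => k * RtoC s + w)%C _ _ _ HO Hth).
    specialize (B2 k w Hk H _ I). rewrite Rabs_Ropp in B2. nra.
Qed.

(** Without zeros the inverse of [f] is entire. It is also bounded: where [dichotomy] bounds [f]
    instead, [minimum_modulus] gives a contour around [w] on which the inverse is at most [/ eta],
    and [Cauchy_estimate] carries this to [w]. Liouville's theorem contradicts nonconstancy. *)
Lemma almost_elliptic_has_zero (f : C -> option C) : almost_elliptic f ->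
  exists a m, has_order f a m /\ (0 < m)%Z.
Proof.
  intros AE. apply NNPP. intros NZ.
  assert (AEi := almost_elliptic_finv f AE). set (g := finv f) in *.
  assert (Fin : forall z, g z = Some (fin g z)).
  { intros z. destruct (proj1 AEi z) as [n Hn]. apply (order_nonneg g z n Hn).
    apply Z.nlt_ge. intros L. apply NZ. destruct (proj1 AE z) as [m Hm]. exists z, m. split; [auto |].
    assert (n = (- m)%Z) by (eapply order_unique; [exact Hn | apply order_finv, Hm]). lia. }
  assert (Dg : forall z, cdiff (fin g) z) by (intros z; apply (fin_cdiff g z _ (proj1 AEi) (Fin z))).
  destruct (bounded_or_inverse_bounded f AE) as (s & Hs & Alt).
  destruct (nondegenerate f s AE Hs Alt) as (mu & M0 & ND).
  destruct (minimum_modulus s mu Hs M0) as (eta & E0 & HE).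
  assert (Ie : 0 < / eta) by (apply Rinv_0_lt_compat, E0).
  assert (Bd : forall w, Cmod (fin g w) <= 2 + 6 * / eta).
  { intros w. destruct (Alt w) as [B | B].
    - destruct (nondegenerate_chart f 1 w s mu AE Hs (or_introl eq_refl) B (ND w)) as [Ch (z0 & Z1 & Z2)].
      destruct (HE (fun z => fin f (1 * z + w)%C)) as (r & Hr & Hb).
      + intros z Hz. apply Ch, Hz.
      + intros z Hz. apply Ch, Hz.
      + exists z0. split; [apply (sq_mono _ (s / 20)); [lra | auto] | auto].
      + assert (E := Cauchy_estimate (fun z => fin g (1 * z + w)%C) (RtoC 0) r (/ eta)).
        specialize (E (proj1 Hr) (fun z _ => cdiff_affine_comp (fin g) 1 w z (Dg _))).
        assert (Q : Cmod (fin g (1 * RtoC 0 + w)%C) <= 6 * / eta).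
        { apply E; [| split; simpl; lra]. intros z Hz. specialize (Hb z Hz). cbv beta in *.
          set (p := (1 * z + w)%C) in *. unfold g, finv, fin in *.
          destruct (f p) as [u |]; [| rewrite Cmod_0 in Hb; lra].
          assert (Nu : u <> 0%C) by (apply Cmod_gt_0; lra).
          rewrite oinv_fin, Cmod_inv by auto. apply Rinv_le_contravar; lra. }
        replace (1 * RtoC 0 + w)%C with w in Q by ring. lra.
    - destruct (B w) as (u & Eu & Hu); [apply sq_of_Cmod; rewrite Cmod_sub_diag; lra |].
      destruct (fin_cdiff g w u (proj1 AEi) Eu) as [_ ->]. lra. }
  destruct (proj1 (proj2 AE)) as (z1 & z2 & N). apply N.
  rewrite <- (oinv_involutive (f z1)), <- (oinv_involutive (f z2)).
  change (oinv (f z1)) with (g z1). change (oinv (f z2)) with (g z2).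
  rewrite (Fin z1), (Fin z2), (Liouville (fin g) _ Dg Bd z1 z2). reflexivity.
Qed.

(** A form of Hurwitz's theorem. On a small contour around a zero [a] the modulus is at least [mu].
    A close translate [h] without zeros inside would have [/ h] bounded at [a] by the values on the
    contour, yet [h a] is close to 0. *)
Lemma zeros_recur (f : C -> option C) : almost_elliptic f ->
  exists K, 0 < K /\ forall w : C, exists p m, Cmod (p - w) < K /\ has_order f p m /\ (0 < m)%Z.
Proof.
  intros AE. destruct (almost_elliptic_has_zero f AE) as (a & m & Hm & Pm).
  assert (Fa : f a = Some (RtoC 0)) by (apply (order_values f a m Hm), Pm).
  destruct (locally_bounded f a 1 (proj1 AE)) as (r1 & R1 & B1).
  { exists (RtoC 0). split; [auto | rewrite Cmod_0; lra]. }
  assert (Hm' := Hm). apply has_order_iff in Hm'. destruct Hm' as (r2 & R2 & g & G1 & G2 & G3 & _).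
  assert (Cg : ccont g a) by (apply cdiff_ccont, G1; rewrite Cmod_sub_diag; auto).
  assert (Pg : 0 < Cmod (g a)) by (apply Cmod_gt_0, G2).
  destruct (Cg (Cmod (g a) / 2)) as (r3 & R3 & G4); [lra |].
  destruct (pos_min r1 r2 R1 R2) as (r4 & R4 & R5 & R6).
  destruct (pos_min r3 r4 R3 R4) as (r5 & R7 & R8 & R9).
  set (r := r5 / 4). assert (Hr : 0 < r) by (unfold r; lra).
  set (n := Z.to_nat m).
  set (mu := r ^ n * (Cmod (g a) / 2)).
  assert (Prn : 0 < r ^ n) by (apply pow_lt, Hr).
  assert (Hmu : 0 < mu) by (apply Rmult_lt_0_compat; lra).
  assert (Bf : forall z, sq a r z -> exists u, f z = Some u /\ Cmod u <= 1).
  { intros z Hz. apply B1. apply sq_Cmod in Hz. unfold r in Hz. lra. }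
  assert (Low : forall z, bdry (fst a - r) (fst a + r) (snd a - r) (snd a + r) z -> mu <= Cmod (fin f z)).
  { intros z Hz. assert (L := sq_Cmod a r z (proj1 Hz)).
    assert (Far : r <= Cmod (z - a)) by (apply (bdry_square_far a r); [auto | auto | split; lra]).
    unfold r in L. unfold fin. rewrite G3 by lra. rewrite Cmod_mult.
    replace (zpow (z - a) m) with ((z - a) ^ n)%C by (rewrite <- zpow_of_nat; unfold n; rewrite Z2Nat.id by lia; auto).
    rewrite Cmod_pow. apply Rmult_le_compat; [lra | lra | apply pow_incr; lra |].
    specialize (G4 z ltac:(lra)). assert (Lo := Cmod_lower (g z) (g a)). lra. }
  (* On the contour [/ h] is at most [2 / mu], so [Cauchy_estimate] gives [12 / mu] at [a]; any
     divisor above 12 leads to the contradiction. *)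
  destruct (rho_close 1 (mu / 13)) as (eps & E0 & EC); [lra | lra |].
  destruct (almost_elliptic_recentre f AE eps E0) as (L & HL & HR).
  assert (Pa := Cmod_ge_0 a).
  exists (Cmod a + 2 * r + L). split; [lra |]. intros w. destruct (HR w) as (u & U0 & U1).
  set (c := (w - u)%C).
  assert (Near : forall z, sq a r z -> exists v, f (1 * z + c)%C = Some v /\ Cmod (v - fin f z) < mu / 13).
  { intros z Hz. destruct (Bf z Hz) as (v & Ev & Hv). specialize (U1 (z - u)%C).
    replace (z - u + u)%C with z in U1 by ring. rewrite Ev in U1.
    replace (z - u + w)%C with (1 * z + c)%C in U1 by (unfold c; ring).
    destruct (EC v _ Hv U1) as (v' & Ev' & Hv'). exists v'. split; [auto |].
    destruct (fin_cdiff f z v (proj1 AE) Ev) as [_ ->]. exact Hv'. }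
  assert (Ex : exists z, sq a r z /\ f (1 * z + c)%C = Some (RtoC 0)).
  { apply NNPP. intros NE. set (h := fun z => fin f (1 * z + c)%C).
    assert (Hh : forall z, sq a r z -> cdiff h z /\ h z <> 0%C /\ Cmod (h z - fin f z) < mu / 13).
    { intros z Hz. destruct (Near z Hz) as (v & Ev & Hv).
      destruct (fin_cdiff f _ v (proj1 AE) Ev) as [D E]. unfold h. rewrite E.
      split; [apply cdiff_affine_comp, D | split; [| auto]].
      intros ->. apply NE. exists z; auto. }
    assert (Sa : sq a r a) by (apply sq_of_Cmod; rewrite Cmod_sub_diag; lra).
    assert (Q : Cmod (/ h a) <= 6 * (2 / mu)).
    { apply (Cauchy_estimate (fun z => / h z)%C a r); auto.
      - intros z Hz. destruct (Hh z Hz) as (D & Nz & _). apply cdiff_inv; auto.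
      - intros z Hz. destruct (Hh z (proj1 Hz)) as (D & Nz & Cz). rewrite Cmod_inv by auto.
        specialize (Low z Hz). assert (Lo := Cmod_lower (h z) (fin f z)).
        replace (2 / mu) with (/ (mu / 2)) by (field; lra). apply Rinv_le_contravar; lra.
      - split; lra. }
    destruct (Hh a Sa) as (_ & Na & Ca). rewrite Cmod_inv in Q by auto.
    assert (Ea : fin f a = 0%C) by (unfold fin; rewrite Fa; auto). rewrite Ea in Ca.
    replace (h a - 0)%C with (h a) in Ca by ring.
    assert (Ph : 0 < Cmod (h a)) by (apply Cmod_gt_0, Na).
    assert (Q1 : / (mu / 13) < / Cmod (h a)) by (apply Rinv_lt_contravar; [nra | auto]).
    replace (/ (mu / 13)) with (13 * / mu) in Q1 by (field; lra).
    replace (6 * (2 / mu)) with (12 * / mu) in Q by (field; lra).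
    assert (0 < / mu) by (apply Rinv_0_lt_compat, Hmu). lra. }
  destruct Ex as (z & Sz & Ez). destruct (proj1 AE (1 * z + c)%C) as [k Hk].
  exists (1 * z + c)%C, k. split; [| split; [auto | apply (order_values f _ k Hk), Ez]].
  replace (1 * z + c - w)%C with ((z - a) + (a + - u))%C by (unfold c; ring).
  assert (T1 := Cmod_triangle (z - a) (a + - u)). assert (T2 := Cmod_triangle a (- u)).
  rewrite Cmod_opp in T2. apply sq_Cmod in Sz. lra.
Qed.

(** * Moving points along a flow *)

Definition zcode (z : Z) : nat := if Z.leb 0 z then Z.to_nat (2 * z) else Z.to_nat (- 2 * z - 1).
Definition zdecode (n : nat) : Z :=
  if Z.eqb (Z.of_nat n mod 2) 0 then (Z.of_nat n / 2)%Z else (- ((Z.of_nat n + 1) / 2))%Z.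

Lemma zdecode_zcode z : zdecode (zcode z) = z.
Proof.
  unfold zdecode, zcode. destruct (Z.leb_spec 0 z).
  - rewrite Z2Nat.id by lia. destruct (Z.eqb_spec ((2 * z) mod 2) 0); Z.div_mod_to_equations; lia.
  - rewrite Z2Nat.id by lia. destruct (Z.eqb_spec ((- 2 * z - 1) mod 2) 0); Z.div_mod_to_equations; lia.
Qed.

Lemma zcode_zdecode n : zcode (zdecode n) = n.
Proof.
  unfold zdecode, zcode. destruct (Z.eqb_spec (Z.of_nat n mod 2) 0).
  - destruct (Z.leb_spec 0 (Z.of_nat n / 2)); Z.div_mod_to_equations; lia.
  - destruct (Z.leb_spec 0 (- ((Z.of_nat n + 1) / 2))); Z.div_mod_to_equations; lia.
Qed.

Definition cell_code (q : Z * Z) : nat := Cantor.to_nat (zcode (fst q), zcode (snd q)).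
Definition cell (n : nat) : Z * Z :=
  let p := Cantor.of_nat n in (zdecode (fst p), zdecode (snd p)).

Lemma cell_cell_code q : cell (cell_code q) = q.
Proof.
  unfold cell, cell_code. rewrite Cantor.cancel_of_to. simpl.
  rewrite !zdecode_zcode. symmetry. apply surjective_pairing.
Qed.

Lemma cell_code_cell n : cell_code (cell n) = n.
Proof.
  unfold cell, cell_code. destruct (Cantor.of_nat n) as [a b] eqn:E. cbn [fst snd].
  rewrite !zcode_zdecode, <- E. apply Cantor.cancel_to_of.
Qed.

(** * Enumeration of a sequence of finite lists *)

Fixpoint sum_below (phi : nat -> nat) (K : nat) : nat :=
  match K with O => O | S k => (sum_below phi k + phi k)%nat end.

Lemma sum_below_plus phi psi K :
  sum_below (fun k => phi k + psi k)%nat K = (sum_below phi K + sum_below psi K)%nat.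
Proof. induction K as [| K IH]; simpl; [reflexivity | rewrite IH; lia]. Qed.

Lemma sum_below_ext phi psi K : (forall k, phi k = psi k) -> sum_below phi K = sum_below psi K.
Proof. intros E. induction K as [| K IH]; simpl; [reflexivity | rewrite IH, E; reflexivity]. Qed.

Lemma sum_below_single phi k1 K : (forall k, k <> k1 -> phi k = 0%nat) -> (k1 < K)%nat ->
  sum_below phi K = phi k1.
Proof.
  intros H. induction K as [| K IH]; intros L; [lia |]. simpl.
  destruct (Nat.eq_dec K k1) as [-> | N].
  - enough (E : forall j, (j <= k1)%nat -> sum_below phi j = 0%nat) by (rewrite E; lia).
    induction j as [| j IHj]; intros Hj; [reflexivity |]. simpl. rewrite IHj, H by lia. reflexivity.
  - rewrite IH, (H K) by lia. lia.
Qed.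

(** Only one term of the sum is nonzero; [K] has to exceed the code of the cell that is shifted to
    [q0]. *)
Lemma sum_below_cells (c : Z * Z -> nat) (q0 : Z * Z) (shift unshift : Z * Z -> Z * Z) :
  (forall q, q <> q0 -> c q = 0%nat) -> (forall q, unshift (shift q) = q) -> shift (unshift q0) = q0 ->
  forall K, (cell_code (unshift q0) < K)%nat -> sum_below (fun k => c (shift (cell k))) K = c q0.
Proof.
  intros H U S0 K HK. rewrite (sum_below_single _ (cell_code (unshift q0))); auto.
  - rewrite cell_cell_code, S0. reflexivity.
  - intros k N. apply H. intros E. apply N. rewrite <- E, U. symmetry. apply cell_code_cell.
Qed.

Definition flat {X : Type} (LL : nat -> list X) (K : nat) : list X := concat (map LL (seq 0 K)).

Lemma flat_S (X : Type) (LL : nat -> list X) K : flat LL (S K) = flat LL K ++ LL K.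
Proof.
  unfold flat. rewrite seq_S, map_app, concat_app. simpl. rewrite app_nil_r. reflexivity.
Qed.

Lemma flat_prefix (X : Type) (LL : nat -> list X) K d : exists R, flat LL (K + d) = flat LL K ++ R.
Proof.
  induction d as [| d [R E]].
  - exists nil. rewrite Nat.add_0_r, app_nil_r. reflexivity.
  - rewrite Nat.add_succ_r, flat_S, E. exists (R ++ LL (K + d)%nat). rewrite app_assoc. reflexivity.
Qed.

Lemma flat_length (X : Type) (LL : nat -> list X) : (forall k, LL k <> nil) ->
  forall K, (K <= length (flat LL K))%nat.
Proof.
  intros H. induction K as [| K IH]; [lia |]. rewrite flat_S, length_app.
  specialize (H K). destruct (LL K); [congruence |]. simpl. lia.
Qed.

(** The infinite concatenation of the lists. If none is empty, the first [S n] of them have more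
    than [n] elements, so the default [d] is never returned. *)
Definition flat_seq {X : Type} (d : X) (LL : nat -> list X) (n : nat) : X := nth n (flat LL (S n)) d.

Lemma flat_seq_nth (X : Type) (d : X) (LL : nat -> list X) : (forall k, LL k <> nil) ->
  forall K n, (n < length (flat LL K))%nat -> nth n (flat LL K) d = flat_seq d LL n.
Proof.
  intros H K n Hn. unfold flat_seq. assert (L := flat_length X LL H (S n)).
  destruct (Nat.le_ge_cases K (S n)) as [E | E].
  - replace (S n) with (K + (S n - K))%nat by lia. destruct (flat_prefix X LL K (S n - K)) as [R ->].
    rewrite app_nth1; auto.
  - replace K with (S n + (K - S n))%nat by lia. destruct (flat_prefix X LL (S n) (K - S n)) as [R ->].
    rewrite app_nth1 by lia. reflexivity.
Qed.

Lemma flat_seq_In (X : Type) (d : X) (LL : nat -> list X) : (forall k, LL k <> nil) ->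
  forall n, exists k, In (flat_seq d LL n) (LL k).
Proof.
  intros H n. assert (I : In (flat_seq d LL n) (flat LL (S n))).
  { apply nth_In. apply (flat_length X LL H (S n)). }
  unfold flat in I. apply in_concat in I. destruct I as (l & L1 & L2).
  apply in_map_iff in L1. destruct L1 as (k & <- & _). exists k; auto.
Qed.

Lemma count_occ_flat (X : Type) (LL : nat -> list X) (g : X -> C) w K :
  count_occ Ceq_dec (map g (flat LL K)) w = sum_below (fun k => count_occ Ceq_dec (map g (LL k)) w) K.
Proof.
  induction K as [| K IH]; [reflexivity |]. rewrite flat_S, map_app, count_occ_app, IH. reflexivity.
Qed.

Lemma length_filter_count (s : nat -> C) (w : C) (l : list nat) :
  length (filter (fun n => if Ceq_dec (s n) w then true else false) l) = count_occ Ceq_dec (map s l) w.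
Proof.
  induction l as [| n l IH]; [reflexivity |]. simpl. destruct (Ceq_dec (s n) w); simpl; congruence.
Qed.

(** The number of occurrences in the first [K] lists is constant from [K0] on, so all occurrences
    lie in the first [K0] lists: a later one would raise the count. *)
Lemma flat_seq_occurs (X : Type) (d : X) (LL : nat -> list X) (g : X -> C) (w : C) (k K0 : nat) :
  (forall j, LL j <> nil) ->
  (forall K, (K0 <= K)%nat -> sum_below (fun j => count_occ Ceq_dec (map g (LL j)) w) K = k) ->
  occurs_exactly (fun n => g (flat_seq d LL n)) w k.
Proof.
  intros NE HK. set (s := fun n => g (flat_seq d LL n)).
  assert (Cnt : forall K, (K0 <= K)%nat ->
    count_occ Ceq_dec (map s (seq 0 (length (flat LL K)))) w = k).
  { intros K L. rewrite <- (HK K L), <- count_occ_flat. f_equal.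
    apply nth_ext with (d := s 0%nat) (d' := g d).
    - rewrite !length_map, length_seq. reflexivity.
    - intros n Hn. rewrite length_map, length_seq in Hn.
      rewrite map_nth. rewrite (map_nth g). rewrite seq_nth, flat_seq_nth by auto. reflexivity. }
  set (N := length (flat LL K0)).
  exists (filter (fun n => if Ceq_dec (s n) w then true else false) (seq 0 N)).
  split; [apply NoDup_filter, seq_NoDup | split].
  - intros n. rewrite filter_In, in_seq. destruct (Ceq_dec (s n) w) as [E | E].
    2: { split; [intros [_ F]; discriminate | intros F; contradiction]. }
    split; [auto |]. intros _. split; [| auto]. split; [lia |]. simpl.
    apply Nat.nle_gt. intros L. set (K := (K0 + S n)%nat).
    assert (LK := flat_length X LL NE K).
    assert (C1 := Cnt K ltac:(unfold K; lia)). assert (C0 := Cnt K0 (le_n _)). fold N in C0.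
    destruct (flat_prefix X LL K0 (S n)) as [R ER]. fold K in ER.
    assert (LR : (length (flat LL K) = N + length R)%nat) by (rewrite ER, length_app; reflexivity).
    rewrite LR, seq_app, map_app, count_occ_app, C0 in C1.
    assert (Z : count_occ Ceq_dec (map s (seq (0 + N) (length R))) w = 0%nat) by lia.
    apply (count_occ_not_In Ceq_dec) in Z. apply Z. apply in_map_iff. exists n. split; [auto |].
    apply in_seq. assert (LN : (n < K)%nat) by (unfold K; lia). lia.
  - rewrite length_filter_count. apply Cnt. lia.
Qed.

Definition near (q q' : Z * Z) : Prop :=
  (Z.abs (fst q - fst q') <= 1)%Z /\ (Z.abs (snd q - snd q') <= 1)%Z.

Lemma split_five (A : Type) (l : list A) (n1 n2 n3 n4 : nat) : (n1 + n2 + n3 + n4 <= length l)%nat ->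
  exists l1 l2 l3 l4 l5, l = l1 ++ l2 ++ l3 ++ l4 ++ l5 /\
    length l1 = n1 /\ length l2 = n2 /\ length l3 = n3 /\ length l4 = n4.
Proof.
  intros L.
  exists (firstn n1 l), (firstn n2 (skipn n1 l)), (firstn n3 (skipn n2 (skipn n1 l))),
    (firstn n4 (skipn n3 (skipn n2 (skipn n1 l)))), (skipn n4 (skipn n3 (skipn n2 (skipn n1 l)))).
  rewrite !firstn_skipn. split; [reflexivity |].
  repeat split; apply firstn_length_le; rewrite ?length_skipn; lia.
Qed.

Lemma map_combine (A B : Type) (l : list A) (l' : list B) : length l = length l' ->
  map fst (combine l l') = l /\ map snd (combine l l') = l'.
Proof.
  revert l'. induction l as [| x l IH]; intros [| y l'] E; try discriminate; auto.
  injection E as E. destruct (IH l' E) as [E1 E2]. simpl. rewrite E1, E2. auto.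
Qed.

(* [H i j] and [V i j] are the flows through the bottom and the left side of the cell [(i, j)].
   Every cell holds more points than its total outflow, so one point can be moved to the adjacent
   cell for each unit of flow, after which both families have equally many points in each cell. *)
Lemma transport_along_flow (Zl Pl : Z * Z -> list C) (H V : Z -> Z -> Z) (N : nat) :
  (forall i j, Z.abs (H i j) <= Z.of_nat N)%Z ->
  (forall i j, Z.abs (V i j) <= Z.of_nat N)%Z ->
  (forall i j, Z.of_nat (length (Zl (i, j))) - Z.of_nat (length (Pl (i, j)))
    = H i j + V (i + 1) j - H i (j + 1) - V i j)%Z ->
  (forall q, (4 * N + 1 <= length (Zl q))%nat) ->
  exists a b : nat -> C,
    (forall w q0, (forall q, q <> q0 -> ~ In w (Zl q) /\ ~ In w (Pl q)) ->
       occurs_exactly a w (count_occ Ceq_dec (Zl q0) w) /\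
       occurs_exactly b w (count_occ Ceq_dec (Pl q0) w)) /\
    (forall n, exists q q', near q q' /\ In (a n) (Zl q) /\ In (b n) (Pl q')).
Proof.
  intros HB VB Div Big.
  (* The divergence formula counts [V] positive to the right and [H] positive downwards. [Z.to_nat]
     of a flow and of its negative separates the two directions, so at most [4 * N] points leave a
     cell. *)
  assert (Sp : forall q, exists p : (list C * list C) * (list C * list C) * list C,
    let '(r, l, (u, d), s) := p in
    Zl q = r ++ l ++ u ++ d ++ s /\
    length r = Z.to_nat (V (fst q + 1) (snd q))%Z /\
    length l = Z.to_nat (- V (fst q) (snd q)) /\
    length u = Z.to_nat (- H (fst q) (snd q + 1))%Z /\
    length d = Z.to_nat (H (fst q) (snd q))).
  { intros [i j]. cbn [fst snd].
    assert (B1 := HB i j). assert (B2 := HB i (j + 1)%Z).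
    assert (B3 := VB i j). assert (B4 := VB (i + 1)%Z j). specialize (Big (i, j)).
    destruct (split_five _ (Zl (i, j)) (Z.to_nat (V (i + 1) j)%Z) (Z.to_nat (- V i j))
      (Z.to_nat (- H i (j + 1))%Z) (Z.to_nat (H i j))) as (r & l & u & d & s & E & L); [lia |].
    exists (r, l, (u, d), s). tauto. }
  destruct (choice _ Sp) as [F HF].
  set (right := fun q => let '(r, l, (u, d), s) := F q in r).
  set (left := fun q => let '(r, l, (u, d), s) := F q in l).
  set (up := fun q => let '(r, l, (u, d), s) := F q in u).
  set (down := fun q => let '(r, l, (u, d), s) := F q in d).
  set (stay := fun q => let '(r, l, (u, d), s) := F q in s).
  assert (HF' : forall q, Zl q = right q ++ left q ++ up q ++ down q ++ stay q /\
    length (right q) = Z.to_nat (V (fst q + 1) (snd q))%Z /\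
    length (left q) = Z.to_nat (- V (fst q) (snd q)) /\
    length (up q) = Z.to_nat (- H (fst q) (snd q + 1))%Z /\
    length (down q) = Z.to_nat (H (fst q) (snd q))).
  { intros q. specialize (HF q). unfold right, left, up, down, stay.
    destruct (F q) as [[[r l] [u d]] s]. exact HF. }
  clearbody right left up down stay. clear F HF Sp.
  set (shift := fun di dj (q : Z * Z) => (fst q + di, snd q + dj)%Z).
  (* The points found in [q] after the move: those that stay, and those sent from the left, right,
     lower and upper neighbour, in this order. *)
  set (Al := fun q => stay q ++ right (shift (-1)%Z 0%Z q) ++ left (shift 1%Z 0%Z q)
    ++ up (shift 0%Z (-1)%Z q) ++ down (shift 0%Z 1%Z q)).
  assert (LA : forall q, length (Al q) = length (Pl q) /\ stay q <> nil).
  { intros [i j]. destruct (HF' (i, j)) as (E & L1 & L2 & L3 & L4).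
    assert (LZ : length (Zl (i, j)) = (length (right (i, j)) + (length (left (i, j)) +
      (length (up (i, j)) + (length (down (i, j)) + length (stay (i, j))))))%nat)
      by (rewrite E at 1; rewrite !length_app; reflexivity).
    assert (B1 := HB i j). assert (B2 := HB i (j + 1)%Z).
    assert (B3 := VB i j). assert (B4 := VB (i + 1)%Z j). specialize (Big (i, j)). specialize (Div i j).
    cbn [fst snd] in *. split.
    - unfold Al. rewrite !length_app.
      destruct (HF' (shift (-1)%Z 0%Z (i, j))) as (_ & M1 & _).
      destruct (HF' (shift 1%Z 0%Z (i, j))) as (_ & _ & M2 & _).
      destruct (HF' (shift 0%Z (-1)%Z (i, j))) as (_ & _ & _ & M3 & _).
      destruct (HF' (shift 0%Z 1%Z (i, j))) as (_ & _ & _ & _ & M4).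
      rewrite M1, M2, M3, M4. unfold shift; cbn [fst snd].
      replace (i + -1 + 1)%Z with i by lia. replace (j + -1 + 1)%Z with j by lia.
      replace (i + 0)%Z with i by lia. replace (j + 0)%Z with j by lia. lia.
    - intros E0. rewrite E0 in LZ. simpl in LZ. lia. }
  set (LL := fun k => combine (Al (cell k)) (Pl (cell k))).
  assert (Fst : forall k, map fst (LL k) = Al (cell k)) by (intros k; apply map_combine, LA).
  assert (Snd : forall k, map snd (LL k) = Pl (cell k)) by (intros k; apply map_combine, LA).
  (* This is the reason for the [+ 1] in the bound [4 * N + 1]: at least one point of each cell
     stays. *)
  assert (NE : forall k, LL k <> nil).
  { intros k E. destruct (LA (cell k)) as [_ S]. assert (M := Fst k). rewrite E in M. simpl in M.
    unfold Al in M. symmetry in M. apply app_eq_nil in M. tauto. }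
  set (d0 := (RtoC 0, RtoC 0)).
  exists (fun n => fst (flat_seq d0 LL n)), (fun n => snd (flat_seq d0 LL n)). split.
  - intros w q0 Hw.
    assert (ZC : forall q, q <> q0 -> count_occ Ceq_dec (Zl q) w = 0%nat /\ count_occ Ceq_dec (Pl q) w = 0%nat).
    { intros q N'. destruct (Hw q N') as [N1 N2].
      split; apply (count_occ_not_In Ceq_dec); auto. }
    assert (Cnt : forall q, count_occ Ceq_dec (Zl q) w = (count_occ Ceq_dec (right q) w +
      (count_occ Ceq_dec (left q) w + (count_occ Ceq_dec (up q) w +
      (count_occ Ceq_dec (down q) w + count_occ Ceq_dec (stay q) w))))%nat).
    { intros q. destruct (HF' q) as [E _]. rewrite E at 1. rewrite !count_occ_app. reflexivity. }
    assert (SU : forall di dj q, shift di dj (shift (- di) (- dj) q)%Z = q /\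
      shift (- di)%Z (- dj)%Z (shift di dj q) = q).
    { intros di dj [i j]. unfold shift; cbn [fst snd]. split; f_equal; lia. }
    assert (Sum : forall (c : Z * Z -> nat) di dj K, (forall q, q <> q0 -> c q = 0%nat) ->
      (cell_code (shift (- di) (- dj) q0)%Z < K)%nat ->
      sum_below (fun k => c (shift di dj (cell k))) K = c q0).
    { intros c di dj K Hc HK. apply (sum_below_cells c q0 (shift di dj) (shift (- di) (- dj))%Z); auto.
      - intros q. apply SU.
      - apply SU. }
    assert (Id : forall q, shift 0%Z 0%Z q = q).
    { intros [i j]. unfold shift; cbn [fst snd]. f_equal; lia. }
    (* A point of [Zl q0] ends in [q0] or in one of the four neighbours, so it is met before
       [K0]. *)
    set (K0 := S (cell_code q0 + cell_code (shift 1%Z 0%Z q0) + cell_code (shift (-1)%Z 0%Z q0) +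
      cell_code (shift 0%Z 1%Z q0) + cell_code (shift 0%Z (-1)%Z q0))%nat).
    split.
    + apply (flat_seq_occurs _ d0 LL fst w _ K0 NE). intros K HK.
      rewrite (sum_below_ext _ (fun k => count_occ Ceq_dec (stay (shift 0%Z 0%Z (cell k))) w +
        (count_occ Ceq_dec (right (shift (-1)%Z 0%Z (cell k))) w +
        (count_occ Ceq_dec (left (shift 1%Z 0%Z (cell k))) w +
        (count_occ Ceq_dec (up (shift 0%Z (-1)%Z (cell k))) w +
         count_occ Ceq_dec (down (shift 0%Z 1%Z (cell k))) w))))%nat).
      2: { intros k. rewrite Fst. unfold Al. rewrite !count_occ_app, Id. reflexivity. }
      rewrite !sum_below_plus.
      rewrite (Sum (fun q => count_occ Ceq_dec (stay q) w) 0%Z 0%Z),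
        (Sum (fun q => count_occ Ceq_dec (right q) w) (-1)%Z 0%Z),
        (Sum (fun q => count_occ Ceq_dec (left q) w) 1%Z 0%Z),
        (Sum (fun q => count_occ Ceq_dec (up q) w) 0%Z (-1)%Z),
        (Sum (fun q => count_occ Ceq_dec (down q) w) 0%Z 1%Z).
      { rewrite Cnt. lia. }
      all: try (intros q N'; destruct (ZC q N') as [Z1 _]; rewrite Cnt in Z1; lia).
      1-5: change (- 0)%Z with 0%Z; change (- -1)%Z with 1%Z; change (- (1))%Z with (-1)%Z;
        rewrite ?Id; unfold K0 in HK; lia.
    + apply (flat_seq_occurs _ d0 LL snd w _ K0 NE). intros K HK.
      rewrite (sum_below_ext _ (fun k => count_occ Ceq_dec (Pl (shift 0%Z 0%Z (cell k))) w)).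
      2: { intros k. rewrite Snd, Id. reflexivity. }
      apply (Sum (fun q => count_occ Ceq_dec (Pl q) w) 0%Z 0%Z).
      * intros q N'. apply ZC, N'.
      * change (- 0)%Z with 0%Z. rewrite Id. unfold K0 in HK. lia.
  - intros n. destruct (flat_seq_In _ d0 LL NE n) as [k Ik].
    assert (I1 := in_map fst _ _ Ik). assert (I2 := in_map snd _ _ Ik).
    rewrite Fst in I1. rewrite Snd in I2.
    assert (Own : forall q x, (In x (right q) \/ In x (left q) \/ In x (up q) \/ In x (down q) \/ In x (stay q)) ->
      In x (Zl q)).
    { intros q x I. destruct (HF' q) as [-> _]. rewrite !in_app_iff. exact I. }
    unfold Al in I1. rewrite !in_app_iff in I1. destruct (cell k) as [i j].
    destruct I1 as [I1 | [I1 | [I1 | [I1 | I1]]]].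
    1: exists (i, j), (i, j).
    2: exists (shift (-1)%Z 0%Z (i, j)), (i, j).
    3: exists (shift 1%Z 0%Z (i, j)), (i, j).
    4: exists (shift 0%Z (-1)%Z (i, j)), (i, j).
    5: exists (shift 0%Z 1%Z (i, j)), (i, j).
    all: split; [unfold near, shift; cbn [fst snd]; lia | split; [apply Own; tauto | exact I2]].
Qed.

(** * Square grids *)

(** Cantor's argument: in step [n] the interval shrinks to the outer third on the side away from
    [u n]. *)
Lemma sequence_avoidable (u : nat -> R) : exists x, forall n, x <> u n.
Proof.
  set (step := fun (n : nat) (I : R * R) =>
    if Rle_dec (u n) ((fst I + snd I) / 2) then (fst I + 2 * (snd I - fst I) / 3, snd I)
    else (fst I, fst I + (snd I - fst I) / 3)).
  set (I := fix I n := match n with O => (0, 1) | S k => step k (I k) end).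
  assert (Pos : forall n, fst (I n) < snd (I n)).
  { induction n as [| n IH]; [simpl; lra |]. change (I (S n)) with (step n (I n)). unfold step.
    destruct (Rle_dec (u n) ((fst (I n) + snd (I n)) / 2)); simpl; lra. }
  destruct (nested_intervals (fun n => fst (I n)) (fun n => snd (I n))) as [x Hx].
  - intros n. specialize (Pos n). change (I (S n)) with (step n (I n)). unfold step.
    destruct (Rle_dec (u n) ((fst (I n) + snd (I n)) / 2)); simpl; lra.
  - exists x. intros n E. specialize (Hx (S n)). specialize (Pos n).
    change (I (S n)) with (step n (I n)) in Hx. unfold step in Hx.
    destruct (Rle_dec (u n) ((fst (I n) + snd (I n)) / 2)); simpl in Hx; lra.
Qed.

(** There are finitely many exceptional points in each square of half side [n], hence countably many
    offsets that would put one of them on some grid line; a single real number avoids them all. *)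
Lemma generic_offset (f : C -> option C) (T : R) (pr : C -> R) : meromorphic f ->
  exists x0, forall (w : C) (m i : Z), has_order f w m -> m <> 0%Z -> pr w <> x0 + IZR i * T.
Proof.
  intros Mf.
  assert (Ex : forall n : nat, exists l, forall w m,
    inrect (- INR n) (INR n) (- INR n) (INR n) w -> has_order f w m -> m <> 0%Z -> In w l).
  { intros n. assert (P := pos_INR n). apply finite_exceptional; auto; lra. }
  destruct (choice _ Ex) as [l Hl].
  destruct (sequence_avoidable (fun N => let p := Cantor.of_nat N in let q := Cantor.of_nat (snd p) in
    pr (nth (fst q) (l (fst p)) (RtoC 0)) - IZR (zdecode (snd q)) * T)) as [x Hx].
  exists x. intros w m i Hm Nm E.
  destruct (INR_unbounded (Rabs (fst w) + Rabs (snd w))) as [n Hn].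
  assert (I : In w (l n)).
  { apply (Hl n w m); auto. assert (A := Rabs_pos (fst w)). assert (B := Rabs_pos (snd w)).
    split; apply Rabs_le_between; lra. }
  destruct (In_nth _ _ (RtoC 0) I) as (k & _ & Ek).
  apply (Hx (Cantor.to_nat (n, Cantor.to_nat (k, zcode i)))).
  cbv zeta. rewrite Cantor.cancel_of_to. cbn [fst snd]. rewrite Cantor.cancel_of_to. cbn [fst snd].
  rewrite zdecode_zcode, Ek. lra.
Qed.

Lemma Inc_bound_long_segment (f : C -> option C) ell B : 0 < ell ->
  (forall (k w : C), k = RtoC 1 \/ k = Ci ->
    (forall s, 0 <= s <= ell -> has_order f (k * RtoC s + w)%C 0) ->
    forall th, Inc (fun s => fin f (k * RtoC s + w)%C) 0 ell th -> Rabs th <= B) ->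
  forall (M : nat) (k w : C), k = RtoC 1 \/ k = Ci ->
    (forall s, 0 <= s <= INR M * ell -> has_order f (k * RtoC s + w)%C 0) ->
    exists th, Inc (fun s => fin f (k * RtoC s + w)%C) 0 (INR M * ell) th /\ Rabs th <= INR M * B.
Proof.
  intros Hl HB M k w Hk.
  assert (Cont : forall t w, has_order f (k * RtoC t + w)%C 0 ->
    pcont (fun s => fin f (k * RtoC s + w)%C) t /\ fin f (k * RtoC t + w)%C <> 0%C).
  { intros t v Ht. destruct (order_0 f _ Ht) as (D & _ & N). split; [| exact N].
    apply (pcont_hor (fun z => fin f (k * z + v)%C) 0 t).
    apply cdiff_ccont, (cdiff_affine_comp (fin f)), D. }
  induction M as [| M IH]; intros HO.
  - destruct (Inc_exists (fun s => fin f (k * RtoC s + w)%C) 0 0) as [th I]; [lra | |].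
    + intros t Ht. apply Cont, HO. simpl; lra.
    + exists th. replace (INR 0 * ell) with 0 by (simpl; ring). split; [auto |].
      destruct I as (_ & phi & _ & ->). rewrite Rminus_diag, Rabs_R0. simpl; lra.
  - rewrite S_INR in *. assert (PM := pos_INR M).
    destruct IH as (t1 & I1 & B1); [intros s Hs; apply HO; nra |].
    set (c := INR M * ell). set (w' := (k * RtoC c + w)%C).
    assert (Ew : forall s, (k * RtoC (s + - c) + w')%C = (k * RtoC s + w)%C).
    { intros s. unfold w'. rewrite RtoC_plus, RtoC_opp. ring. }
    assert (HO' : forall s, 0 <= s <= ell -> has_order f (k * RtoC s + w')%C 0).
    { intros s Hs. replace s with (s + c + - c) by ring. rewrite Ew. apply HO. unfold c. nra. }
    destruct (Inc_exists (fun s => fin f (k * RtoC s + w')%C) 0 ell) as [t2 I2]; [lra | |].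
    { intros t Ht. apply Cont, HO', Ht. }
    assert (B2 : Rabs t2 <= B) by (apply (HB k w' Hk); auto).
    exists (t1 + t2). split.
    + apply (Inc_cat _ 0 c); [exact I1 |].
      apply (Inc_shift _ (- c)) in I2.
      replace (0 - - c) with c in I2 by ring.
      replace (ell - - c) with ((INR M + 1) * ell) in I2 by (unfold c; ring).
      eapply Inc_ext; [| exact I2]. intros s _. cbv beta. rewrite Ew. reflexivity.
    + assert (T := Rabs_triang t1 t2). lra.
Qed.

(** Each of the [t * t] subsquares of side [D] contains the disc of radius [K] around its centre,
    and so a zero. The zeros stay within less than [D / 2] of their centres in each coordinate,
    hence are distinct. Quotient and remainder by [t] index the subsquares. *)
Lemma many_zeros_in_square (f : C -> option C) K : 0 < K ->
  (forall w : C, exists p m, Cmod (p - w) < K /\ has_order f p m /\ (0 < m)%Z) ->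
  forall (t : nat) (D X Y : R) A B, 2 * K < D -> meromorphic f ->
    divisor_on f X (X + INR t * D) Y (Y + INR t * D) A B -> (t * t <= length A)%nat.
Proof.
  intros HK HZ t D X Y A B HD Mf [_ Div].
  set (ctr := fun ij : nat * nat => (X + (INR (fst ij) + / 2) * D, Y + (INR (snd ij) + / 2) * D) : C).
  destruct (choice (fun ij p => exists m, Cmod (p - ctr ij) < K /\ has_order f p m /\ (0 < m)%Z)) as [p Hp].
  { intros ij. destruct (HZ (ctr ij)) as (p & m & H). exists p, m. exact H. }
  assert (Near : forall ij, Rabs (fst (p ij) - fst (ctr ij)) < D / 2 /\ Rabs (snd (p ij) - snd (ctr ij)) < D / 2).
  { intros ij. destruct (Hp ij) as (m & H & _).
    assert (A1 := abs_fst_Cmod (p ij - ctr ij)). assert (A2 := abs_snd_Cmod (p ij - ctr ij)).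
    change (fst (p ij - ctr ij)%C) with (fst (p ij) - fst (ctr ij)) in A1.
    change (snd (p ij - ctr ij)%C) with (snd (p ij) - snd (ctr ij)) in A2. lra. }
  assert (Eq : forall a b : nat, Rabs ((INR a - INR b) * D) < D -> a = b).
  { intros a b H. rewrite Rabs_mult, (Rabs_pos_eq D) in H by lra.
    assert (L : Rabs (INR a - INR b) < 1) by nra. apply Rabs_def2 in L.
    destruct (Nat.lt_trichotomy a b) as [l | [e | g]]; [| auto |].
    - assert (INR a + 1 <= INR b) by (rewrite <- S_INR; apply le_INR; lia). lra.
    - assert (INR b + 1 <= INR a) by (rewrite <- S_INR; apply le_INR; lia). lra. }
  set (pts := map (fun n => p (Nat.div n t, Nat.modulo n t)) (seq 0 (t * t))).
  assert (Lp : length pts = (t * t)%nat) by (unfold pts; rewrite length_map, length_seq; auto).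
  rewrite <- Lp. destruct (Nat.eq_dec t 0) as [-> | Nt]; [simpl; lia |].
  apply NoDup_incl_length.
  - apply FinFun.Injective_map_NoDup; [| apply seq_NoDup]. intros n n' E.
    destruct (Near (Nat.div n t, Nat.modulo n t)) as [N1 N2].
    destruct (Near (Nat.div n' t, Nat.modulo n' t)) as [N1' N2'].
    rewrite E in N1, N2. unfold ctr in *; cbn [fst snd] in *.
    apply Rabs_def2 in N1, N2, N1', N2'.
    assert (E1 : Nat.div n t = Nat.div n' t) by (apply Eq, Rabs_def1; lra).
    assert (E2 : Nat.modulo n t = Nat.modulo n' t) by (apply Eq, Rabs_def1; lra).
    rewrite (Nat.div_mod_eq n t), (Nat.div_mod_eq n' t). congruence.
  - intros z Hz. apply in_map_iff in Hz. destruct Hz as (n & <- & Hn). apply in_seq in Hn.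
    set (i := Nat.div n t). set (j := Nat.modulo n t).
    assert (Hi : (i < t)%nat) by (apply Nat.Div0.div_lt_upper_bound; lia).
    assert (Hj : (j < t)%nat) by (apply Nat.mod_upper_bound; auto).
    destruct (Hp (i, j)) as (m & _ & Hm & Pm). destruct (Near (i, j)) as [N1 N2].
    destruct (Div (p (i, j)) m) as [Cnt _]; [| exact Hm | apply (count_occ_In Ceq_dec); lia].
    unfold ctr in N1, N2; cbn [fst snd] in N1, N2. apply Rabs_def2 in N1, N2.
    assert (INR i + 1 <= INR t) by (rewrite <- S_INR; apply le_INR; lia).
    assert (INR j + 1 <= INR t) by (rewrite <- S_INR; apply le_INR; lia).
    assert (Pi := pos_INR i). assert (Pj := pos_INR j).
    assert (0 <= INR i * D) by nra. assert (0 <= INR j * D) by nra.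
    assert ((INR i + 1) * D <= INR t * D) by (apply Rmult_le_compat_r; lra).
    assert ((INR j + 1) * D <= INR t * D) by (apply Rmult_le_compat_r; lra).
    split; lra.
Qed.

(** The increment differs from [beta - alpha] by [2 * PI * h], and that difference is at most
    [2 * PI] in modulus. So [h] is at most [B / (2 * PI) + 1], and [PI > 3] explains the 6. *)
Lemma flow_integer (w : R -> C) (a b th B : R) (N : nat) (alpha beta : R) :
  Inc w a b th -> Rabs th <= B -> B / 6 + 1 <= INR N ->
  - PI <= alpha <= PI /\ w a = polar (Cmod (w a)) alpha ->
  - PI <= beta <= PI /\ w b = polar (Cmod (w b)) beta ->
  exists h : Z, (Z.abs h <= Z.of_nat N)%Z /\ Inc w a b (beta - alpha + 2 * PI * IZR h).
Proof.
  intros I HB HN [Ha Ea] [Hb Eb].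
  destruct (Inc_integer w a b th alpha beta I Ea Eb) as [h E].
  exists h. split; [| rewrite <- E; exact I].
  apply le_IZR. rewrite abs_IZR, <- INR_IZR_INZ. assert (P := PI2_3_2).
  assert (Q : 2 * PI * Rabs (IZR h) <= B + 2 * PI).
  { rewrite <- (Rabs_pos_eq (2 * PI)) at 1 by lra. rewrite <- Rabs_mult.
    replace (2 * PI * IZR h) with (th + (alpha - beta)) by lra.
    eapply Rle_trans; [apply Rabs_triang |].
    assert (Rabs (alpha - beta) <= 2 * PI) by (apply Rabs_le; lra). lra. }
  assert (HB0 : 0 <= B) by (eapply Rle_trans; [apply Rabs_pos | eauto]).
  apply Rnot_lt_le. intros L. assert (B / 6 + 1 < Rabs (IZR h)) by lra. nra.
Qed.

Lemma between_consecutive (x0 T x : R) : 0 < T -> exists i : Z, x0 + IZR i * T <= x <= x0 + IZR (i + 1) * T.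
Proof.
  intros HT. destruct (archimed ((x - x0) / T)) as [A1 A2].
  exists (up ((x - x0) / T) - 1)%Z. replace (up ((x - x0) / T) - 1 + 1)%Z with (up ((x - x0) / T)) by lia.
  rewrite minus_IZR. assert (E : (x - x0) / T * T = x - x0) by (field; lra). nra.
Qed.

(** Two different cells meet only on grid lines. Combined with [generic_offset], this places each
    zero or pole in exactly one cell. *)
Lemma consecutive_overlap (x0 T x : R) (i j : Z) : 0 < T -> i <> j ->
  x0 + IZR i * T <= x <= x0 + IZR (i + 1) * T -> x0 + IZR j * T <= x <= x0 + IZR (j + 1) * T ->
  exists k : Z, x = x0 + IZR k * T.
Proof.
  intros HT N H1 H2. assert (Mono : forall a b, (a <= b)%Z -> IZR a * T <= IZR b * T).
  { intros a b L. apply Rmult_le_compat_r; [lra | apply IZR_le, L]. }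
  destruct (Z.lt_total i j) as [L | [L | L]]; [| lia |].
  - exists j. assert (Q := Mono (i + 1)%Z j ltac:(lia)). lra.
  - exists i. assert (Q := Mono (j + 1)%Z i ltac:(lia)). lra.
Qed.

Theorem mainTheorem6 :
  forall f : Cpx -> option Cpx, almost_elliptic f ->
    exists a b : nat -> Cpx,
      (forall (w : Cpx) (m : Z), has_order f w m ->
         occurs_exactly a w (Z.to_nat m) /\ occurs_exactly b w (Z.to_nat (- m))) /\
      exists M : R, forall n : nat, Cnorm (Csub (a n) (b n)) <= M.
Proof.
  intros f AE. assert (Mf := proj1 AE).
  destruct (Inc_bound_segment f AE) as (ell & B & Hl & HB0 & HB).
  destruct (zeros_recur f AE) as (K & HK & HZ).
  (* The flow across a side of a square of side [t * m1 * ell] is at most [t * c + 2], which is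
     eventually dwarfed by the [t * t] zeros of the square. *)
  destruct (INR_unbounded (2 * K / ell)) as [m1 Hm1].
  destruct (INR_unbounded (INR m1 * B / 6)) as [c Hc].
  set (t := (4 * c + 9)%nat). set (Nb := (t * c + 2)%nat). set (D := INR m1 * ell).
  assert (Pc := pos_INR c). assert (Pm := pos_INR m1).
  assert (HD : 2 * K < D).
  { unfold D. apply Rle_lt_trans with (2 * K / ell * ell); [right; field; lra |].
    apply Rmult_lt_compat_r; lra. }
  assert (Pt : 0 < INR t) by (apply lt_0_INR; unfold t; lia).
  set (T := INR t * D). assert (HT : 0 < T) by (apply Rmult_lt_0_compat; lra).
  assert (ET : T = INR (t * m1) * ell) by (unfold T, D; rewrite mult_INR; ring).
  assert (BN : INR (t * m1) * B / 6 + 1 <= INR Nb).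
  { unfold Nb. rewrite plus_INR, !mult_INR. simpl (INR 2).
    assert (INR t * (INR m1 * B / 6) <= INR t * INR c) by (apply Rmult_le_compat_l; lra). lra. }
  destruct (generic_offset f T fst Mf) as [x0 Gx].
  destruct (generic_offset f T snd Mf) as [y0 Gy].
  set (X := fun i : Z => x0 + IZR i * T). set (Y := fun j : Z => y0 + IZR j * T).
  assert (SX : forall i, X (i + 1)%Z = X i + T) by (intros i; unfold X; rewrite plus_IZR; ring).
  assert (SY : forall j, Y (j + 1)%Z = Y j + T) by (intros j; unfold Y; rewrite plus_IZR; ring).
  assert (OX : forall i s, has_order f (X i, s) 0).
  { intros i s. destruct (Mf (X i, s)) as [m Hm]. destruct (Z.eq_dec m 0) as [-> | N]; [auto |].
    exfalso. apply (Gx _ m i Hm N). reflexivity. }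
  assert (OY : forall j s, has_order f (s, Y j) 0).
  { intros j s. destruct (Mf (s, Y j)) as [m Hm]. destruct (Z.eq_dec m 0) as [-> | N]; [auto |].
    exfalso. apply (Gy _ m j Hm N). reflexivity. }
  (* One argument for each point, hence the same one at a vertex for all sides that meet there:
     around a cell the terms in [v] cancel and only the integers remain. *)
  destruct (choice _ polar_exists) as [ph Hph].
  set (v := fun i j : Z => ph (fin f (X i, Y j))).
  assert (EH : forall q : Z * Z, exists h : Z, (Z.abs h <= Z.of_nat Nb)%Z /\
    Inc (hor (fin f) (Y (snd q))) (X (fst q)) (X (fst q + 1)%Z)
      (v (fst q + 1)%Z (snd q) - v (fst q) (snd q) + 2 * PI * IZR h)).
  { intros [i j]. cbn [fst snd].
    assert (EP : forall s, (1 * RtoC s + (X i, Y j))%C = (s + X i, Y j)).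
    { intros s. apply injective_projections; simpl; ring. }
    destruct (Inc_bound_long_segment f ell B Hl HB (t * m1) 1%C (X i, Y j)) as (th & I & Bth); [auto | |].
    { intros s _. rewrite EP. apply OY. }
    rewrite <- ET in I. apply (Inc_shift _ (- X i)) in I.
    replace (0 - - X i) with (X i) in I by ring. replace (T - - X i) with (X (i + 1)%Z) in I by (rewrite SX; ring).
    assert (I' : Inc (hor (fin f) (Y j)) (X i) (X (i + 1)%Z) th).
    { eapply Inc_ext; [| exact I]. intros s _. cbv beta. rewrite EP. unfold hor. f_equal. f_equal. ring. }
    apply (flow_integer (hor (fin f) (Y j)) _ _ _ _ _ _ _ I' Bth BN); apply Hph. }
  assert (EV : forall q : Z * Z, exists h : Z, (Z.abs h <= Z.of_nat Nb)%Z /\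
    Inc (ver (fin f) (X (fst q))) (Y (snd q)) (Y (snd q + 1)%Z)
      (v (fst q) (snd q + 1)%Z - v (fst q) (snd q) + 2 * PI * IZR h)).
  { intros [i j]. cbn [fst snd].
    assert (EP : forall s, (Ci * RtoC s + (X i, Y j))%C = (X i, s + Y j)).
    { intros s. apply injective_projections; simpl; ring. }
    destruct (Inc_bound_long_segment f ell B Hl HB (t * m1) Ci (X i, Y j)) as (th & I & Bth); [auto | |].
    { intros s _. rewrite EP. apply OX. }
    rewrite <- ET in I. apply (Inc_shift _ (- Y j)) in I.
    replace (0 - - Y j) with (Y j) in I by ring. replace (T - - Y j) with (Y (j + 1)%Z) in I by (rewrite SY; ring).
    assert (I' : Inc (ver (fin f) (X i)) (Y j) (Y (j + 1)%Z) th).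
    { eapply Inc_ext; [| exact I]. intros s _. cbv beta. rewrite EP. unfold ver. f_equal. f_equal. ring. }
    apply (flow_integer (ver (fin f) (X i)) _ _ _ _ _ _ _ I' Bth BN); apply Hph. }
  destruct (choice _ EH) as [H HH]. destruct (choice _ EV) as [V HV].
  assert (ED : forall q : Z * Z, exists L : list C * list C,
    divisor_on f (X (fst q)) (X (fst q + 1)%Z) (Y (snd q)) (Y (snd q + 1)%Z) (fst L) (snd L)).
  { intros q. destruct (factorization f (X (fst q)) (X (fst q + 1)%Z) (Y (snd q)) (Y (snd q + 1)%Z))
      as (A & P & _ & Dv & _); auto; [rewrite SX; lra | rewrite SY; lra |].
    exists (A, P). exact Dv. }
  destruct (choice _ ED) as [L HL].
  destruct (transport_along_flow (fun q => fst (L q)) (fun q => snd (L q))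
    (fun i j => H (i, j)) (fun i j => V (i, j)) Nb) as (a & b & Occ & Adj).
  - intros i j. apply HH.
  - intros i j. apply HV.
  - intros i j. specialize (HL (i, j)). cbn [fst snd] in HL.
    assert (HXi : X i <= X (i + 1)%Z) by (rewrite SX; lra).
    assert (HYj : Y j <= Y (j + 1)%Z) by (rewrite SY; lra).
    assert (Bd : forall z, bdry (X i) (X (i + 1)%Z) (Y j) (Y (j + 1)%Z) z -> has_order f z 0).
    { intros z [[[Z1 Z2] [Z3 Z4]] Z5]. rewrite (surjective_pairing z).
      destruct (Req_dec (fst z) (X i)) as [-> | N1]; [apply OX |].
      destruct (Req_dec (fst z) (X (i + 1)%Z)) as [-> | N2]; [apply OX |].
      destruct (Req_dec (snd z) (Y j)) as [-> | N3]; [apply OY |].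
      destruct (Req_dec (snd z) (Y (j + 1)%Z)) as [-> | N4]; [apply OY |].
      exfalso. apply Z5. split; lra. }
    assert (W1 := argument_principle f _ _ _ _ _ _ HXi HYj Mf Bd HL).
    assert (W2 : Wind (fin f) (X i) (X (i + 1)%Z) (Y j) (Y (j + 1)%Z)
      (2 * PI * (IZR (H (i, j)) + IZR (V ((i + 1)%Z, j)) - IZR (H (i, (j + 1)%Z)) - IZR (V (i, j))))).
    { destruct (HH (i, j)) as [_ I1], (HH (i, (j + 1)%Z)) as [_ I3].
      destruct (HV ((i + 1)%Z, j)) as [_ I2], (HV (i, j)) as [_ I4].
      do 4 eexists. split; [exact I1 |]. split; [exact I2 |]. split; [exact I3 |]. split; [exact I4 |].
      cbn [fst snd]. ring. }
    assert (E := Wind_unique _ _ _ _ _ _ _ W1 W2). assert (PP := PI_RGT_0).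
    apply Rmult_eq_reg_l in E; [| lra]. rewrite !INR_IZR_INZ in E.
    apply eq_IZR. rewrite !minus_IZR, plus_IZR. exact E.
  - intros q. specialize (HL q).
    assert (Q := many_zeros_in_square f K HK HZ t D (X (fst q)) (Y (snd q)) (fst (L q)) (snd (L q)) HD Mf).
    (* The choice of [t] gives [t * t = 4 * t * c + 9 * t], while [4 * Nb + 1 = 4 * t * c + 9]. *)
    fold T in Q. rewrite <- SX, <- SY in Q. specialize (Q HL). unfold Nb. unfold t in *. nia.
  - assert (Ord : forall q w, In w (fst (L q)) \/ In w (snd (L q)) ->
      inrect (X (fst q)) (X (fst q + 1)%Z) (Y (snd q)) (Y (snd q + 1)%Z) w /\
      exists m, has_order f w m /\ m <> 0%Z).
    { intros q w I. destruct (HL q) as [D1 D2]. split; [apply D1, I |].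
      destruct (Mf w) as [m Hm]. exists m. split; [auto |]. intros ->.
      destruct (D2 w 0%Z (D1 w I) Hm) as [E1 E2]. simpl in E1, E2.
      apply (count_occ_not_In Ceq_dec) in E1. apply (count_occ_not_In Ceq_dec) in E2. tauto. }
    exists a, b. split.
    + intros w m Hm.
      destruct (between_consecutive x0 T (fst w) HT) as [i Hi].
      destruct (between_consecutive y0 T (snd w) HT) as [j Hj].
      destruct (HL (i, j)) as [_ D2]. cbn [fst snd] in D2.
      destruct (D2 w m (conj Hi Hj) Hm) as [E1 E2]. rewrite <- E1, <- E2.
      apply (Occ w (i, j)). intros [i' j'] Nq.
      (* Listed points have nonzero order, whereas a point common to two cells lies on a grid line,
         where every order is 0. *)
      assert (Out : ~ (In w (fst (L (i', j'))) \/ In w (snd (L (i', j'))))).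
      { intros I. destruct (Ord _ _ I) as ([Hi' Hj'] & k & Hk & Nk). cbn [fst snd] in Hi', Hj'.
        destruct (Z.eq_dec i i') as [<- | Ni].
        - assert (Nj : j <> j') by congruence.
          destruct (consecutive_overlap y0 T (snd w) j j' HT Nj Hj Hj') as [l El].
          apply (Gy w k l Hk Nk El).
        - destruct (consecutive_overlap x0 T (fst w) i i' HT Ni Hi Hi') as [l El].
          apply (Gx w k l Hk Nk El). }
      tauto.
    (* Partners lie in the same or in adjacent cells of side [T], so each coordinate differs by at
       most [2 * T]. *)
    + exists (2 * T + 2 * T). intros n. rewrite Cnorm_Cmod.
      destruct (Adj n) as ([i j] & [i' j'] & [N1 N2] & Ia & Ib). cbn [fst snd] in N1, N2.
      destruct (Ord _ _ (or_introl Ia)) as [[A1 A2] _], (Ord _ _ (or_intror Ib)) as [[B1 B2] _].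
      cbn [fst snd] in A1, A2, B1, B2. rewrite SX in A1, B1. rewrite SY in A2, B2.
      assert (Cl : forall p q : Z, (Z.abs (p - q) <= 1)%Z -> Rabs (IZR p * T - IZR q * T) <= T).
      { intros p q Hpq. rewrite <- Rmult_minus_distr_r, <- minus_IZR, Rabs_mult, <- abs_IZR, (Rabs_pos_eq T) by lra.
        apply IZR_le in Hpq. rewrite <- (Rmult_1_l T) at 2. apply Rmult_le_compat_r; lra. }
      assert (Q1 := Cl i i' N1). assert (Q2 := Cl j j' N2).
      apply Rabs_le_between in Q1. apply Rabs_le_between in Q2. unfold X, Y in *.
      apply (Cmod_le_sides (a n) (b n)); apply Rabs_le; lra.
Qed.
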